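(* Assume $\alpha\ne0$. Then the viscosity solutions (in the sense of the definition in the context, called type I) in $Q_T=\Omega\times(0,T)$ of $u_t-F(x,\nabla u,D^2u)-h(x,t)\cdot\nabla u|\nabla u|^\alpha=0$ are the same as the solutions of this equation in the sense of Ohnuma and Sato (type II): a continuous function on $Q_T$ is a type I solution if and only if it is a type II solution.
   Context: $S$ denotes the real symmetric $N\times N$ matrices, $T>0$, $\alpha>-1$, $0<a\le A$ are constants, $\Omega\subset\mathbb R^N$ is a bounded domain with the uniform exterior cone condition: there are $\phi\in(0,\pi)$, $\bar r>0$ such that for every $z\in\partial\Omega$ there is a unit vector $\vec n_z$ with $T_\phi\cap\overline\Omega\cap B_{\bar r}(z)=\{z\}$, where $T_\phi=\{z\}\cup\{x\ne z:\frac{(x-z)\cdot\vec n_z}{|x-z|}\le\cos\phi\}$. Assumptions on $F:\Omega\times(\mathbb R^N\setminus\{0\})\times S\to\mathbb R$: (1) $F$ is continuous and $F(x,tp,\mu X)=|t|^\alpha\mu F(x,p,X)$ for all $t\in\mathbb R\setminus\{0\}$, $\mu\ge0$, $x\in\Omega$, $p\ne0$, $X\in S$. (2) For $x\in\Omega$, $p\neq0$, $M,N\in S$, $N\ge0$: $a|p|^\alpha\mathrm{tr}(N)\le F(x,p,M+N)-F(x,p,M)\le A|p|^\alpha\mathrm{tr}(N)$. (3) There is a continuous $\omega$ with $\omega(0)=0$ such that if $X,Y\in S$, $\zeta\ge0$ satisfy $-\zeta\begin{pmatrix}I&0\\0&I\end{pmatrix}\le\begin{pmatrix}X&0\\0&Y\end{pmatrix}\le4\zeta\begin{pmatrix}I&-I\\-I&I\end{pmatrix}$,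 then for all $x\ne y$ in $\Omega$: $F(x,\zeta(x-y),X)-F(y,\zeta(x-y),-Y)\le\omega(\zeta|x-y|^2)$. Assumptions on $h:Q_T\to\mathbb R^N$: $h$ is continuous and bounded; there are $c_h>0$, $\omega_h\in(0,1]$ with $|h(x,t)-h(x,s)|\le c_h|t-s|^{\omega_h}$; and, for all $x,y\in\Omega$, $t\in(0,T)$: if $\alpha\le0$, $|h(x,t)-h(y,t)|\le c_h|x-y|^{1+\alpha}$; if $\alpha>0$, $(h(x,t)-h(y,t))\cdot(x-y)\le0$. Type I. A continuous $u$ is a type I subsolution if for every $(\bar x,\bar t)\in Q_T$: (i) for every $C^2$ function $\varphi$ touching $u$ from above at $(\bar x,\bar t)$ with $\nabla_x\varphi(\bar x,\bar t)\ne0$, one has $\varphi_t-F(\bar x,\nabla\varphi,D^2\varphi)-h\cdot\nabla\varphi|\nabla\varphi|^\alpha\le0$ at $(\bar x,\bar t)$; (ii) whenever there are $\delta_1>0$ and $\varphi\in C^2((\bar t-\delta_1,\bar t+\delta_1))$ with $\varphi(\bar t)=0$, $u(\bar x,\bar t)\ge u(\bar x,t)-\varphi(t)$ for $|t-\bar t|<\delta_1$, and $x\mapsto\sup_{|t-\bar t|<\delta_1}(u(x,t)-\varphi(t))$ constant in a neighborhood of $\bar x$, then $\varphi'(\bar t)\le0$. Type I supersolution: the same with ''touching from below'', all inequalities reversed, and $\inf$ instead of $\sup$. A type I solution is a continuous function that is both. Type II. Let $\mathcal F(F)$ be the set of $f\in C^2([0,\infty))$ with $f(0)=f'(0)=f''(0)=0$,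 $f''(r)>0$ for $r>0$, and $\lim_{x\to0,x\ne0}F(x_0,\nabla[f(|x|)],D^2[f(|x|)])=\lim_{x\to0,x\ne0}F(x_0,-\nabla[f(|x|)],-D^2[f(|x|)])=0$ for every $x_0\in\Omega$. Let $\mathcal A(F)$ (admissible test functions) be the set of $\varphi\in C^2(Q_T)$ such that for every $(\bar x,\bar t)$ with $\nabla_x\varphi(\bar x,\bar t)=0$ there are $\delta>0$, $f\in\mathcal F(F)$ and a continuous $\omega_1:[0,\infty)\to[0,\infty)$ with $\omega_1(0)=0$, $\omega_1(r)=o(r)$ as $r\to0$, such that $|\varphi(x,t)-\varphi(\bar x,\bar t)-\partial_t\varphi(\bar x,\bar t)(t-\bar t)|\le f(|x-\bar x|)+\omega_1(|t-\bar t|)$ for $|x-\bar x|+|t-\bar t|<\delta$. A continuous $u$ is a type II subsolution if for every $\varphi\in\mathcal A(F)$ and every local maximum point $(\bar x,\bar t)$ of $u-\varphi$: $\varphi_t-F(\bar x,\nabla\varphi,D^2\varphi)-h\cdot\nabla\varphi|\nabla\varphi|^\alpha\le0$ at $(\bar x,\bar t)$ if $\nabla_x\varphi(\bar x,\bar t)\ne0$, and $\varphi_t(\bar x,\bar t)\le0$ if $\nabla_x\varphi(\bar x,\bar t)=0$. Type II supersolutions: local minimum points and reversed inequalities. A type II solution is both. *)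

(* Defs.v *)
From HB Require Import structures.
From mathcomp Require Import all_boot all_order all_algebra.
From mathcomp Require Import all_classical all_reals all_analysis.

Set Implicit Arguments.
Unset Strict Implicit.
Unset Printing Implicit Defensive.

Import Order.TTheory GRing.Theory Num.Theory.
Import numFieldNormedType.Exports.

Local Open Scope classical_set_scope.
Local Open Scope ring_scope.

Section Euclidean.
Variables (R : realType) (N : nat).

Definition dotp (p q : 'rV[R]_N) : R := \sum_(i < N) p 0 i * q 0 i.

(* The library norm on 'rV[R]_N is the sup norm; it induces the same topology
   and bounded sets, but |.| in the formulas below is this Euclidean norm. *)
Definition enorm (p : 'rV[R]_N) : R := Num.sqrt (dotp p p).

Definition grad (g : 'rV[R]_N -> R) (x : 'rV[R]_N) : 'rV[R]_N :=
  \row_i 'D_(delta_mx 0 i) g x.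

Definition hess (g : 'rV[R]_N -> R) (x : 'rV[R]_N) : 'M[R]_N :=
  \matrix_(i, j) 'D_(delta_mx 0 i) ('D_(delta_mx 0 j) g) x.

Definition symmetric_mx (X : 'M[R]_N) : Prop := X^T = X.

End Euclidean.

(* Order on symmetric matrices: B - A is positive semidefinite. *)
Definition mxle (R : realType) (n : nat) (A B : 'M[R]_n) : Prop :=
  forall v : 'rV[R]_n, 0 <= (v *m (B - A) *m v^T) 0 0.

(* f is C^2 on the open set U; all directions v, w are allowed, which by
   linearity amounts to the partial derivatives of order one and two. *)
Definition C2_on (R : realType) (V : normedModType R) (U : set V)
    (f : V -> R) : Prop :=
  {within U, continuous f} /\
  forall v w : V,
    [/\ forall x, U x -> derivable f x v,
        {within U, continuous ('D_v f)},
        forall x, U x -> derivable ('D_v f) x w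
      & {within U, continuous ('D_w ('D_v f))}].

(* f' = g on [0, +oo[, with the one-sided derivative at 0. *)
Definition deriv_on_halfline (R : realType) (f g : R -> R) : Prop :=
  forall r : R, 0 <= r ->
    (f s - f r) / (s - r) @[s --> within [set s | 0 <= s] r^'] --> g r.

(* f is C^2 on [0, +oo[ with f' = f1 and f'' = f2. *)
Definition C2_halfline (R : realType) (f f1 f2 : R -> R) : Prop :=
  [/\ deriv_on_halfline f f1, deriv_on_halfline f1 f2
    & {within `[0, +oo[, continuous f2}].

Section Domain.
Variables (R : realType) (N : nat) (Omega : set 'rV[R]_N).

Definition bounded_domain : Prop :=
  [/\ Omega !=set0, open Omega, connected Omega & bounded_set Omega].

Definition cone (phi : R) (z n : 'rV[R]_N) : set 'rV[R]_N :=
  [set z] `|` [set x | x != z /\ dotp (x - z) n / enorm (x - z) <= cos phi].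

Definition exterior_cone_condition : Prop :=
  exists phi rbar : R, [/\ 0 < phi, phi < pi, 0 < rbar &
    forall z : 'rV[R]_N, (closure Omega `\` interior Omega) z ->
      exists2 n : 'rV[R]_N, enorm n = 1 &
        cone phi z n `&` closure Omega `&` [set x | enorm (x - z) < rbar]
          = [set z]].

End Domain.

Definition cylinder (R : realType) (N : nat) (Omega : set 'rV[R]_N) (T : R) :
    set ('rV[R]_N * R) :=
  [set z | Omega z.1 /\ 0 < z.2 < T].

(* F is a total function, but only its values on
   Omega * (R^N \ {0}) * {symmetric matrices} are ever constrained or used. *)
Section Assumptions_F.
Variables (R : realType) (N : nat) (Omega : set 'rV[R]_N).
Variables (alpha a A : R) (F : 'rV[R]_N -> 'rV[R]_N -> 'M[R]_N -> R).

Definition F_continuous : Prop :=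
  {within [set z : 'rV[R]_N * 'rV[R]_N * 'M[R]_N |
             [/\ Omega z.1.1, z.1.2 != 0 & symmetric_mx z.2]],
    continuous (fun z => F z.1.1 z.1.2 z.2)}.

Definition F_homogeneous : Prop :=
  forall (t mu : R) (x p : 'rV[R]_N) (X : 'M[R]_N),
    t != 0 -> 0 <= mu -> Omega x -> p != 0 -> symmetric_mx X ->
    F x (t *: p) (mu *: X) = `|t| `^ alpha * mu * F x p X.

Definition F_elliptic : Prop :=
  forall (x p : 'rV[R]_N) (M P : 'M[R]_N),
    Omega x -> p != 0 -> symmetric_mx M -> symmetric_mx P -> mxle 0 P ->
    a * enorm p `^ alpha * \tr P <= F x p (M + P) - F x p M
      <= A * enorm p `^ alpha * \tr P.

(* zeta = 0 is left out: F x (zeta *: (x - y)) _ would then be evaluated at a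
   zero gradient, outside the domain of F. *)
Definition F_structure : Prop :=
  exists w : R -> R, [/\ {within `[0, +oo[, continuous w}, w 0 = 0 &
    forall (X Y : 'M[R]_N) (zeta : R),
      symmetric_mx X -> symmetric_mx Y -> 0 < zeta ->
      mxle (- zeta *: block_mx 1%:M 0 0 1%:M) (block_mx X 0 0 Y) ->
      mxle (block_mx X 0 0 Y)
        ((4 * zeta) *: block_mx 1%:M (- 1%:M) (- 1%:M) 1%:M) ->
      forall x y : 'rV[R]_N, Omega x -> Omega y -> x != y ->
        F x (zeta *: (x - y)) X - F y (zeta *: (x - y)) (- Y)
          <= w (zeta * enorm (x - y) ^+ 2)].

End Assumptions_F.

Section Assumptions_h.
Variables (R : realType) (N : nat) (Omega : set 'rV[R]_N) (T alpha : R).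
Variable h : 'rV[R]_N * R -> 'rV[R]_N.

Definition h_assumptions : Prop :=
  [/\ {within cylinder Omega T, continuous h},
      exists M : R, forall z, cylinder Omega T z -> enorm (h z) <= M
    & exists c_h w_h : R, [/\ 0 < c_h, 0 < w_h <= 1,
        forall x t s, cylinder Omega T (x, t) -> cylinder Omega T (x, s) ->
          enorm (h (x, t) - h (x, s)) <= c_h * `|t - s| `^ w_h
      & forall x y t, cylinder Omega T (x, t) -> cylinder Omega T (y, t) ->
          (alpha <= 0 ->
             enorm (h (x, t) - h (y, t)) <= c_h * enorm (x - y) `^ (1 + alpha))
          /\ (0 < alpha -> dotp (h (x, t) - h (y, t)) (x - y) <= 0)]].

End Assumptions_h.

Section Solutions.
Variables (R : realType) (N : nat) (Omega : set 'rV[R]_N) (T alpha : R).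
Variable F : 'rV[R]_N -> 'rV[R]_N -> 'M[R]_N -> R.
Variable h : 'rV[R]_N * R -> 'rV[R]_N.

Local Notation QT := (cylinder Omega T).

Definition dtime (phi : 'rV[R]_N * R -> R) (z : 'rV[R]_N * R) : R :=
  derive1 (fun t => phi (z.1, t)) z.2.

Definition gradx (phi : 'rV[R]_N * R -> R) (z : 'rV[R]_N * R) : 'rV[R]_N :=
  grad (fun x => phi (x, z.2)) z.1.

Definition hessx (phi : 'rV[R]_N * R -> R) (z : 'rV[R]_N * R) : 'M[R]_N :=
  hess (fun x => phi (x, z.2)) z.1.

Definition pde (phi : 'rV[R]_N * R -> R) (z : 'rV[R]_N * R) : R :=
  dtime phi z - F z.1 (gradx phi z) (hessx phi z)
  - dotp (h z) (gradx phi z) * enorm (gradx phi z) `^ alpha.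

Definition touches_above (u phi : 'rV[R]_N * R -> R) (z : 'rV[R]_N * R) :=
  phi z = u z /\ \forall y \near z, u y <= phi y.

Definition touches_below (u phi : 'rV[R]_N * R -> R) (z : 'rV[R]_N * R) :=
  phi z = u z /\ \forall y \near z, phi y <= u y.

(* The sup and inf over time are taken in \bar R: they need not be finite
   before they are known to be constant. *)
Definition typeI_subsolution (u : 'rV[R]_N * R -> R) : Prop :=
  {within QT, continuous u} /\
  forall xb tb, QT (xb, tb) ->
    (forall (U : set ('rV[R]_N * R)) (phi : 'rV[R]_N * R -> R),
       open_nbhs (xb, tb) U -> C2_on U phi ->
       touches_above u phi (xb, tb) -> gradx phi (xb, tb) != 0 ->
       pde phi (xb, tb) <= 0) /\
    (forall (d : R) (phi : R -> R), 0 < d ->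
       `]tb - d, tb + d[ `<=` `]0, T[ ->
       C2_on (`]tb - d, tb + d[ : set R) phi -> phi tb = 0 ->
       (forall t, `|t - tb| < d -> u (xb, t) - phi t <= u (xb, tb)) ->
       (exists c : \bar R, \forall x \near xb,
          ereal_sup [set (u (x, t) - phi t)%:E | t in [set t | `|t - tb| < d]]
            = c) ->
       derive1 phi tb <= 0).

Definition typeI_supersolution (u : 'rV[R]_N * R -> R) : Prop :=
  {within QT, continuous u} /\
  forall xb tb, QT (xb, tb) ->
    (forall (U : set ('rV[R]_N * R)) (phi : 'rV[R]_N * R -> R),
       open_nbhs (xb, tb) U -> C2_on U phi ->
       touches_below u phi (xb, tb) -> gradx phi (xb, tb) != 0 ->
       0 <= pde phi (xb, tb)) /\
    (forall (d : R) (phi : R -> R), 0 < d ->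
       `]tb - d, tb + d[ `<=` `]0, T[ ->
       C2_on (`]tb - d, tb + d[ : set R) phi -> phi tb = 0 ->
       (forall t, `|t - tb| < d -> u (xb, tb) <= u (xb, t) - phi t) ->
       (exists c : \bar R, \forall x \near xb,
          ereal_inf [set (u (x, t) - phi t)%:E | t in [set t | `|t - tb| < d]]
            = c) ->
       0 <= derive1 phi tb).

Definition typeI_solution (u : 'rV[R]_N * R -> R) : Prop :=
  typeI_subsolution u /\ typeI_supersolution u.

Definition classF (f : R -> R) : Prop :=
  exists f1 f2 : R -> R,
    [/\ C2_halfline f f1 f2, [/\ f 0 = 0, f1 0 = 0 & f2 0 = 0],
        forall r : R, 0 < r -> 0 < f2 r
      & let g (x : 'rV[R]_N) := f (enorm x) in
        forall x0, Omega x0 ->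
          F x0 (grad g x) (hess g x) @[x --> (0 : 'rV[R]_N)^'] --> (0 : R) /\
          F x0 (- grad g x) (- hess g x) @[x --> (0 : 'rV[R]_N)^']
            --> (0 : R)].

Definition admissible (phi : 'rV[R]_N * R -> R) : Prop :=
  C2_on QT phi /\
  forall xb tb, QT (xb, tb) -> gradx phi (xb, tb) = 0 ->
    exists (d : R) (f w1 : R -> R),
      [/\ 0 < d, classF f,
          [/\ {within `[0, +oo[, continuous w1},
              forall r : R, 0 <= r -> 0 <= w1 r, w1 0 = 0
            & w1 r / r @[r --> 0^'+] --> (0 : R)]
        & forall x t, QT (x, t) -> enorm (x - xb) + `|t - tb| < d ->
            `|phi (x, t) - phi (xb, tb) - dtime phi (xb, tb) * (t - tb)|
              <= f (enorm (x - xb)) + w1 `|t - tb|].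

Definition typeII_subsolution (u : 'rV[R]_N * R -> R) : Prop :=
  {within QT, continuous u} /\
  forall phi, admissible phi -> forall z, QT z ->
    (\forall y \near z, u y - phi y <= u z - phi z) ->
    (gradx phi z != 0 -> pde phi z <= 0) /\
    (gradx phi z = 0 -> dtime phi z <= 0).

Definition typeII_supersolution (u : 'rV[R]_N * R -> R) : Prop :=
  {within QT, continuous u} /\
  forall phi, admissible phi -> forall z, QT z ->
    (\forall y \near z, u z - phi z <= u y - phi y) ->
    (gradx phi z != 0 -> 0 <= pde phi z) /\
    (gradx phi z = 0 -> 0 <= dtime phi z).

Definition typeII_solution (u : 'rV[R]_N * R -> R) : Prop :=
  typeII_subsolution u /\ typeII_supersolution u.

End Solutions.

(* Main.v *)
(** It suffices to identify the subsolutions of both types: [u] is a supersolution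
    for [F] iff [-u] is a subsolution for [(x, p, X) |-> - F x (-p) (-X)].

    Type II to type I.  A C^2 function with gradient [p <> 0] at the contact point
    is dominated there by a quadratic polynomial whose quadratic part in [x] is
    then composed with [y_i |-> d sin (y_i / d)]; for small [d] its gradient
    vanishes nowhere, so it is admissible.  In the clause on zero gradients the
    constancy of the supremum turns a function of [t] alone into a test function,
    admissible because [r |-> r ^ k] is a profile for large [k].

    Type I to type II.  Suppose the gradient vanishes at the contact point
    [(xb, tb)] and [tau := phi_t > 0].  For [y] near [xb] maximise
    [u - tau (t - tb) - K (t - tb)^2 - 2 f(|x - y|)] over a small cylinder, [K]
    being such that the maximum is interior.  If it is attained at some [x <> y],
    clause (i) is violated, because ellipticity and [f \in F(F)] make the elliptic
    and drift terms smaller than [tau / 2].  So it is always attained at [x = y];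
    its value [v] then satisfies [|v x - v y| <= 2 f(|x - y|) = o(|x - y|)], hence
    is constant, and clause (ii) is violated. *)

Require Import Defs.
From HB Require Import structures.
From mathcomp Require Import all_boot all_order all_algebra.
From mathcomp Require Import all_classical all_reals all_analysis.
From mathcomp Require Import ring lra.

Import Order.TTheory GRing.Theory Num.Theory.
Import numFieldNormedType.Exports.

Local Open Scope classical_set_scope.
Local Open Scope ring_scope.

Set Implicit Arguments.
Unset Strict Implicit.
Unset Printing Implicit Defensive.

(** * Functions of class C^k along all directions *)

(** Admissibility constrains a test function at each of its critical points in Q_T, while touching
    is a local notion. A quadratic polynomial with gradient [p <> 0] at the contact point usually
    has critical points elsewhere; bounding the coordinates by a sine keeps its gradient close to
    [p] on the whole space. A mixed term in [x] and [t] would spoil this, so it is left out: a small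
    multiple of the identity added to the Hessian and a large coefficient of [(t - tb)^2] compensate
    for it, and ellipticity lets the multiple tend to 0.

    In the converse direction the equation says nothing at a zero gradient, whence the moving apex
    [y], which tests [u] at nearby points. Near [xb] the function [u] may itself rise like
    [f(|x - xb|)]; doubling the profile leaves a margin of order [f r] on the lateral boundary of a
    cylinder of radius [r]. This margin dictates the other scales: the height is of order
    [f r / tau], [K] is of order [tau] over that height, and the apices stay so close to [xb] that
    [f] hardly changes. The drift is harmless there because [|p|^(1 + alpha)] tends to 0 with
    [p]. *)

Fixpoint Ck (R : realType) (V : normedModType R) (n : nat) (U : set V)
    (f : V -> R) : Prop :=
  (forall x, U x -> {for x, continuous f}) /\
  if n is n'.+1 then
    forall v, (forall x, U x -> derivable f x v) /\ Ck n' U ('D_v f)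
  else True.

Section CkTheory.
Context {R : realType} {V : normedModType R}.
Implicit Types (U : set V) (f g : V -> R) (n : nat).

Lemma Ck_continuous n U f x : Ck n U f -> U x -> {for x, continuous f}.
Proof. by case: n => [|n] [cf _]; exact: cf. Qed.

Lemma Ck_derivable n U f x v : Ck n.+1 U f -> U x -> derivable f x v.
Proof. by move=> [_ /(_ v)[df _]]; exact: df. Qed.

Lemma Ck_derive n U f v : Ck n.+1 U f -> Ck n U ('D_v f).
Proof. by move=> [_ /(_ v)[]]. Qed.

Lemma Ck_pred n U f : Ck n.+1 U f -> Ck n U f.
Proof.
elim: n f => [|n IHn] f; first by move=> [].
move=> [cf df]; split=> // v; have [dfv Df] := df v.
by split=> //; exact: IHn.
Qed.

Lemma Ck_sub n U W f : W `<=` U -> Ck n U f -> Ck n W f.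
Proof.
move=> WU; elim: n f => [|n IHn] f [cf df]; split=> //=.
- by move=> x /WU; exact: cf.
- by move=> x /WU; exact: cf.
- move=> v; have [dfv Df] := df v.
  by split; [move=> x /WU; exact: dfv|exact: IHn].
Qed.

Lemma open_near_eq U f g x : open U -> (forall y, U y -> f y = g y) -> U x ->
  \forall y \near x, f y = g y.
Proof.
move=> oU fg Ux; have : nbhs x U by exact: open_nbhs_nbhs.
by apply: filterS => y; exact: fg.
Qed.

Lemma Ck_ext n U f g : open U -> (forall x, U x -> f x = g x) ->
  Ck n U f -> Ck n U g.
Proof.
move=> oU; elim: n f g => [|n IHn] f g fg [cf df].
  split=> // x Ux; rewrite /prop_for /continuous_at -(fg _ Ux).
  apply: cvg_trans (cf x Ux); apply: near_eq_cvg.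
  exact: (open_near_eq oU fg Ux).
split.
  move=> x Ux; rewrite /prop_for /continuous_at -(fg _ Ux).
  apply: cvg_trans (cf x Ux); apply: near_eq_cvg.
  exact: (open_near_eq oU fg Ux).
move=> v; have [dfv Df] := df v; split.
  move=> x Ux; apply: near_eq_derivable (dfv x Ux).
  exact: (open_near_eq oU fg Ux).
apply: IHn Df => x Ux; apply: near_eq_derive.
exact: (open_near_eq oU fg Ux).
Qed.

Lemma Ck_cst n U (c : R) : Ck n U (cst c).
Proof.
elim: n c => [|n IHn] c; first by split=> // x _; exact: cst_continuous.
split; first by move=> x _; exact: cst_continuous.
move=> v; split; first by move=> x _; exact: derivable_cst.
suff -> : 'D_v (cst c : V -> R) = cst 0 by exact: IHn.
by apply/funext => x; rewrite derive_cst.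
Qed.

Lemma Ck_add n U f g : open U -> Ck n U f -> Ck n U g ->
  Ck n U (fun x => f x + g x).
Proof.
move=> oU; elim: n f g => [|n IHn] f g [cf df] [cg dg].
  by split=> // x Ux; apply: continuousD; [exact: cf|exact: cg].
split; first by move=> x Ux; apply: continuousD; [exact: cf|exact: cg].
move=> v; have [dfv Df] := df v; have [dgv Dg] := dg v; split.
  by move=> x Ux; apply: derivableD; [exact: dfv|exact: dgv].
apply: Ck_ext (IHn _ _ Df Dg) => // x Ux.
by rewrite (@deriveD _ _ _ f g) //; [exact: dfv|exact: dgv].
Qed.

Lemma Ck_mul n U f g : open U -> Ck n U f -> Ck n U g ->
  Ck n U (fun x => f x * g x).
Proof.
move=> oU; elim: n f g => [|n IHn] f g Cf Cg.
  by split=> // x Ux; apply: continuousM; [exact: (Ck_continuous Cf)|exact: (Ck_continuous Cg)].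
split; first by move=> x Ux; apply: continuousM; [exact: (Ck_continuous Cf)|exact: (Ck_continuous Cg)].
move=> v; split.
  by move=> x Ux; exact: (derivableM (Ck_derivable Cf Ux) (Ck_derivable Cg Ux)).
have Cf' := Ck_pred Cf; have Cg' := Ck_pred Cg.
have := Ck_add oU (IHn _ _ Cf' (Ck_derive v Cg)) (IHn _ _ Cg' (Ck_derive v Cf)).
apply: Ck_ext => // x Ux; exact/esym/(deriveM (Ck_derivable Cf Ux) (Ck_derivable Cg Ux)).
Qed.

Lemma Ck_opp n U f : open U -> Ck n U f -> Ck n U (fun x => - f x).
Proof.
move=> oU Cf; apply: Ck_ext (Ck_mul oU (Ck_cst n U (-1)) Cf) => // x _.
by rewrite mulN1r.
Qed.

Lemma Ck_sum n U (I : Type) (r : seq I) (h : I -> V -> R) : open U ->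
  (forall i, Ck n U (h i)) -> Ck n U (fun x => \sum_(i <- r) h i x).
Proof.
move=> oU Ch; elim: r => [|i r IHr].
  by apply: Ck_ext (Ck_cst n U 0) => // x _; rewrite big_nil.
by apply: Ck_ext (Ck_add oU (Ch i) IHr) => // x _; rewrite big_cons.
Qed.

(** As [f] is derivable along [v] and perhaps not differentiable, the one-variable chain rule is
    applied to its restriction to the line through [x]. *)
Lemma is_derive_compr (x v : V) f (G : R -> R) (df dG : R) :
  is_derive x v f df -> is_derive (f x) 1 G dG ->
  is_derive x v (fun y => G (f y)) (dG * df).
Proof.
move=> [dfx <-] [dGx <-].
pose k (h : R) := f (h *: v + x).
have k0 : k 0 = f x by rewrite /k scale0r add0r.
have dk : derivable k 0 1 by exact: (derivable1P f x v).1.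
have dGk : derivable G (k 0) 1 by rewrite k0.
have eqD (p : V -> R) : 'D_v p x = 'D_1 (fun h : R => p (h *: v + x)) 0.
  rewrite /derive; set g1 := fun h => h^-1 *: _; set g2 := fun h => h^-1 *: _.
  suff -> : g1 = g2 by [].
  by apply/funext => h; rewrite /g1 /g2 /= addr0 scale0r add0r [_%:A]mulr1.
have dGf : derivable (G \o k) 0 1.
  apply/derivable1_diffP/differentiable_comp; exact/derivable1_diffP.
split; first exact: (derivable1P (fun y => G (f y)) x v).2.
rewrite eqD -derive1E -/(G \o k) (derive1_comp dk dGk) !derive1E k0.
by rewrite (eqD f).
Qed.

End CkTheory.

Lemma Ck_comp (R : realType) (V : normedModType R) n (U : set V) (W : set R)
    (f : V -> R) (G : R -> R) :
  open U -> (forall x, U x -> W (f x)) -> Ck n U f -> Ck n W G ->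
  Ck n U (fun x => G (f x)).
Proof.
move=> oU UW; elim: n G => [|n IHn] G Cf CG.
  split=> // x Ux; apply: continuous_comp; first exact: (Ck_continuous Cf Ux).
  exact: (Ck_continuous CG (UW _ Ux)).
split.
  move=> x Ux; apply: continuous_comp; first exact: (Ck_continuous Cf Ux).
  exact: (Ck_continuous CG (UW _ Ux)).
have isD v x : U x ->
    is_derive x v (fun y => G (f y)) ('D_1 G (f x) * 'D_v f x).
  move=> Ux; apply: is_derive_compr; apply: derivableP.
    exact: (Ck_derivable Cf Ux).
  exact: (Ck_derivable CG (UW _ Ux)).
move=> v; split; first by move=> x /(isD v) [].
have DG : Ck n W ('D_1 G) by exact: Ck_derive.
have C1 := IHn _ (Ck_pred Cf) DG.
apply: Ck_ext (Ck_mul oU C1 (Ck_derive v Cf)) => // x /(isD v) dx.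
by rewrite (@derive_val _ _ _ _ _ _ _ dx).
Qed.

(** The recursive form makes closure under products and composition a single induction; this is the
    way back to [C2_on]. Openness turns subspace continuity into continuity at each point. *)
Lemma C2_onP (R : realType) (V : normedModType R) (U : set V) (f : V -> R) :
  open U -> C2_on U f <-> Ck 2 U f.
Proof.
move=> oU; have cP (k : V -> R) : {within U, continuous k} <->
    (forall x, U x -> {for x, continuous k}).
  rewrite continuous_open_subspace //; split=> ck x Ux; apply: ck.
    by rewrite inE.
  by rewrite inE in Ux.
split=> [[cf df]|[cf df]].
  split; [exact: (cP _).1|move=> v].
  have [d1 c1 _ _] := df v 0; split; [exact: d1|split; [exact: (cP _).1|]].
  move=> w; have [_ _ d2 c2] := df v w; split; [exact: d2|split; [|exact: I]].
  exact: (cP _).1.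
split; first exact: (cP _).2.
move=> v w; have [d1 [c1 d2]] := df v; have [d3 [c3 _]] := d2 w.
split; [exact: d1|exact: (cP _).2|exact: d3|exact: (cP _).2].
Qed.

(** * Directional derivatives: lines, mean values, linearity in the direction *)

Section Directional.
Context {R : realType} {V : normedModType R}.
Implicit Types (U : set V) (f g : V -> R).

Lemma is_derive_mull (x v : V) f (k df : R) :
  is_derive x v f df -> is_derive x v (fun y => k * f y) (k * df).
Proof. exact: (@is_deriveZ _ _ _ f k x v df). Qed.

Lemma is_derive_mul (x v : V) f g (df dg : R) :
  is_derive x v f df -> is_derive x v g dg ->
  is_derive x v (fun y => f y * g y) (f x * dg + g x * df).
Proof. exact: (@is_deriveM _ _ f g x v df dg). Qed.

Lemma is_derive_add (x v : V) f g (df dg : R) :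
  is_derive x v f df -> is_derive x v g dg ->
  is_derive x v (fun y => f y + g y) (df + dg).
Proof. exact: (@is_deriveD _ _ _ f g x v df dg). Qed.

Lemma is_derive_bigsum (I : Type) (r : seq I) (h : I -> V -> R) (dh : I -> R)
    (x v : V) : (forall i, is_derive x v (h i) (dh i)) ->
  is_derive x v (fun y => \sum_(i <- r) h i y) (\sum_(i <- r) dh i).
Proof.
move=> dhi; elim: r => [|i r IHr].
  rewrite big_nil.
  have -> : (fun y => \sum_(i <- [::]) h i y) = cst 0.
    by apply/funext => y; rewrite big_nil.
  exact: is_derive_cst.
rewrite big_cons.
have -> : (fun y => \sum_(k <- i :: r) h k y) =
    (fun y => h i y + \sum_(k <- r) h k y).
  by apply/funext => y; rewrite big_cons.
exact: is_derive_add.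
Qed.

Lemma derive_translate f (b x v : V) :
  'D_v (fun y => f (b + y)) x = 'D_v f (b + x).
Proof.
rewrite /derive; set g1 := fun h => h^-1 *: _; set g2 := fun h => h^-1 *: _.
suff -> : g1 = g2 by [].
by apply/funext => h; rewrite /g1 /g2 /= addrCA.
Qed.

Lemma derivable_translate f (b x v : V) :
  derivable f (b + x) v -> derivable (fun y => f (b + y)) x v.
Proof.
rewrite /derivable; set g1 := fun h => h^-1 *: _; set g2 := fun h => h^-1 *: _.
suff -> : g1 = g2 by [].
by apply/funext => h; rewrite /g1 /g2 /= addrCA.
Qed.

Lemma is_derive_line f (z v : V) (s : R) :
  derivable f (s *: v + z) v ->
  is_derive s 1 (fun h : R => f (h *: v + z)) ('D_v f (s *: v + z)).
Proof.
rewrite /derivable => df; split.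
  move: df; rewrite /derivable.
  set g1 := fun h => h^-1 *: _; set g2 := fun h => h^-1 *: _.
  suff -> : g1 = g2 by [].
  by apply/funext => h; rewrite /g1 /g2 /= [_%:A]mulr1 scalerDl addrA.
rewrite /derive; set g1 := fun h => h^-1 *: _; set g2 := fun h => h^-1 *: _.
suff -> : g1 = g2 by [].
by apply/funext => h; rewrite /g1 /g2 /= [_%:A]mulr1 scalerDl addrA.
Qed.

(** Composing with [h |-> h * k] on the line, instead of rescaling the quotient, treats [k = 0]
    along with the other values. *)
Lemma is_derive_dirZ f (x v : V) (k : R) :
  derivable f x v -> is_derive x (k *: v) f (k * 'D_v f x).
Proof.
move=> df.
have df0 : derivable f ((0 * k) *: v + x) v by rewrite mul0r scale0r add0r.
have dl := is_derive_line df0.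
have dk : is_derive (0 : R) 1 (fun h : R => h * k) k.
  have := is_deriveM (is_derive_id (0 : R) (1 : R)) (is_derive_cst k (0 : R) (1 : R)).
  by rewrite scaler0 add0r [_ *: _]mulr1.
have := is_derive_compr dk dl; rewrite mul0r scale0r add0r mulrC => -[d1 d2].
split.
  apply: (derivable1P f x (k *: v)).2.
  have -> // : (fun h : R => f (h *: (k *: v) + x)) =
    (fun h : R => f ((h * k) *: v + x)).
  by apply/funext => h; rewrite scalerA.
rewrite -d2 /derive.
set g1 := fun h => h^-1 *: _; set g2 := fun h => h^-1 *: _.
suff -> : g1 = g2 by [].
apply/funext => h; rewrite /g1 /g2 /= addr0 mul0r scale0r add0r [_%:A]mulr1.
by rewrite scalerA.
Qed.

Lemma mvt_line f (z v : V) :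
  (forall s : R, 0 <= s <= 1 -> derivable f (s *: v + z) v) ->
  exists2 c : R, 0 <= c <= 1 & f (v + z) - f z = 'D_v f (c *: v + z).
Proof.
move=> df; pose k (h : R) := f (h *: v + z).
have dk (s : R) : 0 <= s <= 1 -> is_derive s 1 k ('D_v f (s *: v + z)).
  by move=> s01; apply: is_derive_line; exact: df.
have [||c c01] := @MVT_segment R k (fun s => 'D_v f (s *: v + z)) 0 1 ler01.
- move=> s; rewrite in_itv /= => /andP[s0 s1]; apply: dk.
  by rewrite !ltW.
- apply: derivable_within_continuous => s; rewrite in_itv /= => /dk [] //.
- rewrite /k scale1r scale0r add0r subr0 mulr1 => ->; by exists c.
Qed.

Lemma Ck_near n U f z e : Ck n U f -> open U -> U z -> 0 < e ->
  exists2 d, 0 < d & forall y, `|y - z| < d -> U y /\ `|f y - f z| < e.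
Proof.
move=> Cf oU Uz e0.
have UN : nbhs z U by exact: open_nbhs_nbhs.
have fN : \forall y \near z, `|f z - f y| < e.
  exact: (cvgr_dist_lt _ _ (Ck_continuous Cf Uz) _ e0).
have : nbhs z (U `&` [set y | `|f z - f y| < e]) by exact: filterI.
move=> /nbhs_ballP[d d0 dP].
exists d => // y yz; have [|Uy fy] := dP y.
  by rewrite -ball_normE /ball_ /= distrC.
by rewrite distrC.
Qed.

(** The increment along [h (v + w)] is split at [h v + z]. The first leg is the quotient for [v];
    the mean value theorem turns the second into ['D_w f] at a point tending to [z], and ['D_w f] is
    continuous. *)
Lemma derive_dirD U f z v w : open U -> U z -> Ck 1 U f ->
  'D_(v + w) f z = 'D_v f z + 'D_w f z.
Proof.
move=> oU Uz Cf; have Cw := Ck_derive w Cf.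
rewrite [LHS]/derive; apply: cvg_lim => //.
apply/cvgrPdist_lt => e e0; have e2 : 0 < e / 2 by rewrite divr_gt0.
have [d d0 dP] := Ck_near Cw oU Uz e2.
have dv : derivable f z v by exact: (Ck_derivable Cf Uz).
have nv := cvgr_dist_lt _ _ dv _ e2.
near=> h.
have h0 : h != 0 by near: h; exact: nbhs_dnbhs_neq.
have hs : `|h| * (`|v| + `|w| + 1) < d.
  rewrite -ltr_pdivlMr ?ltr_wpDl ?addr_ge0 //; near: h.
  apply: dnbhs0_lt; rewrite divr_gt0 ?ltr_wpDl ?addr_ge0 //.
have inU (c : R) : 0 <= c <= 1 -> `|c *: (h *: w) + (h *: v + z) - z| < d.
  move=> /andP[c0 c1]; apply: le_lt_trans hs.
  rewrite addrA addrK (le_trans (ler_normD _ _)) // !normrZ (ger0_norm c0).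
  have : c * (`|h| * `|w|) <= `|h| * `|w| by rewrite ler_piMl ?mulr_ge0.
  have := normr_ge0 h; lra.
have [c c01 fc] : exists2 c : R, 0 <= c <= 1 & f (h *: w + (h *: v + z)) - f (h *: v + z)
    = 'D_(h *: w) f (c *: (h *: w) + (h *: v + z)).
  apply: mvt_line => s s01; have [Us _] := dP _ (inU _ s01).
  have := is_derive_dirZ h (Ck_derivable (v := w) Cf Us); by case.
have [Uc fcz] := dP _ (inU _ c01).
have -> : h^-1 *: ((f \o shift z) (h *: (v + w)) - f z) =
   h^-1 *: ((f \o shift z) (h *: v) - f z) + 'D_w f (c *: (h *: w) + (h *: v + z)).
  have -> : (f \o shift z) (h *: (v + w)) - f z = (f \o shift z) (h *: v) - f z
      + (f (h *: w + (h *: v + z)) - f (h *: v + z)).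
    by rewrite /= scalerDr [h *: v + h *: w]addrC -addrA; ring.
  rewrite fc scalerDr; congr (_ + _).
  have [_ ->] := is_derive_dirZ h (Ck_derivable (v := w) Cf Uc).
  by rewrite /GRing.scale /= mulKf.
rewrite opprD addrACA [ltRHS]splitr; apply: le_lt_trans (ler_normD _ _) _.
rewrite ltrD //; last by rewrite distrC.
near: h; exact: nv.
Unshelve. all: by end_near. Qed.

Lemma derive_dir_sum U f z (I : Type) (r : seq I) (e : I -> V) (c : I -> R) :
  open U -> U z -> Ck 1 U f ->
  'D_(\sum_(i <- r) c i *: e i) f z = \sum_(i <- r) c i * 'D_(e i) f z.
Proof.
move=> oU Uz Cf; elim: r => [|i r IHr]; first by rewrite !big_nil derive0.
rewrite !big_cons (derive_dirD _ _ oU Uz Cf) IHr; congr (_ + _).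
by have [] := is_derive_dirZ (c i) (Ck_derivable (v := e i) Cf Uz).
Qed.

End Directional.

(** * Symmetry of second derivatives and second-order Taylor bounds *)

Section SecondOrder.
Context {R : realType} {V : normedModType R}.
Implicit Types (U : set V) (f g : V -> R).

(** Two mean values in succession: along [h v] for the difference [f (h w + x) - f x], then along
    [h w] for ['D_v f]. *)
Lemma second_difference U f z v w d (h : R) :
  Ck 2 U f -> (forall y, `|y - z| < d -> U y) ->
  `|h| * (`|v| + `|w|) < d ->
  exists2 y, `|y - z| <= `|h| * (`|v| + `|w|) &
    f (h *: w + (h *: v + z)) - f (h *: v + z) - (f (h *: w + z) - f z)
    = h * h * 'D_w ('D_v f) y.
Proof.
move=> Cf dU hd.
have bnd (s c : R) : 0 <= s <= 1 -> 0 <= c <= 1 ->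
    `|s *: (h *: w) + (c *: (h *: v) + z) - z| <= `|h| * (`|v| + `|w|).
  move=> /andP[s0 s1] /andP[c0 c1].
  rewrite addrA addrK (le_trans (ler_normD _ _)) // !normrZ (ger0_norm s0) (ger0_norm c0).
  have : s * (`|h| * `|w|) <= `|h| * `|w| by rewrite ler_piMl ?mulr_ge0.
  have : c * (`|h| * `|v|) <= `|h| * `|v| by rewrite ler_piMl ?mulr_ge0.
  lra.
have inU (s c : R) : 0 <= s <= 1 -> 0 <= c <= 1 ->
    U (s *: (h *: w) + (c *: (h *: v) + z)).
  by move=> s01 c01; apply: dU; apply: le_lt_trans (bnd _ _ s01 c01) hd.
have inU1 (c : R) : 0 <= c <= 1 -> U (h *: w + (c *: (h *: v) + z)).
  by move=> c01; rewrite -[h *: w]scale1r; apply: inU; rewrite ?ler01 ?lexx.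
have inU0 (c : R) : 0 <= c <= 1 -> U (c *: (h *: v) + z).
  move=> c01; have := inU 0 c; rewrite scale0r add0r; apply=> //.
  by rewrite ler01 lexx.
pose g x := f (h *: w + x) - f x.
have dg (c : R) : 0 <= c <= 1 -> is_derive (c *: (h *: v) + z) (h *: v) g
   (h * ('D_v f (h *: w + (c *: (h *: v) + z)) - 'D_v f (c *: (h *: v) + z))).
  move=> c01; rewrite mulrBr; apply: is_deriveB.
    have := is_derive_dirZ h (Ck_derivable (v := v) (Ck_pred Cf) (inU1 _ c01)).
    move=> [d1 d2]; split; first exact: derivable_translate.
    by rewrite derive_translate.
  exact: is_derive_dirZ h (Ck_derivable (v := v) (Ck_pred Cf) (inU0 _ c01)).
have [|c c01] := @mvt_line R V g z (h *: v).
  by move=> s /dg [].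
have [_ ->] := dg _ c01; rewrite /g => ->.
have Cv := Ck_derive v Cf.
have [|s s01 ->] := @mvt_line R V ('D_v f) (c *: (h *: v) + z) (h *: w).
  move=> s s01.
  by have [] := is_derive_dirZ h (Ck_derivable (v := w) Cv (inU _ _ s01 c01)).
have [_ ->] := is_derive_dirZ h (Ck_derivable (v := w) Cv (inU _ _ s01 c01)).
by exists (s *: (h *: w) + (c *: (h *: v) + z)); rewrite ?mulrA //; exact: bnd.
Qed.

Lemma dist_combine (a b p q e : R) :
  a = b -> `|a - p| < e / 2 -> `|b - q| < e / 2 -> `|p - q| <= e.
Proof. by move=> ->; rewrite !ltr_norml ler_norml; lra. Qed.

(** The second difference is symmetric in [v] and [w], so for one small [h] the two mixed
    derivatives agree at two points near [z]; continuity brings both points to [z]. *)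
Lemma deriveC U f z v w : open U -> U z -> Ck 2 U f ->
  'D_w ('D_v f) z = 'D_v ('D_w f) z.
Proof.
move=> oU Uz Cf; apply/eqP; rewrite -subr_eq0 -normr_le0.
apply/ler_addgt0Pl => e e0; rewrite addr0.
have e2 : 0 < e / 2 by rewrite divr_gt0.
have [d1 d10 dP1] := Ck_near (Ck_derive w (Ck_derive v Cf)) oU Uz e2.
have [d2 d20 dP2] := Ck_near (Ck_derive v (Ck_derive w Cf)) oU Uz e2.
pose h := Num.min d1 d2 / (2 * (`|v| + `|w| + 1)).
have vw0 : 0 < `|v| + `|w| + 1 by rewrite ltr_wpDl ?addr_ge0.
have m0 : 0 < Num.min d1 d2 by rewrite lt_min d10.
have h0 : 0 < h by rewrite divr_gt0 // mulr_gt0.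
have hlt : `|h| * (`|v| + `|w|) < Num.min d1 d2.
  rewrite gtr0_norm // /h mulrAC ltr_pdivrMr ?mulr_gt0 // ltr_pM2l //.
  have := normr_ge0 v; have := normr_ge0 w; lra.
have U1 y : `|y - z| < d1 -> U y by move=> /dP1[].
have U2 y : `|y - z| < d2 -> U y by move=> /dP2[].
have [h1 h2] : `|h| * (`|v| + `|w|) < d1 /\ `|h| * (`|v| + `|w|) < d2.
  by move: hlt; rewrite lt_min => /andP[].
have [y1 y1z E1] := second_difference Cf U1 h1.
have [|y2 y2z E2] := @second_difference _ f z w v _ h Cf U2.
  by rewrite [`|w| + _]addrC.
rewrite [`|w| + _]addrC in y2z.
have E : 'D_w ('D_v f) y1 = 'D_v ('D_w f) y2.
  apply: (@mulfI _ (h * h)); first by rewrite mulf_neq0 // gt_eqF.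
  have swap (a b p q : R) : a - b - (p - q) = a - p - (b - q) by ring.
  apply: etrans (esym E1) _; apply: etrans E2.
  by rewrite [h *: v + (h *: w + z)]addrCA; exact: swap.
have [_ A1] := dP1 _ (le_lt_trans y1z h1).
have [_ A2] := dP2 _ (le_lt_trans y2z h2).
exact: dist_combine E A1 A2.
Qed.

Lemma taylor2_line U f z v (M : R) :
  Ck 2 U f -> (forall s : R, 0 <= s <= 1 -> U (s *: v + z)) ->
  (forall s : R, 0 <= s <= 1 -> 'D_v ('D_v f) (s *: v + z) <= M) ->
  f (v + z) <= f z + 'D_v f z + M / 2.
Proof.
move=> Cf inU leM.
(* By a second mean value the derivative of [q] at [c] is [c] times a second derivative minus [M],
   hence nonpositive. *)
pose q (s : R) := f (s *: v + z) - 'D_v f z * s - M / 2 * s ^+ 2.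
have dq (s : R) : 0 <= s <= 1 ->
    is_derive s 1 q ('D_v f (s *: v + z) - 'D_v f z - M * s).
  move=> s01.
  have d1 := is_derive_line (Ck_derivable (v := v) (Ck_pred Cf) (inU _ s01)).
  have d2 : is_derive s 1 (fun s : R => 'D_v f z * s) ('D_v f z).
    by rewrite -[X in is_derive _ _ _ X]mulr1; apply: is_derive_mull; exact: is_derive_id.
  have d3 : is_derive s 1 (fun s : R => M / 2 * s ^+ 2) (M * s).
    have -> : M * s = M / 2 * (s * 1 + s * 1) by field.
    apply: is_derive_mull; exact: (is_derive_mul (is_derive_id s 1) (is_derive_id s 1)).
  exact: (is_deriveB (is_deriveB d1 d2) d3).
have [||c c01] := @MVT_segment R q (fun s => 'D_v f (s *: v + z) - 'D_v f z - M * s) 0 1 ler01.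
- by move=> s; rewrite in_itv /= => /andP[s0 s1]; apply: dq; rewrite !ltW.
- by apply: derivable_within_continuous => s; rewrite in_itv /= => /dq [].
rewrite in_itv /= in c01.
have c0 : 0 <= c by case/andP: c01.
have [|s s01] := @mvt_line R V ('D_v f) z (c *: v).
  move=> s s01; rewrite scalerA.
  have sc : 0 <= s * c <= 1.
    case/andP: c01 => _ c1; case/andP: s01 => s0 s1.
    by rewrite mulr_ge0 // mulr_ile1.
  by have [] := is_derive_dirZ c (Ck_derivable (v := v) (Ck_derive v Cf) (inU _ sc)).
have sc : 0 <= s * c <= 1.
  case/andP: c01 => _ c1; case/andP: s01 => s0 s1.
  by rewrite mulr_ge0 // mulr_ile1.
rewrite scalerA.
have [_ ->] := is_derive_dirZ c (Ck_derivable (v := v) (Ck_derive v Cf) (inU _ sc)).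
move=> ->; have := leM _ sc => /(ler_wpM2l c0) le1.
rewrite /q scale1r scale0r add0r; move: le1; rewrite expr1n expr0n /=.
move: ('D_v ('D_v f) _) ('D_v f z) (f (v + z)) (f z) => a1 a2 a3 a4.
by clear; lra.
Qed.

(** The directions [e] form an arbitrary finite family: below it is the time axis with the space
    axes, or one direction for a function of time. *)
Lemma taylor2_upper U f z (I : finType) (e : I -> V) (eps : R) :
  open U -> U z -> Ck 2 U f -> 0 < eps ->
  exists2 d, 0 < d & forall c : I -> R, (forall i, `|c i| < d) ->
    f (\sum_i c i *: e i + z) <= f z + \sum_i c i * 'D_(e i) f z
      + 2^-1 * (\sum_i \sum_j c i * c j * 'D_(e j) ('D_(e i) f) z)
      + eps * \sum_i c i ^+ 2.
Proof.
move=> oU Uz Cf eps0.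
(* An oscillation [eps / n] of each second derivative costs at most [2 * eps * \sum_i c i ^+ 2],
   since [|c i * c j| <= c i ^+ 2 + c j ^+ 2]; the [1] keeps [n] positive for empty [I]. *)
pose n : R := #|I|%:R + 1.
have n0 : 0 < n by rewrite ltr_wpDl.
have en0 : 0 < eps / n by rewrite divr_gt0.
have [d d0 dP] : exists2 d, 0 < d & forall y, `|y - z| < d ->
    U y /\ forall i j, `|'D_(e j) ('D_(e i) f) y - 'D_(e j) ('D_(e i) f) z| < eps / n.
  have : \forall y \near z, U y /\ forall p : I * I,
      `|'D_(e p.2) ('D_(e p.1) f) y - 'D_(e p.2) ('D_(e p.1) f) z| < eps / n.
    apply: filterI; first exact: open_nbhs_nbhs.
    apply: filter_forall => -[i j] /=.
    have [d d0 dP] := Ck_near (Ck_derive (e j) (Ck_derive (e i) Cf)) oU Uz en0.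
    apply/nbhs_ballP; exists d => // y; rewrite -ball_normE /ball_ /= distrC.
    by move=> /dP[].
  move=> /nbhs_ballP[d d0 dP]; exists d => // y yz.
  have [|Uy A] := dP y; first by rewrite -ball_normE /ball_ /= distrC.
  by split=> // i j; exact: (A (i, j)).
pose S := \sum_i `|e i| + 1.
have S0 : 0 < S by rewrite ltr_wpDl // sumr_ge0.
exists (d / S); first by rewrite divr_gt0.
move=> c cd; set v := \sum_i c i *: e i.
have vd : `|v| < d.
  apply: (@le_lt_trans _ _ (\sum_i d / S * `|e i|)).
    apply: le_trans (ler_norm_sum _ _ _) _; apply: ler_sum => i _.
    by rewrite normrZ ler_wpM2r // ltW.
  rewrite -mulr_sumr mulrAC ltr_pdivrMr // ltr_pM2l // /S ltrDl //.
have inU (s : R) : 0 <= s <= 1 -> `|s *: v + z - z| < d.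
  move=> /andP[s0 s1]; rewrite addrK normrZ ger0_norm //.
  by apply: le_lt_trans vd; rewrite ler_piMl.
pose B y := \sum_i \sum_j c i * c j * 'D_(e j) ('D_(e i) f) y.
have D2 y : U y -> 'D_v ('D_v f) y = B y.
  move=> Uy.
  have -> : 'D_v ('D_v f) y = 'D_v (fun x => \sum_i c i * 'D_(e i) f x) y.
    apply: near_eq_derive; apply: (open_near_eq oU) Uy => x Ux.
    exact: derive_dir_sum oU Ux (Ck_pred Cf).
  have Ci i : Ck 1 U (fun x => c i * 'D_(e i) f x).
    by apply: Ck_mul => //; [exact: Ck_cst|exact: Ck_derive].
  rewrite (derive_dir_sum _ _ _ oU Uy); last exact: Ck_sum.
  rewrite /B exchange_big /=; apply: eq_bigr => j _.
  have [_ ->] : is_derive y (e j) (fun x => \sum_i c i * 'D_(e i) f x)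
      (\sum_i c i * 'D_(e j) ('D_(e i) f) y).
    apply: is_derive_bigsum => i; apply: is_derive_mull; apply: derivableP.
    exact: (Ck_derivable (Ck_derive (e i) Cf) Uy).
  by rewrite mulr_sumr; apply: eq_bigr => i _; rewrite mulrA [c j * _]mulrC.
have leB (s : R) : 0 <= s <= 1 ->
    'D_v ('D_v f) (s *: v + z) <= B z + 2 * eps * \sum_i c i ^+ 2.
  move=> s01; have [Us As] := dP _ (inU _ s01).
  rewrite (D2 _ Us) -lerBlDl /B -sumrB.
  set Q := \sum_i c i ^+ 2.
  have -> : 2 * eps * Q = 2 * eps / n * (n * Q).
    by field; rewrite gt_eqF.
  apply: (@le_trans _ _ (\sum_i \sum_j eps / n * (c i ^+ 2 + c j ^+ 2))).
    apply: ler_sum => i _; rewrite -sumrB; apply: ler_sum => j _.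
    rewrite -mulrBr; apply: le_trans (ler_norm _) _; rewrite normrM.
    apply: (@le_trans _ _ (`|c i * c j| * (eps / n))).
      by rewrite ler_wpM2l // ltW.
    rewrite [leLHS]mulrC; apply: (ler_wpM2l (ltW en0)); rewrite ler_norml.
    move: (c i) (c j) => x y; clear.
    have := sqr_ge0 (x + y); have := sqr_ge0 (x - y).
    have := sqr_ge0 x; have := sqr_ge0 y.
    lra.
  have -> : \sum_i \sum_j eps / n * (c i ^+ 2 + c j ^+ 2) =
      eps / n * (2 * (#|I|%:R * Q)).
    under eq_bigr do rewrite -mulr_sumr.
    rewrite -mulr_sumr; congr (_ * _).
    under eq_bigr do rewrite big_split /= sumr_const -/Q.
    rewrite big_split /= sumr_const -/Q -[Q *+ _]mulr_natl.
    under eq_bigr do rewrite -mulr_natl.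
    by rewrite -mulr_sumr -/Q [RHS]mulr_natl mulr2n.
  have Q0 : 0 <= Q by rewrite sumr_ge0 // => i _; exact: sqr_ge0.
  have -> : 2 * eps / n * (n * Q) = eps / n * (2 * (n * Q)).
    by rewrite -!mulrA mulrCA; congr (_ * _); rewrite mulrCA.
  apply: (ler_wpM2l (ltW en0)); rewrite /n; move: Q0; clear; lra.
have := taylor2_line Cf (fun s s01 => (dP _ (inU s s01)).1) leB.
rewrite (derive_dir_sum _ _ _ oU Uz (Ck_pred Cf)) -/v /B.
move: (f _) (f z) (\sum_i c i * _) (\sum_i \sum_j _) (\sum_i c i ^+ 2).
by move=> a1 a2 a3 a4 a5; clear; lra.
Qed.

End SecondOrder.

(** * Elementary functions of class C^k *)

Section CkConstructors.
Context {R : realType} {V : normedModType R}.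
Implicit Types (U : set V) (f : V -> R).

Lemma Ck_intro n U f : open U -> (forall x, U x -> {for x, continuous f}) ->
  (forall v, exists2 df : V -> R,
    (forall x, U x -> is_derive x v f (df x)) & Ck n U df) ->
  Ck n.+1 U f.
Proof.
move=> oU cf df; split=> // v; have [g dg Cg] := df v.
split; first by move=> x /dg [].
by apply: Ck_ext Cg => // x /dg [].
Qed.

Lemma is_derive_lin f (x v : V) :
  (forall h, f (h *: v + x) = h * f v + f x) -> is_derive x v f (f v).
Proof.
move=> fl.
have cvf : (fun h : R => h^-1 *: ((f \o shift x) (h *: v) - f x)) @ 0^' --> f v.
  apply: cvg_near_cst; near=> h.
  have h0 : h != 0 by near: h; exact: nbhs_dnbhs_neq.
  by rewrite /= fl addrK /GRing.scale /= mulKf.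
by split; [apply/cvg_ex; exists (f v)|exact: cvg_lim cvf].
Unshelve. all: by end_near. Qed.

Lemma Ck_lin n U f : open U -> (forall h x v, f (h *: v + x) = h * f v + f x) ->
  (forall x, U x -> {for x, continuous f}) -> Ck n U f.
Proof.
move=> oU fl cf; case: n => [|n]; first by split.
apply: Ck_intro => // v; exists (cst (f v)); last exact: Ck_cst.
by move=> x _; exact: is_derive_lin.
Qed.

End CkConstructors.

Section CkReal.
Context {R : realType}.
Implicit Types (U : set R) (f df : R -> R).

Lemma is_derive_dirR f (x v d : R) :
  is_derive x 1 f d -> is_derive x v f (v * d).
Proof.
move=> [dx <-]; have := @is_derive_dirZ R R f x 1 v dx.
by rewrite [v *: 1]mulr1.
Qed.

Lemma Ck_real n U f df : open U -> (forall x, U x -> is_derive x 1 f (df x)) ->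
  Ck n U df -> Ck n.+1 U f.
Proof.
move=> oU fdf Cdf; apply: Ck_intro => //.
  move=> x /fdf [dfx _].
  exact: (differentiable_continuous ((derivable1_diffP f x).1 dfx)).
move=> v; exists (fun x => v * df x).
  by move=> x /fdf; exact: is_derive_dirR.
by apply: Ck_mul => //; exact: Ck_cst.
Qed.

Lemma Ck_id n U : open U -> Ck n U (fun x : R => x).
Proof. by move=> oU; apply: Ck_lin => // x _; exact: cvg_id. Qed.

Lemma is_derive_inv (x : R) : x != 0 -> is_derive x 1 (fun y : R => y^-1) (- (x^-1 * x^-1)).
Proof.
move=> x0; have := @is_deriveV R id x 1 1 x0 (is_derive_id x 1).
by rewrite [_ *: _]mulr1 expr2 invfM.
Qed.

Lemma Ck_inv n U : open U -> (forall x, U x -> x != 0) ->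
  Ck n U (fun x : R => x^-1).
Proof.
move=> oU U0; elim: n => [|n IHn].
  by split=> // x Ux; apply: inv_continuous; exact: U0.
apply: (@Ck_real _ _ _ (fun x => - (x^-1 * x^-1))) => //.
  by move=> x /U0; exact: is_derive_inv.
by apply: Ck_opp => //; exact: Ck_mul.
Qed.

(** A joint induction, as each function is the derivative of the other up to sign. *)
Lemma Ck_sin_cos n U : open U -> Ck n U (sin : R -> R) /\ Ck n U (cos : R -> R).
Proof.
move=> oU; elim: n => [|n [IHs IHc]].
  by split; split=> // x _; [exact: continuous_sin|exact: continuous_cos].
split; first by apply: (@Ck_real _ _ _ cos) => // x _; exact: is_derive_sin.
apply: (@Ck_real _ _ _ (fun x => - sin x)) => //.
exact: Ck_opp.
Qed.

Lemma is_derive_sqrt (x : R) : 0 < x ->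
  is_derive x 1 (@Num.sqrt R) (2^-1 * (Num.sqrt x)^-1).
Proof.
by move=> x0; rewrite -invfM; exact: is_derive1_sqrt.
Qed.

Lemma Ck_sqrt n U : open U -> (forall x, U x -> 0 < x) -> Ck n U (@Num.sqrt R).
Proof.
move=> oU U0; elim: n => [|n IHn].
  by split=> // x _; exact: sqrt_continuous.
apply: (@Ck_real _ _ _ (fun x => 2^-1 * (Num.sqrt x)^-1)) => //.
  by move=> x /U0; exact: is_derive_sqrt.
apply: Ck_mul => //; first exact: Ck_cst.
apply: (@Ck_comp _ _ _ _ (`]0, +oo[)%classic) => //.
  by move=> x /U0 x0; rewrite /= in_itv /= andbT sqrtr_gt0.
apply: Ck_inv; first exact: interval_open.
by move=> x; rewrite /= in_itv /= andbT => /gt_eqF ->.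
Qed.

End CkReal.

(** * Euclidean norm and radial functions *)

Section EuclideanNorm.
Context {R : realType} {N : nat}.
Implicit Types (p q x y v w : 'rV[R]_N).

Lemma dotpC p q : dotp p q = dotp q p.
Proof. by apply: eq_bigr => i _; rewrite mulrC. Qed.

Lemma dotpDl p q x : dotp (p + q) x = dotp p x + dotp q x.
Proof. by rewrite -big_split; apply: eq_bigr => i _; rewrite mxE mulrDl. Qed.

Lemma dotpZl k p x : dotp (k *: p) x = k * dotp p x.
Proof. by rewrite mulr_sumr; apply: eq_bigr => i _; rewrite mxE mulrA. Qed.

Lemma dotpNl p x : dotp (- p) x = - dotp p x.
Proof. by rewrite -scaleN1r dotpZl mulN1r. Qed.

Lemma dotpDr p x y : dotp p (x + y) = dotp p x + dotp p y.
Proof. by rewrite !(dotpC p) dotpDl. Qed.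

Lemma dotpZr k p x : dotp p (k *: x) = k * dotp p x.
Proof. by rewrite !(dotpC p) dotpZl. Qed.

Lemma dotpNr p x : dotp p (- x) = - dotp p x.
Proof. by rewrite !(dotpC p) dotpNl. Qed.

Lemma dotp_delta p i : dotp p (delta_mx 0 i) = p 0 i.
Proof.
rewrite /dotp (bigD1 i) //= mxE !eqxx mulr1 big1 ?addr0 // => j ji.
by rewrite mxE (negbTE ji) mulr0.
Qed.

Lemma dotp_ge0 p : 0 <= dotp p p.
Proof. by apply: sumr_ge0 => i _; rewrite -expr2 sqr_ge0. Qed.

Lemma enorm_ge0 p : 0 <= enorm p.
Proof. exact: sqrtr_ge0. Qed.

Lemma sqr_enorm p : enorm p ^+ 2 = dotp p p.
Proof. by rewrite sqr_sqrtr // dotp_ge0. Qed.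

Lemma coord_le_enorm p i : `|p 0 i| <= enorm p.
Proof.
rewrite -sqrtr_sqr; apply: ler_wsqrtr; rewrite expr2 /dotp (bigD1 i) //=.
by rewrite lerDl sumr_ge0 // => j _; rewrite -expr2 sqr_ge0.
Qed.

Lemma enorm_eq0 p : (enorm p == 0) = (p == 0).
Proof.
apply/eqP/eqP => [p0|->]; last first.
  by rewrite /enorm /dotp big1 ?sqrtr0 // => i _; rewrite mxE mul0r.
apply/rowP => i; rewrite mxE; apply/eqP.
by rewrite -normr_le0 -p0 coord_le_enorm.
Qed.

Lemma enorm_gt0 p : (0 < enorm p) = (p != 0).
Proof. by rewrite lt_def enorm_eq0 enorm_ge0 andbT. Qed.

Lemma enorm0 : enorm (0 : 'rV[R]_N) = 0.
Proof. by apply/eqP; rewrite enorm_eq0. Qed.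

Lemma enormZ k p : enorm (k *: p) = `|k| * enorm p.
Proof.
by rewrite /enorm dotpZl dotpZr mulrA -expr2 sqrtrM ?sqr_ge0 // sqrtr_sqr.
Qed.

Lemma enormN p : enorm (- p) = enorm p.
Proof. by rewrite -scaleN1r enormZ normrN1 mul1r. Qed.

Lemma cauchy_schwarz_sqr p q : dotp p q ^+ 2 <= dotp p p * dotp q q.
Proof.
have [->|q0] := eqVneq q 0.
  rewrite [dotp p 0]dotpC /dotp [X in X ^+ 2]big1.
    by rewrite expr0n /= mulr_ge0 ?dotp_ge0 // sumr_ge0 // => i _; rewrite mxE mul0r.
  by move=> i _; rewrite mxE mul0r.
have qq : 0 < dotp q q by rewrite -sqr_enorm exprn_gt0 // enorm_gt0.
(* The square of this vector is [dotp q q] times the defect in the inequality. *)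
have := dotp_ge0 (dotp q q *: p - dotp p q *: q).
rewrite !(dotpDl, dotpDr, dotpNl, dotpNr, dotpZl, dotpZr) (dotpC q p).
move: (dotp q q) (dotp p q) (dotp p p) qq => b c a b0 H.
rewrite -subr_ge0 -(pmulr_rge0 _ b0); move: H; congr (0 <= _); ring.
Qed.

Lemma cauchy_schwarz p q : `|dotp p q| <= enorm p * enorm q.
Proof.
rewrite -sqrtrM ?dotp_ge0 // -sqrtr_sqr ler_wsqrtr //.
exact: cauchy_schwarz_sqr.
Qed.

Lemma enormD p q : enorm (p + q) <= enorm p + enorm q.
Proof.
rewrite -(@ler_pXn2r _ 2) ?nnegrE ?addr_ge0 ?enorm_ge0 //.
rewrite sqr_enorm sqrrD !sqr_enorm dotpDl !dotpDr (dotpC q p).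
have := le_trans (ler_norm _) (cauchy_schwarz p q); lra.
Qed.

Lemma norm_le_enorm p : `|p| <= enorm p.
Proof.
have [->|p0] := eqVneq `|p| 0; first exact: enorm_ge0.
have [[i j] /= pij] := mx_norm_neq0 p0.
by rewrite [leLHS]pij (ord1 i); exact: coord_le_enorm.
Qed.

Lemma coord_le_norm p i : `|p 0 i| <= `|p|.
Proof.
rewrite [leRHS]mx_normrE.
exact: (le_bigmax _ (fun k : 'I_1 * 'I_N => `|p k.1 k.2|) (0, i)).
Qed.

(** The factor is cruder than the sharp [sqrt N]; it serves to pass between neighbourhoods for the
    two norms. *)
Lemma enorm_le_norm p : enorm p <= N%:R * `|p|.
Proof.
rewrite -(@ler_pXn2r _ 2) ?nnegrE ?mulr_ge0 ?enorm_ge0 //.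
rewrite sqr_enorm exprMn.
apply: (@le_trans _ _ (\sum_(i < N) `|p| ^+ 2)).
  apply: ler_sum => i _; rewrite -expr2 -real_normK ?num_real //.
  by rewrite ler_pXn2r ?nnegrE // coord_le_norm.
rewrite sumr_const card_ord -[_ *+ N]mulr_natl ler_wpM2r ?sqr_ge0 //.
by rewrite -natrX ler_nat -mulnn; case: (N) => // n; rewrite leq_pmulr.
Qed.

Lemma enorm_continuous : continuous (@enorm R N : 'rV[R]_N -> R).
Proof.
move=> x; apply: (@cvgrPdist_lt R R 'rV[R]_N (nbhs x) _ _ _).2 => e e0.
apply/nbhs_ballP; exists (e / (N%:R + 1)); first by rewrite /= divr_gt0 // ltr_wpDl.
move=> y; rewrite -ball_normE /ball_ /= ltr_pdivlMr ?ltr_wpDl // => xy.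
have h1 : enorm (x - y) < e.
  apply: le_lt_trans (enorm_le_norm _) _; apply: le_lt_trans xy.
  by rewrite mulrC ler_wpM2l // lerDl.
have h2 := enormD (x - y) y; rewrite subrK in h2.
have h3 := enormD (y - x) x; rewrite subrK -opprB enormN in h3.
rewrite ltr_norml; lra.
Qed.

End EuclideanNorm.

(** Restricted to [r > 0] because [enorm] is smooth off the origin; the behaviour of a profile at 0
    enters separately, through [halfline_flat]. *)
Definition twice_derivable_pos (R : realType) (f f1 f2 : R -> R) : Prop :=
  forall r : R, 0 < r ->
    [/\ is_derive r 1 f (f1 r), is_derive r 1 f1 (f2 r)
      & {for r, continuous f2}].

Section Radial.
Context {R : realType} {N : nat}.
Implicit Types (x v w : 'rV[R]_N) (f : R -> R).

Lemma open_neq0 : open [set x : 'rV[R]_N | x != 0].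
Proof.
have -> : [set x : 'rV[R]_N | x != 0] =
    (@enorm R N : 'rV[R]_N -> R) @^-1` [set r | 0 < r].
  by apply/seteqP; split=> x /=; rewrite enorm_gt0.
apply: open_comp; last exact: open_gt.
by move=> x _; exact: enorm_continuous.
Qed.

Lemma Ck_coord n (U : set 'rV[R]_N) i : open U ->
  Ck n U (fun x : 'rV[R]_N => x 0 i).
Proof.
move=> oU; apply: Ck_lin => // [h x v|x _]; first by rewrite !mxE.
exact: coord_continuous.
Qed.

Lemma is_derive_coord x v i :
  is_derive x v (fun y : 'rV[R]_N => y 0 i) (v 0 i).
Proof. by apply: is_derive_lin => h; rewrite !mxE. Qed.

Lemma is_derive_dotp x v w : is_derive x w (fun y => dotp y v) (dotp w v).
Proof. by apply: is_derive_lin => h; rewrite dotpDl dotpZl. Qed.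

Lemma is_derive_enorm x v : x != 0 ->
  is_derive x v (@enorm R N : 'rV[R]_N -> R) (dotp x v / enorm x).
Proof.
move=> x0.
have d1 : is_derive x v (fun y : 'rV[R]_N => dotp y y) (2 * dotp x v).
  rewrite mulr_sumr; apply: is_derive_bigsum => i.
  have -> : 2 * (x 0 i * v 0 i) = x 0 i * v 0 i + x 0 i * v 0 i by ring.
  by apply: is_derive_mul; exact: is_derive_coord.
have xx : 0 < dotp x x by rewrite -sqr_enorm exprn_gt0 // enorm_gt0.
have := is_derive_compr d1 (is_derive_sqrt xx).
by rewrite -/(enorm x) mulrACA mulVf // mul1r mulrC.
Qed.

Lemma Ck_enorm n : Ck n [set x : 'rV[R]_N | x != 0] (@enorm R N).
Proof.
have o0 := open_neq0.
apply: (@Ck_comp _ _ _ _ (`]0, +oo[)%classic) => //.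
- move=> x /= x0; rewrite in_itv /= andbT -sqr_enorm exprn_gt0 //.
  by rewrite enorm_gt0.
- by apply: Ck_sum => // i; apply: Ck_mul => //; exact: Ck_coord.
- apply: Ck_sqrt; first exact: interval_open.
  by move=> x; rewrite /= in_itv /= andbT.
Qed.

Lemma Ck_profile f f1 f2 : twice_derivable_pos f f1 f2 ->
  Ck 2 (`]0, +oo[ : set R)%classic f.
Proof.
move=> df; have oI : open (`]0, +oo[ : set R)%classic by exact: interval_open.
have pos (r : R) : (`]0, +oo[)%classic r -> 0 < r.
  by rewrite /= in_itv /= andbT.
apply: (@Ck_real _ _ _ f f1) => //; first by move=> r /pos/df[].
apply: (@Ck_real _ _ _ f1 f2) => //; first by move=> r /pos/df[].
by split=> // r /pos/df[].
Qed.

Lemma Ck_radial f f1 f2 : twice_derivable_pos f f1 f2 ->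
  Ck 2 [set x : 'rV[R]_N | x != 0] (fun x => f (enorm x)).
Proof.
move=> df; apply: (@Ck_comp _ _ _ _ (`]0, +oo[)%classic).
- exact: open_neq0.
- by move=> x /= x0; rewrite in_itv /= andbT enorm_gt0.
- exact: Ck_enorm.
- exact: Ck_profile df.
Qed.

Lemma is_derive_radial f f1 f2 x v : twice_derivable_pos f f1 f2 -> x != 0 ->
  is_derive x v (fun y => f (enorm y)) (f1 (enorm x) * (dotp x v / enorm x)).
Proof.
move=> df x0; have r0 : 0 < enorm x by rewrite enorm_gt0.
have [d1 _ _] := df _ r0.
exact: is_derive_compr (is_derive_enorm v x0) d1.
Qed.

Lemma derive2_radial f f1 f2 x v w : twice_derivable_pos f f1 f2 -> x != 0 ->
  'D_w ('D_v (fun y => f (enorm y))) x =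
  f1 (enorm x) / enorm x * dotp v w
  + (f2 (enorm x) / enorm x ^+ 2 - f1 (enorm x) / enorm x ^+ 3)
    * (dotp x v * dotp x w).
Proof.
move=> df x0; have r0 : 0 < enorm x by rewrite enorm_gt0.
have [_ d2 _] := df _ r0.
have -> : 'D_w ('D_v (fun y => f (enorm y))) x =
    'D_w (fun y => f1 (enorm y) * (dotp y v * (enorm y)^-1)) x.
  apply: near_eq_derive; apply: (open_near_eq open_neq0) x0 => y y0.
  by have [] := is_derive_radial v df y0.
have dn := is_derive_enorm w x0.
have dV := is_derive_compr dn (is_derive_inv (lt0r_neq0 r0)).
have [_ ->] := is_derive_mul (is_derive_compr dn d2)
  (is_derive_mul (is_derive_dotp x v w) dV).
rewrite (dotpC w v); move: r0.
move: (enorm x) (dotp x v) (dotp x w) (dotp v w) => r a b c r0.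
by field; rewrite gt_eqF.
Qed.

Lemma grad_radial f f1 f2 x : twice_derivable_pos f f1 f2 -> x != 0 ->
  grad (fun y => f (enorm y)) x = (f1 (enorm x) / enorm x) *: x.
Proof.
move=> df x0; apply/rowP => i; rewrite !mxE.
have [_ ->] := is_derive_radial (delta_mx 0 i) df x0.
by rewrite dotp_delta mulrA mulrAC.
Qed.

(** In other words, the eigenvalue is [f2] along [x] and [f1 / enorm x] on the orthogonal
    complement. *)
Lemma hess_radial f f1 f2 x : twice_derivable_pos f f1 f2 -> x != 0 ->
  hess (fun y => f (enorm y)) x = (f1 (enorm x) / enorm x)%:M +
  (f2 (enorm x) / enorm x ^+ 2 - f1 (enorm x) / enorm x ^+ 3) *: (x^T *m x).
Proof.
move=> df x0; apply/matrixP => i j; rewrite [LHS]mxE.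
rewrite (derive2_radial _ _ df x0) !dotp_delta !mxE big_ord1 !mxE.
by rewrite eqxx /= (eq_sym i j) mulr_natr [x 0 j * _]mulrC.
Qed.

Lemma enorm_grad_radial f f1 f2 x : twice_derivable_pos f f1 f2 -> x != 0 ->
  0 <= f1 (enorm x) -> enorm (grad (fun y => f (enorm y)) x) = f1 (enorm x).
Proof.
move=> df x0 f10; have r0 : 0 < enorm x by rewrite enorm_gt0.
rewrite (grad_radial df x0) enormZ ger0_norm ?divr_ge0 ?enorm_ge0 //.
by rewrite mulfVK // gt_eqF.
Qed.

Lemma tr_hess_radial f f1 f2 x : twice_derivable_pos f f1 f2 -> x != 0 ->
  \tr (hess (fun y => f (enorm y)) x) =
  f2 (enorm x) + (N%:R - 1) * (f1 (enorm x) / enorm x).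
Proof.
move=> df x0; have r0 : 0 < enorm x by rewrite enorm_gt0.
rewrite (hess_radial df x0) mxtraceD mxtrace_scalar mxtraceZ mxtrace_mulC.
have -> : \tr (x *m x^T) = enorm x ^+ 2.
  rewrite /mxtrace big_ord1 mxE sqr_enorm.
  by apply: eq_bigr => i _; rewrite mxE.
rewrite -mulr_natl; move: (enorm x) r0 => r r0.
by field; rewrite gt_eqF.
Qed.

Lemma sym_hess_radial f f1 f2 x : twice_derivable_pos f f1 f2 -> x != 0 ->
  symmetric_mx (hess (fun y => f (enorm y)) x).
Proof.
move=> df x0; rewrite /symmetric_mx (hess_radial df x0).
by rewrite linearD /= tr_scalar_mx linearZ /= trmx_mul trmxK.
Qed.

(** The quadratic form is regrouped as [f2] times a square plus [f1] times the Cauchy-Schwarz defect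
    of [x] and [v]. *)
Lemma hess_radial_ge0 f f1 f2 x : twice_derivable_pos f f1 f2 -> x != 0 ->
  0 <= f1 (enorm x) -> 0 <= f2 (enorm x) ->
  mxle 0 (hess (fun y => f (enorm y)) x).
Proof.
move=> df x0 f10 f20 v; have r0 : 0 < enorm x by rewrite enorm_gt0.
rewrite subr0 (hess_radial df x0) mulmxDr mulmxDl mul_mx_scalar.
have dotE (p q : 'rV[R]_N) : (p *m q^T) 0 0 = dotp p q.
  by rewrite mxE; apply: eq_bigr => i _; rewrite mxE.
have quadE k : v *m (k *: (x^T *m x)) *m v^T
    = k *: ((v *m x^T) *m (x *m v^T)).
  by rewrite -scalemxAr -scalemxAl !mulmxA.
rewrite quadE -scalemxAl mxE [X in X + _]mxE [X in _ + X]mxE dotE.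
rewrite [X in _ + _ * X]mxE big_ord1 !dotE (dotpC v x).
have := cauchy_schwarz_sqr x v; rewrite -sqr_enorm.
move: (enorm x) r0 (dotp v v) (dotp x v) f10 f20 => r r0 a b.
move: (f1 r) (f2 r) => c d c0 d0 cs.
have -> : c / r * a + (d / r ^+ 2 - c / r ^+ 3) * (b * b) =
   d / r ^+ 2 * b ^+ 2 + c / r ^+ 3 * (r ^+ 2 * a - b ^+ 2).
  by field; rewrite gt_eqF.
have r0' := ltW r0; apply: addr_ge0; apply: mulr_ge0.
- by rewrite divr_ge0 ?exprn_ge0.
- exact: sqr_ge0.
- by rewrite divr_ge0 ?exprn_ge0.
- by rewrite subr_ge0.
Qed.

End Radial.

(** * The class of profiles *)

Section Halfline.
Context {R : realType}.
Implicit Types (f g : R -> R).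

Lemma is_deriveP f (r l : R) : is_derive r 1 f l <->
  forall e, 0 < e -> exists2 d, 0 < d &
    forall s, s != r -> `|s - r| < d -> `|l - (f s - f r) / (s - r)| < e.
Proof.
pose q (h : R) := h^-1 *: ((f \o shift r) (h *: (1 : R)) - f r).
have qE (s : R) : s != r -> q (s - r) = (f s - f r) / (s - r).
  by move=> sr; rewrite /q /= [_%:A]mulr1 subrK [_ *: _]mulrC.
split=> [[df <-] e e0|dP].
  have : q @ 0^' --> 'D_1 f r by [].
  move=> /cvgrPdist_lt/(_ _ e0); rewrite /dnbhs near_withinE.
  move=> /nbhs_ballP[d d0 dP]; exists d => // s sr sd.
  rewrite -qE //; apply: dP; last by rewrite /= subr_eq0.
  by rewrite -ball_normE /ball_ /= sub0r normrN.
have cq : q @ 0^' --> l.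
  apply/cvgrPdist_lt => e /dP[d d0 {}dP].
  rewrite /dnbhs near_withinE; apply/nbhs_ballP; exists d => // h.
  rewrite -ball_normE /ball_ /= sub0r normrN => hd h0.
  have hr : h + r != r by rewrite -subr_eq0 addrK.
  by have := dP (h + r) hr; rewrite -qE // addrK; apply.
by split; [apply/cvg_ex; exists l|exact: cvg_lim cq].
Qed.

Lemma deriv_on_halflineP f g : deriv_on_halfline f g <->
  forall r, 0 <= r -> forall e, 0 < e -> exists2 d, 0 < d &
    forall s, 0 <= s -> s != r -> `|s - r| < d ->
      `|g r - (f s - f r) / (s - r)| < e.
Proof.
split=> dP r r0.
  move=> e e0; have := dP r r0.
  move=> /cvgrPdist_lt/(_ _ e0); rewrite /dnbhs !near_withinE.
  move=> /nbhs_ballP[d d0 {}dP]; exists d => // s s0 sr sd.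
  by apply: dP => //; rewrite -ball_normE /ball_ /= distrC.
apply/cvgrPdist_lt => e /(dP r r0)[d d0 {}dP].
rewrite /dnbhs !near_withinE; apply/nbhs_ballP; exists d => // s.
by rewrite -ball_normE /ball_ /= distrC => sd sr s0; exact: dP.
Qed.

(** Within distance [r] of [r] the constraint [0 <= s] holds automatically, so the one-sided
    quotient is the full one. *)
Lemma deriv_on_halfline_is_derive f g (r : R) :
  deriv_on_halfline f g -> 0 < r -> is_derive r 1 f (g r).
Proof.
move=> /deriv_on_halflineP dP r0; apply/is_deriveP => e e0.
have [d d0 {}dP] := dP _ (ltW r0) _ e0.
exists (Num.min d r); first by rewrite lt_min d0.
move=> s sr; rewrite lt_min => /andP[sd srr]; apply: dP => //.
by move: srr; rewrite ltr_norml; lra.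
Qed.

Lemma is_derive_deriv_on_halfline f g :
  (forall r : R, is_derive r 1 f (g r)) -> deriv_on_halfline f g.
Proof.
move=> dP; apply/deriv_on_halflineP => r _ e e0.
by have [d d0 {}dP] := (is_deriveP _ _ _).1 (dP r) _ e0; exists d => // s _; exact: dP.
Qed.

Lemma halfline_flat f g e : deriv_on_halfline f g -> f 0 = 0 -> g 0 = 0 ->
  0 < e -> exists2 d, 0 < d & forall s, 0 < s < d -> `|f s| <= e * s.
Proof.
move=> /deriv_on_halflineP dP f0 g0 e0.
have [d d0 {}dP] := dP 0 (lexx _) _ e0; exists d => // s /andP[s0 sd].
have := dP s (ltW s0); rewrite gt_eqF // g0 f0 !subr0 sub0r normrN.
rewrite normrM normfV (gtr0_norm s0) => /(_ isT sd).
by rewrite ltr_pdivrMr // => /ltW.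
Qed.

Lemma derive_pos_lt f g : (forall r : R, 0 < r -> is_derive r 1 f (g r)) ->
  (forall r, 0 < r -> 0 < g r) -> forall s r, 0 < s -> s < r -> f s < f r.
Proof.
move=> df g0 s r s0 sr.
have [||c] := @MVT R f g s r sr.
- by move=> x; rewrite in_itv /= => /andP[sx _]; apply: df; exact: lt_trans sx.
- apply: derivable_within_continuous => x; rewrite in_itv /= => /andP[sx _].
  by have [] := df x (lt_le_trans s0 sx).
rewrite in_itv /= => /andP[sc _] E; rewrite -subr_gt0 E mulr_gt0 ?subr_gt0 //.
by apply: g0; exact: lt_trans sc.
Qed.

(** The flatness bound makes [f] tend to 0 at 0. Being increasing, [f] with a nonpositive value at
    [r] would have [f (r / 2) < 0] and stay below that value near 0. *)
Lemma derive_pos_gt0 f g : (forall r : R, 0 < r -> is_derive r 1 f (g r)) ->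
  (forall r, 0 < r -> 0 < g r) ->
  (exists2 d, 0 < d & forall s, 0 < s < d -> `|f s| <= 1 * s) ->
  forall r, 0 < r -> 0 < f r.
Proof.
move=> df g0 [d d0 dP] r r0; rewrite ltNge; apply/negP => fr0.
have inc := derive_pos_lt df g0.
have r20 : 0 < r / 2 by rewrite divr_gt0.
have fh : f (r / 2) < 0.
  by apply: lt_le_trans fr0; apply: inc => //; rewrite ltr_pdivrMr // ltr_pMr // ltr1n.
pose s := Num.min (Num.min (d / 2) (r / 4)) (- f (r / 2) / 2).
have s0 : 0 < s.
  by rewrite /s !lt_min !divr_gt0 //= oppr_gt0.
have [s1 s2 s3] : [/\ s <= d / 2, s <= r / 4 & s <= - f (r / 2) / 2].
  by split; rewrite /s !ge_min lexx ?orbT.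
have := dP s; rewrite s0 /= mul1r ler_norml => /(_ _)/andP[]; first lra.
have : f s < f (r / 2) by apply: inc => //; lra.
by move=> *; lra.
Qed.

Lemma halfline_profile f f1 f2 : C2_halfline f f1 f2 ->
  f 0 = 0 -> f1 0 = 0 -> f2 0 = 0 -> (forall r, 0 < r -> 0 < f2 r) ->
  [/\ twice_derivable_pos f f1 f2, forall r, 0 < r -> 0 < f1 r,
      forall r, 0 < r -> 0 < f r & forall s r, 0 <= s -> s <= r -> f s <= f r].
Proof.
move=> [d1 d2 c2] f00 f10 f20 f2p.
have df (r : R) : 0 < r -> is_derive r 1 f (f1 r).
  exact: deriv_on_halfline_is_derive.
have df1 (r : R) : 0 < r -> is_derive r 1 f1 (f2 r).
  exact: deriv_on_halfline_is_derive.
have f1p : forall r, 0 < r -> 0 < f1 r.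
  exact: (derive_pos_gt0 df1 f2p (halfline_flat d2 f10 f20 ltr01)).
have fp : forall r, 0 < r -> 0 < f r.
  exact: (derive_pos_gt0 df f1p (halfline_flat d1 f00 f10 ltr01)).
split=> //.
  move=> r r0; split; [exact: df|exact: df1|].
  have [cin _] := (continuous_within_itvcyP 0 f2).1 c2.
  by apply: cin; rewrite in_itv /= r0.
move=> s r; rewrite le_eqVlt => /predU1P[<-|s0].
  by rewrite le_eqVlt f00 => /predU1P[<-|/fp/ltW] //; rewrite f00.
rewrite le_eqVlt => /predU1P[<-//|sr].
exact/ltW/(derive_pos_lt df f1p).
Qed.

Lemma is_derive_expr n (r : R) :
  is_derive r 1 (fun s : R => s ^+ n.+1) (n.+1%:R * r ^+ n).
Proof.
elim: n => [|n IHn].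
  by rewrite expr0 mulr1; exact: is_derive_id.
have -> : (fun s : R => s ^+ n.+2) = (fun s => s * s ^+ n.+1).
  by apply/funext => s; rewrite exprS.
have -> : n.+2%:R * r ^+ n.+1 = r * (n.+1%:R * r ^+ n) + r ^+ n.+1 * 1.
  by rewrite mulr1 [n.+2%:R]mulrS mulrDl mul1r addrC mulrCA -exprS.
apply: is_derive_mul => //; exact: is_derive_id.
Qed.

End Halfline.

Lemma row_neq0_gt0 (R : realType) (N : nat) (x : 'rV[R]_N) : x != 0 -> (0 < N)%N.
Proof.
case: (posnP N) => // N0 /eqP[]; apply/rowP => i.
by have := ltn_ord i; rewrite {2}N0.
Qed.

(** * Powers of large exponent as profiles *)

Section ClassF.
Context {R : realType} {N : nat}.
Variables (Omega : set 'rV[R]_N) (alpha a A : R).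
Variable F : 'rV[R]_N -> 'rV[R]_N -> 'M[R]_N -> R.
Hypothesis F_zero : forall x p, Omega x -> p != 0 -> F x p 0 = 0.
Hypothesis F_ell : F_elliptic Omega alpha a A F.

Lemma symmetric_mx0 : symmetric_mx (0 : 'M[R]_N).
Proof. exact: trmx0. Qed.

Lemma symmetric_mxN (P : 'M[R]_N) : symmetric_mx P -> symmetric_mx (- P).
Proof. by rewrite /symmetric_mx linearN /= => ->. Qed.

Lemma elliptic_pos x p P : Omega x -> p != 0 -> symmetric_mx P -> mxle 0 P ->
  a * enorm p `^ alpha * \tr P <= F x p P <= A * enorm p `^ alpha * \tr P.
Proof.
move=> Ox p0 sP P0.
by have := F_ell Ox p0 symmetric_mx0 sP P0; rewrite add0r (F_zero Ox p0) subr0.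
Qed.

Lemma elliptic_neg x p P : Omega x -> p != 0 -> symmetric_mx P -> mxle 0 P ->
  a * enorm p `^ alpha * \tr P <= - F x p (- P) <= A * enorm p `^ alpha * \tr P.
Proof.
move=> Ox p0 sP P0.
have := F_ell Ox p0 (symmetric_mxN sP) sP P0.
by rewrite addNr (F_zero Ox p0) sub0r.
Qed.

Hypothesis alpha_gtN1 : -1 < alpha.
Hypothesis a_gt0 : 0 < a.
Hypothesis le_aA : a <= A.

(** The left side is the upper elliptic bound for the radial function [r ^+ m.+2]. It is a constant
    times [r] to the power [(m + 1) * alpha + m], and the hypothesis on [m] says that this exponent
    is positive. *)
Lemma power_profile_small m (e : R) : 1 < m.+1%:R * (1 + alpha) -> 0 < e ->
  exists2 d, 0 < d & forall r, 0 < r < d ->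
    A * (m.+2%:R * r ^+ m.+1) `^ alpha
      * (m.+2%:R * m.+1%:R * r ^+ m
         + (N%:R - 1) * (m.+2%:R * r ^+ m.+1 / r)) < e.
Proof.
move=> m1 e0; pose k : R := m.+2%:R.
pose C := A * k `^ alpha * (k * m.+1%:R + N%:R * k) + 1.
have A0 : 0 < A by exact: lt_le_trans le_aA.
have C0 : 0 < C.
  by rewrite ltr_wpDl // !mulr_ge0 ?powR_ge0 ?addr_ge0 ?mulr_ge0 // ltW.
pose b := m.+1%:R * alpha + m%:R.
have b0 : 0 < b by rewrite /b; move: m1; rewrite -natr1; lra.
have := @powR_cvg0 R b b0; move=> /cvgrPdist_lt/(_ _ (divr_gt0 e0 C0)).
rewrite /at_right near_withinE => /nbhs_ballP[d d0 dP].
exists d => // r /andP[r0 rd].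
have := dP r; rewrite -ball_normE /ball_ /= !sub0r !normrN (gtr0_norm r0).
move=> /(_ rd r0); rewrite ger0_norm ?powR_ge0 // => rb.
have rm : r ^+ m.+1 / r = r ^+ m by rewrite exprS mulrAC mulfV ?mul1r // gt_eqF.
rewrite -[_ * _ / r]mulrA rm.
have -> : (k * r ^+ m.+1) `^ alpha = k `^ alpha * r `^ (m.+1%:R * alpha).
  by rewrite powRM ?exprn_ge0 ?ltW // -powR_mulrn ?ltW // -powRrM.
have rbE : r `^ b = r `^ (m.+1%:R * alpha) * r ^+ m.
  by rewrite /b powRD ?gt_eqF ?implybT // powR_mulrn // ltW.
rewrite -/k.
have -> : A * (k `^ alpha * r `^ (m.+1%:R * alpha)) *
   (k * m.+1%:R * r ^+ m + (N%:R - 1) * (k * r ^+ m)) =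
   (C - 1 - A * k `^ alpha * k) * r `^ b.
  by rewrite rbE /C; ring.
apply: (@le_lt_trans _ _ (C * r `^ b)); last first.
  by rewrite mulrC -ltr_pdivlMr.
rewrite ler_wpM2r ?powR_ge0 // -addrA gerDl -opprD oppr_le0 addr_ge0 //.
by rewrite !mulr_ge0 ?powR_ge0 // ltW.
Qed.

Lemma classF_nonempty : exists2 f, classF Omega F f & forall r, 0 <= r -> 0 <= f r.
Proof.
(* The Archimedean bound gives [m + 1 > 1 / (1 + alpha)], which beats the singular factor
   [|p|^alpha]; the successor makes [m] positive, so that [f2 0 = 0]. *)
pose m := (Num.bound (1 + alpha)^-1).+1.
have al : 0 < 1 + alpha by rewrite -ltrBlDl sub0r.
have m1 : 1 < m.+1%:R * (1 + alpha).
  rewrite -ltr_pdivrMr // mul1r.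
  apply: (@lt_le_trans _ _ (Num.bound (1 + alpha)^-1)%:R).
    by have := archi_boundP (ltW (etrans (invr_gt0 _) al)).
  by rewrite ler_nat; exact/leqW/leqW.
pose f (r : R) := r ^+ m.+2.
pose f1 (r : R) := m.+2%:R * r ^+ m.+1.
pose f2 (r : R) := m.+2%:R * (m.+1%:R * r ^+ m).
exists f; last by move=> r r0; exact: exprn_ge0.
have df (r : R) : is_derive r 1 f (f1 r) by exact: is_derive_expr.
have df1 (r : R) : is_derive r 1 f1 (f2 r).
  by apply: is_derive_mull; exact: is_derive_expr.
have cf2 (r : R) : {for r, continuous f2}.
  have [d _] : is_derive r 1 f2 (m.+2%:R * (m.+1%:R * (m%:R * r ^+ m.-1))).
    by do 2!apply: is_derive_mull; exact: is_derive_expr.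
  exact: (differentiable_continuous ((derivable1_diffP f2 r).1 d)).
exists f1, f2.
have tf : twice_derivable_pos f f1 f2 by [].
have f1p (r : R) : 0 < r -> 0 < f1 r by move=> r0; apply: mulr_gt0 => //; exact: exprn_gt0.
have f2p (r : R) : 0 < r -> 0 < f2 r by move=> r0; do 2!apply: mulr_gt0 => //; exact: exprn_gt0.
split=> //.
- split; [exact: is_derive_deriv_on_halfline|exact: is_derive_deriv_on_halfline|].
  by apply: continuous_subspaceT => r; exact: cf2.
- by rewrite /f /f1 /f2 !expr0n /= !mulr0.
move=> g x0 Ox0.
have small e : 0 < e -> \forall x \near (0 : 'rV[R]_N)^',
    `|F x0 (grad g x) (hess g x)| < e /\ `|F x0 (- grad g x) (- hess g x)| < e.
  move=> /(power_profile_small m1)[d d0 dP].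
  rewrite /dnbhs near_withinE; apply/nbhs_ballP.
  exists (d / (N%:R + 1)); first by rewrite /= divr_gt0 // ltr_wpDl.
  move=> x; rewrite -ball_normE /ball_ /= sub0r normrN.
  rewrite ltr_pdivlMr ?ltr_wpDl // => xd xn0.
  have r0 : 0 < enorm x by rewrite enorm_gt0.
  have rd : enorm x < d.
    apply: le_lt_trans (enorm_le_norm _) _; apply: le_lt_trans xd.
    by rewrite mulrC ler_wpM2l // lerDl.
  have := dP (enorm x); rewrite r0 rd => /(_ isT) {}dP.
  have f1r := ltW (f1p _ r0); have f2r := ltW (f2p _ r0).
  have gr : enorm (grad g x) = f1 (enorm x) by exact: (enorm_grad_radial tf).
  have gn0 : grad g x != 0 by rewrite -enorm_gt0 gr f1p.
  have hs : symmetric_mx (hess g x) by exact: (sym_hess_radial tf).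
  have hp : mxle 0 (hess g x) by exact: (hess_radial_ge0 tf).
  (* Nonnegative lower elliptic bounds let the upper bounds control absolute values. A nonzero row
     exists, so [N - 1 >= 0] in the trace. *)
  have tr0 : 0 <= a * enorm (grad g x) `^ alpha * \tr (hess g x).
    apply: mulr_ge0; first by rewrite mulr_ge0 ?powR_ge0 // ltW.
    rewrite (tr_hess_radial tf xn0) addr_ge0 // mulr_ge0 ?divr_ge0 ?enorm_ge0 // subr_ge0 ler1n.
    by rewrite (row_neq0_gt0 xn0).
  have /andP[l1 u1] := elliptic_pos Ox0 gn0 hs hp.
  have /andP[l2 u2] : a * enorm (- grad g x) `^ alpha * \tr (hess g x) <=
      - F x0 (- grad g x) (- hess g x)
      <= A * enorm (- grad g x) `^ alpha * \tr (hess g x).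
    by apply: elliptic_neg; rewrite ?oppr_eq0.
  rewrite enormN in l2 u2.
  have ub : A * enorm (grad g x) `^ alpha * \tr (hess g x) < e.
    by rewrite gr (tr_hess_radial tf xn0) /f1 /f2 mulrA.
  move: tr0 l1 u1 l2 u2 ub; clear.
  move: (F x0 (grad _ _) _) (F x0 (- _) _) (a * _ * _) (A * _ * _) => y1 y2 y3 y4.
  by move=> *; rewrite !ltr_norml; split; lra.
split; apply/cvgrPdist_lt => e /small; apply: filterS => x [s1 s2].
  by rewrite sub0r normrN.
by rewrite sub0r normrN.
Qed.
End ClassF.

(** * From type II to type I *)

Section Slices.
Context {R : realType} {N : nat}.
Implicit Types (phi : 'rV[R]_N * R -> R) (z : 'rV[R]_N * R).

(** Space derivatives at frozen time become directional derivatives on the product, where the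
    results on [Ck] apply. *)
Lemma derive_slice phi (x v : 'rV[R]_N) t :
  'D_v (fun y => phi (y, t)) x = 'D_((v, 0) : 'rV[R]_N * R) phi (x, t).
Proof.
rewrite /derive; set g1 := fun h => h^-1 *: _; set g2 := fun h => h^-1 *: _.
suff -> : g1 = g2 by [].
apply/funext => h; rewrite /g1 /g2 /=; congr (_ *: (phi _ - _)).
by congr (_, _); rewrite /= scaler0 add0r.
Qed.

Lemma gradxE phi z :
  gradx phi z = \row_i 'D_((delta_mx 0 i, 0) : 'rV[R]_N * R) phi z.
Proof.
case: z => x t; apply/rowP => i; rewrite mxE [RHS]mxE; exact: derive_slice.
Qed.

Lemma hessxE phi z : hessx phi z = \matrix_(i, j)
  'D_((delta_mx 0 i, 0) : 'rV[R]_N * R)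
     ('D_((delta_mx 0 j, 0) : 'rV[R]_N * R) phi) z.
Proof.
case: z => x t.
rewrite /hessx /hess.
apply: eq_mx => i j.
apply: etrans (derive_slice _ x (delta_mx 0 i) t).
apply: (congr1 (fun g : 'rV[R]_N -> R => 'D_(delta_mx 0 i) g x)).
by apply/funext => y; exact: derive_slice.
Qed.

Lemma dtimeE phi z : dtime phi z = 'D_((0, 1) : 'rV[R]_N * R) phi z.
Proof.
case: z => x t; rewrite /dtime derive1E /derive /=.
set g1 := fun h => h^-1 *: _; set g2 := fun h => h^-1 *: _.
suff -> : g1 = g2 by [].
apply/funext => h; rewrite /g1 /g2 /=; congr (_ *: (phi _ - _)).
by congr (_, _); rewrite /= scaler0 add0r.
Qed.

Lemma open_cylinder (Omega : set 'rV[R]_N) T :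
  open Omega -> open (cylinder Omega T).
Proof.
move=> oO.
have -> : cylinder Omega T =
    (fst @^-1` Omega) `&` (snd @^-1` [set t | 0 < t < T]).
  by apply/seteqP; split.
apply: openI; apply: open_comp => //.
- by move=> z _; exact: cvg_fst.
- by move=> z _; exact: cvg_snd.
have -> : [set t : R | 0 < t < T] = (`]0, T[)%classic.
  by apply/seteqP; split=> t; rewrite /= in_itv.
exact: interval_open.
Qed.

Lemma Ck_fst_coord n (U : set ('rV[R]_N * R)) i : open U ->
  Ck n U (fun z => z.1 0 i).
Proof.
move=> oU; apply: Ck_lin; [exact: oU|by move=> h x v; rewrite !mxE|move=> x _].
apply: (@continuous_comp _ _ _ fst (fun y : 'rV[R]_N => y 0 i)).
  exact: cvg_fst.
exact: coord_continuous.
Qed.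

Lemma Ck_snd n (U : set ('rV[R]_N * R)) : open U -> Ck n U (fun z => z.2).
Proof.
move=> oU; apply: Ck_lin; [exact: oU|by []|].
by move=> x _; exact: cvg_snd.
Qed.

Lemma is_derive_fst_coord z (v : 'rV[R]_N * R) i (b : R) :
  is_derive z v (fun y => y.1 0 i - b) (v.1 0 i).
Proof.
rewrite -[X in is_derive _ _ _ X]addr0; apply: is_derive_add.
by apply: (@is_derive_lin _ _ (fun y : 'rV[R]_N * R => y.1 0 i)) => h; rewrite !mxE.
Qed.

Lemma is_derive_snd z (v : 'rV[R]_N * R) (b : R) :
  is_derive z v (fun y => y.2 - b) v.2.
Proof.
rewrite -[X in is_derive _ _ _ X]addr0; apply: is_derive_add.
exact: (@is_derive_lin _ _ (fun y : 'rV[R]_N * R => y.2)).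
Qed.

End Slices.

(** * The bent quadratic test function *)

Section QuadraticTest.
Context {R : realType} {N : nat}.

(** Bounded by [d], yet equal to [y] up to an error of third order at 0. *)
Definition bent (d y : R) : R := d * sin (d^-1 * y).

(* Bending the coordinates in the quadratic part keeps the 2-jet at (xb, tb) and
   makes the gradient of that part globally small for small d. *)
Definition quad_test (d tau K : R) (p xb : 'rV[R]_N) (tb : R) (Y : 'M[R]_N)
    (z : 'rV[R]_N * R) : R :=
  tau * (z.2 - tb) + K * ((z.2 - tb) * (z.2 - tb))
  + \sum_i p 0 i * (z.1 0 i - xb 0 i)
  + 2^-1 * \sum_i \sum_j Y i j
      * (bent d (z.1 0 i - xb 0 i) * bent d (z.1 0 j - xb 0 j)).

(** The derivative of [quad_test] along [v], left in the unsimplified shape that the product rule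
    [is_derive_mul] produces. *)
Definition quad_test1 (d tau K : R) (p xb : 'rV[R]_N) (tb : R) (Y : 'M[R]_N)
    (v z : 'rV[R]_N * R) : R :=
  tau * v.2 + K * ((z.2 - tb) * v.2 + (z.2 - tb) * v.2)
  + \sum_i p 0 i * v.1 0 i
  + 2^-1 * \sum_i \sum_j Y i j
      * (bent d (z.1 0 i - xb 0 i)
           * (cos (d^-1 * (z.1 0 j - xb 0 j)) * v.1 0 j)
         + bent d (z.1 0 j - xb 0 j)
           * (cos (d^-1 * (z.1 0 i - xb 0 i)) * v.1 0 i)).

Lemma is_derive_dmull (d y : R) : is_derive y 1 (fun y : R => d^-1 * y) d^-1.
Proof.
by rewrite -[X in is_derive _ _ _ X]mulr1; apply: is_derive_mull; exact: is_derive_id.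
Qed.

Lemma is_derive_bent (d y : R) : d != 0 ->
  is_derive y 1 (bent d) (cos (d^-1 * y)).
Proof.
move=> d0; have := is_derive_mull d
  (is_derive_compr (is_derive_dmull d y) (is_derive_sin (d^-1 * y))).
by rewrite mulrCA mulfV // mulr1.
Qed.

Lemma is_derive_cosd (d y : R) :
  is_derive y 1 (fun y => cos (d^-1 * y)) (- sin (d^-1 * y) * d^-1).
Proof.
exact: (is_derive_compr (is_derive_dmull d y) (is_derive_cos (d^-1 * y))).
Qed.

Lemma bent0 (d : R) : bent d 0 = 0.
Proof. by rewrite /bent mulr0 sin0 mulr0. Qed.

Lemma bent_le (d y : R) : 0 < d -> `|bent d y| <= d.
Proof.
move=> d0; rewrite normrM (gtr0_norm d0); apply: ler_piMr; first exact: ltW.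
by rewrite ler_norml sin_geN1 sin_le1.
Qed.

Lemma is_derive_quad_test d tau K p xb tb Y (z v : 'rV[R]_N * R) : d != 0 ->
  is_derive z v (quad_test d tau K p xb tb Y)
    (quad_test1 d tau K p xb tb Y v z).
Proof.
move=> d0.
have db i : is_derive z v (fun y => bent d (y.1 0 i - xb 0 i))
    (cos (d^-1 * (z.1 0 i - xb 0 i)) * v.1 0 i).
  exact: is_derive_compr (is_derive_fst_coord z v i (xb 0 i)) (is_derive_bent _ d0).
apply: is_derive_add; [apply: is_derive_add; [apply: is_derive_add|]|].
- by apply: is_derive_mull; exact: is_derive_snd.
- by apply: is_derive_mull; apply: is_derive_mul; exact: is_derive_snd.
- apply: is_derive_bigsum => i; apply: is_derive_mull.
  exact: is_derive_fst_coord.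
- apply: is_derive_mull; apply: is_derive_bigsum => i.
  apply: is_derive_bigsum => j; apply: is_derive_mull.
  by apply: is_derive_mul; exact: db.
Qed.

Lemma derive_quad_test d tau K p xb tb Y (z v : 'rV[R]_N * R) : d != 0 ->
  'D_v (quad_test d tau K p xb tb Y) z = quad_test1 d tau K p xb tb Y v z.
Proof. by move=> d0; have [] := is_derive_quad_test tau K p xb tb Y z v d0. Qed.

Lemma derive2_quad_test d tau K p xb tb Y (v w : 'rV[R]_N * R) : d != 0 ->
  'D_w ('D_v (quad_test d tau K p xb tb Y)) (xb, tb) =
  2 * K * (v.2 * w.2)
  + 2^-1 * \sum_i \sum_j Y i j * (w.1 0 i * v.1 0 j + w.1 0 j * v.1 0 i).
Proof.
move=> d0; set z : 'rV[R]_N * R := (xb, tb).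
have -> : 'D_v (quad_test d tau K p xb tb Y) = quad_test1 d tau K p xb tb Y v.
  by apply/funext => y; exact: derive_quad_test.
have db i : is_derive z w (fun y => bent d (y.1 0 i - xb 0 i))
    (cos (d^-1 * (z.1 0 i - xb 0 i)) * w.1 0 i).
  exact: is_derive_compr (is_derive_fst_coord z w i (xb 0 i)) (is_derive_bent _ d0).
have dc i : is_derive z w (fun y => cos (d^-1 * (y.1 0 i - xb 0 i)) * v.1 0 i)
    (cos (d^-1 * (z.1 0 i - xb 0 i)) * 0 + v.1 0 i *
     (- sin (d^-1 * (z.1 0 i - xb 0 i)) * d^-1 * w.1 0 i)).
  apply: is_derive_mul.
  exact: is_derive_compr (is_derive_fst_coord z w i (xb 0 i)) (is_derive_cosd d _).
have dt : is_derive z w (fun y : 'rV[R]_N * R => (y.2 - tb) * v.2) (v.2 * w.2).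
  have := is_derive_mul (is_derive_snd z w tb) (is_derive_cst v.2 z w).
  by rewrite mulr0 add0r.
have -> : 2 * K * (v.2 * w.2) + 2^-1 *
    (\sum_i \sum_j Y i j * (w.1 0 i * v.1 0 j + w.1 0 j * v.1 0 i)) =
  0 + K * (v.2 * w.2 + v.2 * w.2) + 0 + 2^-1 *
    (\sum_i \sum_j Y i j * (w.1 0 i * v.1 0 j + w.1 0 j * v.1 0 i)).
  by rewrite add0r addr0; congr (_ + _); ring.
(* At the centre [bent] is 0 and the cosines are 1, so the derivative of the cosine drops out. *)
have E k l : is_derive z w (fun y => bent d (y.1 0 k - xb 0 k)
    * (cos (d^-1 * (y.1 0 l - xb 0 l)) * v.1 0 l)) (w.1 0 k * v.1 0 l).
  have := is_derive_mul (db k) (dc l).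
  rewrite /z /= !subrr bent0 mul0r add0r !mulr0 cos0 !mul1r.
  by rewrite mulrC.
have D0 := is_derive_add (is_derive_cst (tau * v.2) z w)
  (is_derive_mull K (is_derive_add dt dt)).
have D1 := is_derive_add D0 (is_derive_cst (\sum_i p 0 i * v.1 0 i) z w).
have D2 : is_derive z w (fun y => 2^-1 * \sum_i \sum_j Y i j
    * (bent d (y.1 0 i - xb 0 i) * (cos (d^-1 * (y.1 0 j - xb 0 j)) * v.1 0 j)
     + bent d (y.1 0 j - xb 0 j) * (cos (d^-1 * (y.1 0 i - xb 0 i)) * v.1 0 i)))
    (2^-1 * \sum_i \sum_j Y i j * (w.1 0 i * v.1 0 j + w.1 0 j * v.1 0 i)).
  apply: is_derive_mull; apply: is_derive_bigsum => i.
  exact: is_derive_bigsum => j.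
by have [_ DE] := is_derive_add D1 D2; exact: DE.
Qed.

Lemma Ck_quad_test d tau K p xb tb Y n (U : set ('rV[R]_N * R)) : open U ->
  Ck n U (quad_test d tau K p xb tb Y).
Proof.
move=> oU.
have Cc (k : R) : Ck n U (fun _ => k) by exact: Ck_cst.
have Cx i : Ck n U (fun z : 'rV[R]_N * R => z.1 0 i - xb 0 i).
  by apply: Ck_add => //; exact: Ck_fst_coord.
have Ct : Ck n U (fun z : 'rV[R]_N * R => z.2 - tb).
  by apply: Ck_add => //; exact: Ck_snd.
have Cb i : Ck n U (fun z : 'rV[R]_N * R => bent d (z.1 0 i - xb 0 i)).
  apply: Ck_mul => //; apply: (@Ck_comp _ _ _ _ setT) => //.
    by apply: Ck_mul.
  by have [] := @Ck_sin_cos R n setT openT.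
apply: Ck_add => //; [apply: Ck_add => //; [apply: Ck_add => //|]|].
- exact: Ck_mul.
- by apply: Ck_mul => //; exact: Ck_mul.
- by apply: Ck_sum => // i; exact: Ck_mul.
- apply: Ck_mul => //; apply: Ck_sum => // i; apply: Ck_sum => // j.
  by apply: Ck_mul => //; exact: Ck_mul.
Qed.

(** Each term in the derivative of the quadratic part keeps one factor [bent], of size at most [d];
    the two terms of the product rule are offset by the factor [2^-1]. The bound holds at every [z],
    as admissibility requires. *)
Lemma gradx_quad_test_near d tau K p xb tb Y (z : 'rV[R]_N * R) k : 0 < d ->
  `|gradx (quad_test d tau K p xb tb Y) z 0 k - p 0 k|
     <= d * \sum_i \sum_j `|Y i j|.
Proof.
move=> d0; rewrite gradxE mxE derive_quad_test ?gt_eqF // /quad_test1 /=.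
have -> : \sum_i p 0 i * (delta_mx 0 k : 'rV[R]_N) 0 i = p 0 k.
  exact: dotp_delta.
rewrite !mulr0 !addr0 mulr0 !add0r addrAC subrr add0r normrM.
rewrite ger0_norm ?invr_ge0 // mulrC ler_pdivrMr //.
apply: le_trans (ler_norm_sum _ _ _) _.
rewrite mulr_sumr mulr_suml; apply: ler_sum => i _.
apply: le_trans (ler_norm_sum _ _ _) _.
rewrite mulr_sumr mulr_suml; apply: ler_sum => j _.
rewrite normrM.
have -> : d * `|Y i j| * 2 = `|Y i j| * (d * 2) by ring.
apply: ler_wpM2l => //.
have le1 (l : 'I_N) (y : R) : `|cos y * (delta_mx 0 k : 'rV[R]_N) 0 l| <= 1.
  rewrite normrM mulr_ile1 //; first by rewrite ler_norml cos_geN1 cos_le1.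
  by rewrite mxE eqxx /=; case: (_ == _); rewrite ?normr1 ?normr0.
have le2 (y y' : R) (l : 'I_N) :
    `|bent d y * (cos y' * (delta_mx 0 k : 'rV[R]_N) 0 l)| <= d.
  by rewrite normrM -[leRHS]mulr1; apply: ler_pM; rewrite ?bent_le.
by apply: le_trans (ler_normD _ _) _; rewrite mulr_natr mulr2n lerD.
Qed.

Lemma gradx_quad_test d tau K p xb tb Y : d != 0 ->
  gradx (quad_test d tau K p xb tb Y) (xb, tb) = p.
Proof.
move=> d0; rewrite gradxE; apply/rowP => k.
rewrite mxE derive_quad_test // /quad_test1 /=.
rewrite [X in _ + 2^-1 * X]big1; last first.
  by move=> i _; rewrite big1 // => j _; rewrite !subrr bent0 !mul0r addr0 mulr0.
rewrite !mulr0 !addr0 mulr0 !add0r; exact: dotp_delta.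
Qed.

Lemma dtime_quad_test d tau K p xb tb Y x t : d != 0 ->
  dtime (quad_test d tau K p xb tb Y) (x, t) = tau + K * (2 * (t - tb)).
Proof.
move=> d0; rewrite dtimeE derive_quad_test // /quad_test1 /= !mulr1.
rewrite [X in _ + X + _]big1; last by move=> i _; rewrite mxE mulr0.
rewrite [X in _ + 2^-1 * X]big1; last first.
  by move=> i _; rewrite big1 // => j _; rewrite !mxE !mulr0 addr0 mulr0.
by rewrite mulr0 !addr0 mulr_natl mulr2n.
Qed.

Lemma hessx_quad_test d tau K p xb tb Y : d != 0 -> symmetric_mx Y ->
  hessx (quad_test d tau K p xb tb Y) (xb, tb) = Y.
Proof.
move=> d0 sY; rewrite hessxE; apply/matrixP => k l.
rewrite mxE derive2_quad_test //= !mulr0 add0r.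
have E (q r : 'I_N) : \sum_i \sum_j Y i j * ((delta_mx 0 q : 'rV[R]_N) 0 i
    * (delta_mx 0 r : 'rV[R]_N) 0 j) = Y q r.
  rewrite (bigD1 q) //= [X in _ + X]big1 ?addr0; last first.
    move=> i iq; rewrite big1 // => j _.
    by rewrite !mxE (negbTE iq) mul0r mulr0.
  rewrite (bigD1 r) //= [X in _ + X]big1 ?addr0; last first.
    by move=> j jr; rewrite !mxE (negbTE jr) !mulr0.
  by rewrite !mxE !eqxx !mulr1.
have -> : \sum_i \sum_j Y i j * ((delta_mx 0 k : 'rV[R]_N) 0 i
    * (delta_mx 0 l : 'rV[R]_N) 0 j + (delta_mx 0 k : 'rV[R]_N) 0 j
    * (delta_mx 0 l : 'rV[R]_N) 0 i) = Y k l + Y l k.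
  rewrite -(E k l) -(E l k) -big_split; apply: eq_bigr => i _.
  rewrite -big_split; apply: eq_bigr => j _.
  by rewrite /= -mulrDr [in RHS](mulrC ((delta_mx 0 l : 'rV[R]_N) 0 i)).
have -> : Y l k = Y k l by rewrite -{1}sY mxE.
by move: (Y k l) => y; field.
Qed.

End QuadraticTest.

(** * Dominating a C^2 function near the contact point *)

Section TouchingTest.
Context {R : realType} {N : nat}.
Local Notation V := ('rV[R]_N * R)%type.

Lemma near_pairP (P : V -> Prop) x t :
  (\forall y \near ((x, t) : V), P y) <->
  exists2 d : R, 0 < d & forall x' t', `|x' - x| < d -> `|t' - t| < d ->
    P (x', t').
Proof.
split=> [/nbhs_ballP[d d0 dP]|[d d0 dP]].
  exists d => // x' t' xd td; apply: dP; split => /=.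
    by rewrite -ball_normE /ball_ /= distrC.
  by rewrite -ball_normE /ball_ /= distrC.
apply/nbhs_ballP; exists d => // -[x' t'] [/=].
by rewrite -!ball_normE /ball_ /= !(distrC _ x') !(distrC _ t'); exact: dP.
Qed.

Lemma derive2B (W : normedModType R) (U : set W) (f g : W -> R) z v w :
  open U -> U z -> Ck 2 U f -> Ck 2 U g ->
  'D_w ('D_v (fun x => f x - g x)) z = 'D_w ('D_v f) z - 'D_w ('D_v g) z.
Proof.
move=> oU Uz Cf Cg.
have d1 x : U x -> 'D_v (fun x => f x - g x) x = 'D_v f x - 'D_v g x.
  move=> Ux; apply: deriveB; first exact: (Ck_derivable (Ck_pred Cf) Ux).
  exact: (Ck_derivable (Ck_pred Cg) Ux).
have E := near_eq_derive w (open_near_eq oU d1 Uz).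
apply: etrans E _; apply: deriveB.
  exact: (Ck_derivable (Ck_derive v Cf) Uz).
exact: (Ck_derivable (Ck_derive v Cg) Uz).
Qed.

Lemma sym_hessx (U : set V) (phi : V -> R) z : open U -> U z -> Ck 2 U phi ->
  symmetric_mx (hessx phi z).
Proof.
move=> oU Uz Cp; rewrite /symmetric_mx hessxE; apply/matrixP => i j.
rewrite mxE [LHS]mxE [RHS]mxE; exact: (deriveC _ _ oU Uz Cp).
Qed.

(** Completing the square: a time-space cross term is absorbed by the space term at the price of a
    multiple of [s ^+ 2], to be paid for by [K]. *)
Lemma young_absorb (eps s y b : R) : 0 < eps ->
  2^-1 * (s * y * b) - eps / 2 * y ^+ 2 <= s ^+ 2 * (b ^+ 2 / (8 * eps)).
Proof.
move=> e0; rewrite -subr_ge0.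
have -> : s ^+ 2 * (b ^+ 2 / (8 * eps)) -
    (2^-1 * (s * y * b) - eps / 2 * y ^+ 2) =
    (eps * y - s * b / 2) ^+ 2 / (2 * eps).
  by field; rewrite gt_eqF.
by rewrite divr_ge0 ?sqr_ge0 // mulr_ge0 // ltW.
Qed.

(** Index [ord0] is time, the others are space. After halving, the space block yields [- eps] times
    the squared space increment: one half cancels the Taylor error, the other half absorbs the cross
    terms. What remains is a multiple of the squared time increment, nonpositive by the condition on
    [B ord0 ord0]. *)
Lemma quadratic_absorb (c : 'I_N.+1 -> R) (B : 'I_N.+1 -> 'I_N.+1 -> R) eps :
  0 < eps ->
  (forall i j, B (lift ord0 i) (lift ord0 j) = - (2 * eps) *+ (j == i)) ->
  B ord0 ord0 + eps
    + 2 * \sum_j (B ord0 (lift ord0 j) + B (lift ord0 j) ord0) ^+ 2 / (8 * eps)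
    <= 0 ->
  2^-1 * (\sum_i \sum_j c i * c j * B i j) + eps / 2 * \sum_i c i ^+ 2 <= 0.
Proof.
move=> e0 BSS B00.
pose b j := B ord0 (lift ord0 j) + B (lift ord0 j) ord0.
pose s := c ord0; pose y j := c (lift ord0 j).
have -> : \sum_k c k ^+ 2 = s ^+ 2 + \sum_i y i ^+ 2 by rewrite big_ord_recl.
have -> : \sum_i \sum_j c i * c j * B i j = s ^+ 2 * B ord0 ord0
    + \sum_j s * y j * b j + \sum_j y j ^+ 2 * - (2 * eps).
  rewrite big_ord_recl big_ord_recl -expr2 -!addrA; congr (_ + _).
  have -> : \sum_(i < N) \sum_(j < N.+1) c (lift ord0 i) * c j
      * B (lift ord0 i) j = \sum_i (s * y i * B (lift ord0 i) ord0
       + y i ^+ 2 * - (2 * eps)).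
    apply: eq_bigr => i _; rewrite big_ord_recl.
    congr (_ + _); first by rewrite [X in X * _]mulrC.
    rewrite (bigD1 i) //= BSS eqxx mulr1n -expr2 big1 ?addr0 //.
    by move=> j ji; rewrite BSS (negbTE ji) mulr0n mulr0.
  rewrite big_split /= addrA; congr (_ + _); rewrite -big_split.
  by apply: eq_bigr => j _; rewrite /= /b mulrDr.
have yb : \sum_j (2^-1 * (s * y j * b j) - eps / 2 * y j ^+ 2)
    <= s ^+ 2 * \sum_j b j ^+ 2 / (8 * eps).
  by rewrite mulr_sumr; apply: ler_sum => j _; exact: young_absorb.
rewrite sumrB -!mulr_sumr in yb; rewrite -mulr_suml.
have s2 := sqr_ge0 s; have := mulr_ge0_le0 s2 B00.
move: yb e0; rewrite -/b.
move: (\sum_j s * _ * _) (\sum_i y i ^+ 2) (\sum_j _ / _) => B2 B3 B4.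
move: (B ord0 ord0) (s ^+ 2); clear => B1 s2; lra.
Qed.

(** The difference of both sides vanishes to first order at the centre. Its space Hessian is
    [- 2 * eps] times the identity, its mixed derivatives are those of [phi], and a large [K] makes
    its second time derivative as negative as needed. *)
Lemma quad_test_dominates (U : set V) (phi : V -> R) xb tb (eps d : R) :
  open U -> U (xb, tb) -> Ck 2 U phi -> 0 < eps -> d != 0 ->
  exists K : R, \forall y \near ((xb, tb) : V),
    phi y - phi (xb, tb) <= quad_test d (dtime phi (xb, tb)) K
      (gradx phi (xb, tb)) xb tb (hessx phi (xb, tb) + (2 * eps)%:M) y.
Proof.
move=> oU; set z : V := (xb, tb) => Uz Cp e0 d0.
pose E i : V := (delta_mx 0 i, 0).
pose E0 : V := (0, 1).
pose b j := 'D_E0 ('D_(E j) phi) z + 'D_(E j) ('D_E0 phi) z.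
(* The value for which the condition in [quadratic_absorb] holds with equality, the second time
   derivative of the difference being lowered by [2 * K]. *)
pose K := 2^-1 * ('D_E0 ('D_E0 phi) z + eps) + \sum_j b j ^+ 2 / (8 * eps).
exists K; set Y := hessx phi z + _; set psi := quad_test _ _ _ _ _ _ _.
have Cpsi : Ck 2 U psi by exact: Ck_quad_test.
have sY : symmetric_mx Y.
  rewrite /symmetric_mx /Y linearD /= tr_scalar_mx.
  by rewrite (sym_hessx oU Uz Cp).
pose chi y := phi y - psi y.
have Cchi : Ck 2 U chi := Ck_add oU Cp (Ck_opp oU Cpsi).
pose e (k : 'I_N.+1) : V := if unlift ord0 k is Some i then E i else E0.
have e_0 : e ord0 = E0 by rewrite /e unlift_none.
have e_S i : e (lift ord0 i) = E i by rewrite /e liftK.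
have chi1 v : 'D_v chi z = 'D_v phi z - 'D_v psi z.
  apply: deriveB; first exact: (Ck_derivable (Ck_pred Cp) Uz).
  exact: (Ck_derivable (Ck_pred Cpsi) Uz).
have D0 : 'D_E0 chi z = 0.
  rewrite (chi1 E0); have := dtimeE psi z; rewrite /psi dtime_quad_test //.
  rewrite subrr !mulr0 addr0 => <-; rewrite dtimeE; exact: subrr.
have DS i : 'D_(E i) chi z = 0.
  rewrite (chi1 (E i)).
  have := congr1 (fun p : 'rV[R]_N => p 0 i) (gradxE psi z).
  rewrite /= {1}/psi gradx_quad_test // gradxE !mxE => <-.
  exact: subrr.
have chi2 v w : 'D_w ('D_v chi) z = 'D_w ('D_v phi) z - 'D_w ('D_v psi) z.
  exact: (derive2B _ _ oU Uz Cp Cpsi).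
have psi2 v w := derive2_quad_test (dtime phi z) K (gradx phi z) xb tb Y v w d0.
have DSS i j : 'D_(E i) ('D_(E j) chi) z = - (2 * eps) *+ (i == j).
  rewrite (chi2 (E j) (E i)).
  have := congr1 (fun X : 'M[R]_N => X i j) (hessxE psi z).
  rewrite /= {1}/psi hessx_quad_test // /Y hessxE !mxE => <-.
  by rewrite opprD addrA subrr sub0r mulNrn.
have z0 (i : 'I_N) : (0 : 'rV[R]_N) 0 i = 0 by rewrite mxE.
have D00 : 'D_E0 ('D_E0 chi) z = 'D_E0 ('D_E0 phi) z - 2 * K.
  rewrite (chi2 E0 E0) (psi2 E0 E0) /= !mulr1 big1 ?mulr0 ?addr0 //.
  move=> i _; rewrite big1 // => j _.
  by rewrite !z0 !mul0r addr0 mulr0.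
have D0S j : 'D_E0 ('D_(E j) chi) z = 'D_E0 ('D_(E j) phi) z.
  rewrite (chi2 (E j) E0) (psi2 (E j) E0) /= mul0r mulr0 add0r.
  rewrite big1 ?mulr0 ?subr0 // => i _; rewrite big1 // => k _.
  by rewrite !z0 !mul0r addr0 mulr0.
have DS0 j : 'D_(E j) ('D_E0 chi) z = 'D_(E j) ('D_E0 phi) z.
  rewrite (chi2 E0 (E j)) (psi2 E0 (E j)) /= mulr0 mulr0 add0r.
  rewrite big1 ?mulr0 ?subr0 // => i _; rewrite big1 // => k _.
  by rewrite !z0 !mulr0 addr0 mulr0.
have psi0 : psi z = 0.
  rewrite /psi /quad_test /= subrr !mulr0 addr0 add0r big1 ?add0r; last first.
    by move=> i _; rewrite subrr mulr0.
  rewrite big1 ?mulr0 // => i _; rewrite big1 // => j _.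
  by rewrite subrr bent0 mul0r mulr0.
have e20 : 0 < eps / 2 by rewrite divr_gt0.
have [r r0 rP] := taylor2_upper e oU Uz Cchi e20.
apply/near_pairP; exists r => // x t xr tr.
pose c (k : 'I_N.+1) := if unlift ord0 k is Some i then (x - xb) 0 i else t - tb.
have c_0 : c ord0 = t - tb by rewrite /c unlift_none.
have c_S i : c (lift ord0 i) = (x - xb) 0 i by rewrite /c liftK.
have cr k : `|c k| < r.
  rewrite /c; case: (unlift ord0 k) => [i|//].
  exact: le_lt_trans (coord_le_norm _ _) xr.
have ce : \sum_k c k *: e k + z = (x, t).
  rewrite big_ord_recl c_0 e_0.
  under eq_bigr do rewrite c_S e_S.
  have -> : \sum_(i < N) (x - xb) 0 i *: E i = (x - xb, 0).
    rewrite {2}[x - xb]row_sum_delta.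
    elim/big_ind2 : _ => [//|p q p' q' -> ->|i _].
      by congr (_, _); rewrite /= addr0.
    by congr (_, _); rewrite /= scaler0.
  congr (_, _); rewrite /= ?scaler0 ?add0r ?addr0 ?subrK //.
  by rewrite [_%:A]mulr1 subrK.
have := rP c cr; rewrite ce.
have -> : \sum_k c k * 'D_(e k) chi z = 0.
  rewrite big_ord_recl e_0 D0 mulr0 add0r big1 // => i _.
  by rewrite e_S DS mulr0.
pose B i j := 'D_(e j) ('D_(e i) chi) z.
have B00 : B ord0 ord0 = 'D_E0 ('D_E0 phi) z - 2 * K.
  by rewrite /B e_0; exact: D00.
have BSS i j : B (lift ord0 i) (lift ord0 j) = - (2 * eps) *+ (j == i).
  by rewrite /B !e_S; exact: DSS.
have B0S j : B ord0 (lift ord0 j) = 'D_(E j) ('D_E0 phi) z.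
  by rewrite /B e_0 e_S; exact: DS0.
have BS0 j : B (lift ord0 j) ord0 = 'D_E0 ('D_(E j) phi) z.
  by rewrite /B e_0 e_S; exact: D0S.
have Bb j : B ord0 (lift ord0 j) + B (lift ord0 j) ord0 = b j.
  by rewrite B0S BS0; exact: addrC.
have := @quadratic_absorb c B eps e0 BSS.
under eq_bigr do rewrite Bb.
rewrite B00 /K.
change (\sum_i \sum_j c i * c j * 'D_(e j) ('D_(e i) chi) z) with
  (\sum_i \sum_j c i * c j * B i j).
rewrite {1 2}/chi psi0 subr0; clear.
move: (psi _) (phi _) (phi _) (\sum_i \sum_j _) (\sum_i c i ^+ 2) => A1 A2 A3 A4 A5.
move: ('D_E0 _ _) (\sum_j _ / _) => B1 B2 H1 H2.
have : B1 - 2 * (2^-1 * (B1 + eps) + B2) + eps + 2 * B2 <= 0 by lra.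
by move=> /H1 {}H1; lra.
Qed.

End TouchingTest.

(** * Subsolutions of type II are of type I *)

Section TypeIItoI.
Context {R : realType} {N : nat}.
Variables (Omega : set 'rV[R]_N) (T alpha a A : R).
Variable F : 'rV[R]_N -> 'rV[R]_N -> 'M[R]_N -> R.
Variable h : 'rV[R]_N * R -> 'rV[R]_N.
Hypothesis open_Omega : open Omega.
Hypothesis F_zero : forall x p, Omega x -> p != 0 -> F x p 0 = 0.
Hypothesis F_ell : F_elliptic Omega alpha a A F.
Hypothesis alpha_gtN1 : -1 < alpha.
Hypothesis a_gt0 : 0 < a.
Hypothesis le_aA : a <= A.
Local Notation V := ('rV[R]_N * R)%type.

Lemma admissible_quad_test (d tau K : R) (p xb : 'rV[R]_N) tb (Y : 'M[R]_N) k :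
  0 < d -> d * (\sum_i \sum_j `|Y i j|) < `|p 0 k| ->
  admissible Omega T F (quad_test d tau K p xb tb Y).
Proof.
move=> d0 dp; have oQ := open_cylinder (T := T) open_Omega; split.
  by apply: (C2_onP _ oQ).2; exact: Ck_quad_test.
move=> x t _ g0.
have := @gradx_quad_test_near R N d tau K p xb tb Y (x, t) k d0.
by rewrite g0 mxE sub0r normrN leNgt dp.
Qed.

Lemma quad_test_time (tau K : R) (xb : 'rV[R]_N) tb (z : V) :
  quad_test 1 tau K 0 xb tb 0 z = tau * (z.2 - tb) + K * ((z.2 - tb) * (z.2 - tb)).
Proof.
rewrite /quad_test [X in _ + X + _]big1; last by move=> i _; rewrite mxE mul0r.
rewrite [X in _ + 2^-1 * X]big1 ?mulr0 ?addr0 // => i _.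
by rewrite big1 // => j _; rewrite mxE mul0r.
Qed.

(** Every point is critical here, so the flatness condition is checked at all of them. The remainder
    in time is exactly [K * (t - t0)^2], and a nonnegative profile may be added to the bound. *)
Lemma admissible_time_test (tau K : R) (xb : 'rV[R]_N) tb :
  admissible Omega T F (quad_test 1 tau K 0 xb tb 0).
Proof.
have oQ := open_cylinder (T := T) open_Omega; split.
  by apply: (C2_onP _ oQ).2; exact: Ck_quad_test.
move=> x0 t0 _ _.
have [f cf f0] := classF_nonempty F_zero F_ell alpha_gtN1 a_gt0 le_aA.
exists 1, f, (fun r => `|K| * (r * r)); split=> //.
  split.
  - apply: continuous_subspaceT => r.
    have Cid := @Ck_id R 0 setT openT.
    exact: (Ck_continuous (Ck_mul openT (Ck_cst 0 setT `|K|)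
      (Ck_mul openT Cid Cid)) (I : setT r)).
  - by move=> r r0; rewrite !mulr_ge0.
  - by rewrite mulr0 mulr0.
  - apply/cvgrPdist_lt => e e0; rewrite /at_right near_withinE.
    apply/nbhs_ballP; exists (e / (`|K| + 1)).
      by rewrite /= divr_gt0 // ltr_wpDl.
    move=> r; rewrite -ball_normE /ball_ /= !sub0r !normrN => re r0.
    rewrite mulrA mulfK ?gt_eqF // normrM normr_id (gtr0_norm r0).
    rewrite (gtr0_norm r0) ltr_pdivlMr ?ltr_wpDl // in re.
    apply: le_lt_trans re; rewrite mulrC ler_wpM2l ?lerDl //.
    exact: ltW.
move=> x t _ _; rewrite dtime_quad_test ?oner_neq0 // !quad_test_time /=.
have -> : tau * (t - tb) + K * ((t - tb) * (t - tb)) -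
    (tau * (t0 - tb) + K * ((t0 - tb) * (t0 - tb))) -
    (tau + K * (2 * (t0 - tb))) * (t - t0) = K * ((t - t0) * (t - t0)) by ring.
by rewrite !normrM ler_wpDl // f0 // enorm_ge0.
Qed.

Lemma typeII_typeI_sub u :
  typeII_subsolution Omega T alpha F h u -> typeI_subsolution Omega T alpha F h u.
Proof.
move=> [cu II]; split=> // xb tb Qz; split.
  move=> U phi [oU Uz] /(C2_onP _ oU) Cp [pz up] g0.
  set z : V := (xb, tb) in Qz Uz pz up g0 *.
  have [k pk] : exists k, gradx phi z 0 k != 0.
    apply/existsP; apply: contraR g0; rewrite negb_exists => /forallP g0.
    apply/eqP/rowP => k; have := g0 k; rewrite negbK => /eqP ->.
    by rewrite mxE.
  (* What ellipticity charges, per unit of [eps], for adding [2 * eps] times the identity to the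
     Hessian. *)
  pose C := A * enorm (gradx phi z) `^ alpha * (2 * N%:R).
  suff main eps : 0 < eps -> pde alpha F h phi z <= eps * C.
    apply/ler_addgt0Pl => e e0; rewrite addr0.
    have C1 : 0 < `|C| + 1 by rewrite ltr_wpDl.
    have := main _ (divr_gt0 e0 C1) => /le_trans; apply.
    rewrite mulrAC ler_pdivrMr // ler_wpM2l ?(ltW e0) //.
    by rewrite (le_trans (ler_norm _)) // lerDl.
  move=> e0; pose Y := hessx phi z + (2 * eps)%:M.
  pose S := \sum_i \sum_j `|Y i j|.
  have S0 : 0 <= S by do 2!(apply: sumr_ge0 => ? _).
  (* Keeps [d * S] below half of the nonzero coordinate [k], so that this coordinate of the gradient
     of the test function vanishes nowhere. *)
  pose d := `|gradx phi z 0 k| / (S + 1) / 2.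
  have S1 : 0 < S + 1 by rewrite ltr_wpDl.
  have d0 : 0 < d by rewrite !divr_gt0 // normr_gt0.
  have dS : d * S < `|gradx phi z 0 k|.
    rewrite /d mulrAC ltr_pdivrMr // mulrAC ltr_pdivrMr //.
    have : 0 < `|gradx phi z 0 k| by rewrite normr_gt0.
    move: `|gradx phi z 0 k| => q q0.
    have : 0 <= q * S by rewrite mulr_ge0 // ltW.
    lra.
  have [K dom] := quad_test_dominates oU Uz Cp e0 (lt0r_neq0 d0).
  set psi := quad_test _ _ _ _ _ _ _ in dom.
  have adm : admissible Omega T F psi by exact: admissible_quad_test dS.
  have sY : symmetric_mx Y.
    rewrite /symmetric_mx /Y linearD /= tr_scalar_mx.
    by rewrite (sym_hessx oU Uz Cp).
  have gpsi : gradx psi z = gradx phi z.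
    by apply: gradx_quad_test; exact: lt0r_neq0.
  have psi0 : psi z = 0.
    rewrite /psi /quad_test /= subrr !mulr0 addr0 add0r big1 ?add0r; last first.
      by move=> i _; rewrite subrr mulr0.
    rewrite big1 ?mulr0 // => i _; rewrite big1 // => j _.
    by rewrite subrr bent0 mul0r mulr0.
  have loc : \forall y \near z, u y - psi y <= u z - psi z.
    near=> y.
    have h1 : u y <= phi y by near: y.
    have h2 : phi y - phi z <= psi y by near: y.
    rewrite psi0 -pz; move: (phi y) (phi z) (psi y) (u y) h1 h2 => b1 b2 b3 b4 h1 h2; lra.
  have [] := II psi adm z Qz loc; rewrite gpsi => /(_ g0) + _.
  have hpsi : hessx psi z = Y.
    by apply: hessx_quad_test => //; exact: lt0r_neq0.
  have tpsi : dtime psi z = dtime phi z.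
    rewrite /psi dtime_quad_test; last exact: lt0r_neq0.
    by rewrite subrr !mulr0 addr0.
  rewrite /pde gpsi hpsi tpsi.
  have Oxb : Omega z.1 by case: Qz.
  have sI : symmetric_mx ((2 * eps)%:M : 'M[R]_N) by exact: tr_scalar_mx.
  have pI : mxle 0 ((2 * eps)%:M : 'M[R]_N).
    move=> v; rewrite subr0 mul_mx_scalar -scalemxAl mxE mulr_ge0 //.
      by rewrite mulr_ge0 // ltW.
    have -> : (v *m v^T) 0 0 = dotp v v; last exact: dotp_ge0.
    by rewrite mxE; apply: eq_bigr => i _; rewrite mxE.
  have /andP[_] := F_ell Oxb g0 (sym_hessx oU Uz Cp) sI pI.
  rewrite mxtrace_scalar -/Y -[_ *+ N]mulr_natr /C.
  lra.
move=> d phi d0 dT C2 phi0 umax [c cP].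
have oI : open (`]tb - d, tb + d[ : set R)%classic by exact: interval_open.
have tI : (`]tb - d, tb + d[ : set R)%classic tb.
  by rewrite /= in_itv /=; lra.
have Cp := (C2_onP phi oI).1 C2.
have [r r0 rP] := @taylor2_upper R R _ phi tb unit (fun=> 1) 1 oI tI Cp ltr01.
pose tau := derive1 phi tb.
(* The given [phi] is C^2 on a short interval only; the Taylor bound with error 1 replaces it by a
   quadratic polynomial defined for all times. *)
pose K := 2^-1 * 'D_1 ('D_1 phi) tb + 1.
pose psi := quad_test 1 tau K (0 : 'rV[R]_N) xb tb 0.
have adm : admissible Omega T F psi by exact: admissible_time_test.
have phile t : `|t - tb| < r -> phi t <= tau * (t - tb) + K * ((t - tb) * (t - tb)).
  move=> tr; have := rP (fun=> t - tb) (fun=> tr).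
  rewrite !big_const !card_unit /= !addr0 [_ *: _]mulr1 subrK phi0 add0r.
  rewrite /tau derive1E /K; move: (phi t) ('D_1 ('D_1 phi) tb) ('D_1 phi tb).
  by move=> a1 a2 a3; rewrite expr2; lra.
have loc : \forall y \near ((xb, tb) : V), u y - psi y <= u (xb, tb) - psi (xb, tb).
  (* The constant is the supremum at [xb], hence at most [u (xb, tb)]; constancy transfers this
     bound to all nearby [x]. *)
  have cxb := nbhs_singleton cP.
  have cle : (c <= (u (xb, tb))%:E)%E.
    by rewrite -cxb; apply: ge_ereal_sup => _ [t td <-]; rewrite lee_fin; exact: umax.
  move: cP => /nbhs_ballP[r1 r10 r1P].
  apply/near_pairP; exists (Num.min r1 (Num.min d r)).
    by rewrite !lt_min r10 d0.
  move=> x t; rewrite !lt_min => /and3P[xr1 _ _] /and3P[_ td tr].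
  have := r1P x; rewrite -ball_normE /ball_ /= distrC.
  move=> /(_ xr1) xsup.
  have : ((u (x, t) - phi t)%:E <= (u (xb, tb))%:E)%E.
    apply: le_trans cle; rewrite -xsup; apply: ereal_sup_ubound.
    by exists t.
  rewrite lee_fin /psi !quad_test_time /= subrr !mulr0 addr0 subr0.
  by have := phile t tr; lra.
have [_] := II psi adm (xb, tb) Qz loc.
rewrite /psi gradx_quad_test ?oner_neq0 // dtime_quad_test ?oner_neq0 //.
by rewrite subrr !mulr0 addr0; exact.
Unshelve. all: by end_near. Qed.

End TypeIItoI.

(** * From type I to type II *)

Section AddConstant.
Context {R : realType} {N : nat}.

Lemma derive_addr (V : normedModType R) (f : V -> R) (c : R) (v x : V) :
  'D_v (fun y => f y + c) x = 'D_v f x.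
Proof.
rewrite /derive; set g1 := fun h => h^-1 *: _; set g2 := fun h => h^-1 *: _.
suff -> : g1 = g2 by [].
apply/funext => k; rewrite /g1 /g2 /=; congr (_ *: _).
by rewrite opprD addrACA subrr addr0.
Qed.

Lemma gradx_addr (phi : 'rV[R]_N * R -> R) (c : R) z :
  gradx (fun y => phi y + c) z = gradx phi z.
Proof. by rewrite !gradxE; apply: eq_mx => i j; exact: derive_addr. Qed.

Lemma hessx_addr (phi : 'rV[R]_N * R -> R) (c : R) z :
  hessx (fun y => phi y + c) z = hessx phi z.
Proof.
rewrite !hessxE; apply: eq_mx => i j.
apply: (congr1 (fun g : 'rV[R]_N * R -> R =>
  'D_((delta_mx 0 i, 0) : 'rV[R]_N * R) g z)).
by apply/funext => y; exact: derive_addr.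
Qed.

Lemma pde_addr (alpha : R) F h (phi : 'rV[R]_N * R -> R) (c : R) z :
  pde alpha F h (fun y => phi y + c) z = pde alpha F h phi z.
Proof.
rewrite /pde gradx_addr hessx_addr.
have -> // : dtime (fun y => phi y + c) z = dtime phi z.
by rewrite !dtimeE; exact: derive_addr.
Qed.

End AddConstant.

(** * The test function with movable apex *)

Section ConeTest.
Context {R : realType} {N : nat}.
Variables (f f1 f2 : R -> R).
Hypothesis df : twice_derivable_pos f f1 f2.
Local Notation V := ('rV[R]_N * R)%type.
Local Notation g := (fun x : 'rV[R]_N => f (enorm x)).

(** The factor 2 leaves a margin over the single [f] by which [u] may rise away from [xb]. *)
Definition cone_test (tau K tb : R) (y : 'rV[R]_N) (z : V) : R :=
  tau * (z.2 - tb) + K * ((z.2 - tb) * (z.2 - tb)) + 2 * f (enorm (z.1 - y)).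

Lemma open_fst_neq (y : 'rV[R]_N) : open [set z : V | z.1 - y != 0].
Proof.
have -> : [set z : V | z.1 - y != 0] =
    (fun z : V => z.1 - y) @^-1` [set x | x != 0] by [].
apply: open_comp; last exact: open_neq0.
move=> z _; apply: continuousB; first exact: cvg_fst.
exact: cst_continuous.
Qed.

Lemma Ck_cone_test tau K tb y :
  Ck 2 [set z : V | z.1 - y != 0] (cone_test tau K tb y).
Proof.
have oU : open [set z : V | z.1 - y != 0] by exact: open_fst_neq.
set U := [set z : V | _] in oU *.
have Cc (k : R) : Ck 2 U (fun _ => k) by exact: Ck_cst.
have Cx i : Ck 2 U (fun z : V => z.1 0 i - y 0 i).
  by apply: Ck_add; [exact: oU|exact: Ck_fst_coord|exact: Cc].
have Ct : Ck 2 U (fun z : V => z.2 - tb).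
  by apply: Ck_add; [exact: oU|exact: Ck_snd|exact: Cc].
have Cd : Ck 2 U (fun z : V => dotp (z.1 - y) (z.1 - y)).
  apply: (Ck_ext oU) (Ck_sum (index_enum 'I_N) oU (fun i => Ck_mul oU (Cx i) (Cx i))).
  by move=> z _; apply: eq_bigr => i _; rewrite !mxE.
have Ce : Ck 2 U (fun z : V => enorm (z.1 - y)).
  apply: (@Ck_comp _ _ _ _ (`]0, +oo[)%classic _ _ oU _ Cd).
    move=> z /= z0; rewrite in_itv /= andbT -sqr_enorm exprn_gt0 //.
    by rewrite enorm_gt0.
  apply: Ck_sqrt; first exact: interval_open.
  by move=> x; rewrite /= in_itv /= andbT.
have Cf : Ck 2 U (fun z : V => f (enorm (z.1 - y))).
  apply: (@Ck_comp _ _ _ _ (`]0, +oo[)%classic _ _ oU _ Ce).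
    by move=> z /= z0; rewrite in_itv /= andbT enorm_gt0.
  exact: Ck_profile df.
exact: (Ck_add oU (Ck_add oU (Ck_mul oU (Cc tau) Ct)
  (Ck_mul oU (Cc K) (Ck_mul oU Ct Ct))) (Ck_mul oU (Cc 2) Cf)).
Qed.

Lemma derive_cone_slice tau K tb y t x v : x - y != 0 ->
  'D_v (fun x' => cone_test tau K tb y (x', t)) x = 2 * 'D_v g (- y + x).
Proof.
rewrite addrC => xy.
have dg : derivable (fun x' => g (- y + x')) x v.
  have [d _] := is_derive_radial v df xy; exact: (derivable_translate d).
pose c := tau * (t - tb) + K * ((t - tb) * (t - tb)).
have -> : (fun x' => cone_test tau K tb y (x', t)) =
    (fun x' => 2 * g (- y + x') + c).
  by apply/funext => x'; rewrite /cone_test /= addrC [x' - y]addrC.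
apply: etrans (derive_addr _ c v x) _.
have [_ E] := is_derive_mull 2 (derivableP dg).
exact: (etrans E (congr1 (fun q => 2 * q) (derive_translate g (- y) x v))).
Qed.

Lemma gradx_cone_test tau K tb y x t : x - y != 0 ->
  gradx (cone_test tau K tb y) (x, t) = 2 *: grad g (x - y).
Proof.
move=> xy; apply/rowP => i; rewrite mxE [RHS]mxE [X in _ * X]mxE.
by rewrite [x - y]addrC; exact: derive_cone_slice.
Qed.

Lemma hessx_cone_test tau K tb y x t : x - y != 0 ->
  hessx (cone_test tau K tb y) (x, t) = 2 *: hess g (x - y).
Proof.
move=> xy; rewrite (addrC x (- y)).
apply/matrixP => i j; rewrite mxE [RHS]mxE [X in _ * X]mxE.
have oW : open [set x' : 'rV[R]_N | x' - y != 0].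
  have -> : [set x' : 'rV[R]_N | x' - y != 0] =
    (fun x' : 'rV[R]_N => x' - y) @^-1` [set x | x != 0] by [].
  apply: open_comp; last exact: open_neq0.
  move=> x' _; apply: continuousB; first exact: cvg_id.
  exact: cst_continuous.
have E := near_eq_derive (delta_mx 0 i) (open_near_eq oW
  (fun x' x'y => derive_cone_slice tau K tb t (delta_mx 0 j) x'y) xy).
apply: etrans E _.
have xy' : - y + x != 0 by rewrite addrC.
have dd : derivable ('D_(delta_mx 0 j) g) (- y + x) (delta_mx 0 i).
  exact: (Ck_derivable (Ck_derive _ (Ck_radial df)) xy').
have [_ E2] := is_derive_mull 2 (derivableP (derivable_translate dd)).
exact: (etrans E2 (congr1 (fun q => 2 * q) (derive_translate _ (- y) x _))).
Qed.

Lemma dtime_cone_test tau K tb y x t :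
  dtime (cone_test tau K tb y) (x, t) = tau + K * (2 * (t - tb)).
Proof.
rewrite /dtime derive1E /=.
pose c := 2 * f (enorm (x - y)).
have -> : (fun s => cone_test tau K tb y (x, s)) =
  (fun s => (tau * (s - tb) + K * ((s - tb) * (s - tb))) + c) by [].
apply: etrans (@derive_addr R R
  (fun s => tau * (s - tb) + K * ((s - tb) * (s - tb))) c 1 t) _.
have d0 : is_derive t 1 (fun s : R => s - tb) 1.
  rewrite -[X in is_derive _ _ _ X]addr0; apply: is_derive_add.
have [_ E] := is_derive_add (is_derive_mull tau d0)
  (is_derive_mull K (is_derive_mul d0 d0)).
apply: etrans E _; by rewrite !mulr1; congr (_ + _ * _); rewrite mulr_natl mulr2n.
Qed.

End ConeTest.

(** * Functions with flat increments are constant *)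

Section FlatImpliesConstant.
Context {R : realType} {N : nat}.

(** The segment from [xb] to [x] stays in the ball. Cut into [n] equal steps, it yields a total
    increment of at most [n * 2 * f (L / n)], which tends to 0 because [f r = o(r)]. *)
Lemma flat_increments_const (f : R -> R) (v : 'rV[R]_N -> R)
    (xb : 'rV[R]_N) (s : R) :
  (forall e, 0 < e -> exists2 d, 0 < d & forall r, 0 < r < d -> `|f r| <= e * r) ->
  (forall x y, enorm (x - xb) <= s -> enorm (y - xb) <= s ->
     v x <= v y + 2 * f (enorm (x - y))) ->
  forall x, enorm (x - xb) <= s -> v x = v xb.
Proof.
move=> flat vle x xs.
have [->//|xxb] := eqVneq x xb.
pose L := enorm (x - xb).
have L0 : 0 < L by rewrite enorm_gt0 subr_eq0.
apply/eqP; rewrite -subr_eq0 -normr_le0; apply/ler_addgt0Pl => e e0.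
rewrite addr0.
have [d d0 dP] := flat _ (divr_gt0 e0 (mulr_gt0 (ltr0n _ 2) L0)).
pose n := (Num.bound (L / d)).+1.
have n0 : (0 : R) < n%:R by rewrite ltr0n.
have nd : L / n%:R < d.
  rewrite ltr_pdivrMr // mulrC -ltr_pdivrMr //.
  apply: lt_trans (archi_boundP _) _; first by rewrite divr_ge0 // ltW.
  by rewrite ltr_nat.
pose p (k : nat) := xb + (k%:R / n%:R) *: (x - xb).
have pin k : (k <= n)%N -> enorm (p k - xb) <= s.
  move=> kn; rewrite /p addrC addKr enormZ ger0_norm ?divr_ge0 //.
  apply: le_trans xs; rewrite ler_piMl ?enorm_ge0 //.
  by rewrite ler_pdivrMr // mul1r ler_nat.
have pS k : enorm (p k.+1 - p k) = L / n%:R /\ enorm (p k - p k.+1) = L / n%:R.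
  have E : p k.+1 - p k = n%:R^-1 *: (x - xb).
    rewrite /p opprD addrACA subrr add0r -scalerBl -mulrBl -natrB //.
    by rewrite subSnn mul1r.
  have E' : enorm (p k.+1 - p k) = L / n%:R.
    by rewrite E enormZ ger0_norm ?invr_ge0 // mulrC.
  by split=> //; rewrite -enormN opprB.
have fs : 2 * f (L / n%:R) <= e / n%:R.
  have := dP (L / n%:R); rewrite divr_gt0 //= nd => /(_ isT).
  move=> /(le_trans (ler_norm _)).
  have -> : e / (2 * L) * (L / n%:R) = e / n%:R / 2.
    by field; rewrite !gt_eqF.
  move: (f _) (e / n%:R) => a1 a2; lra.
have step k : (k <= n)%N -> `|v (p k) - v (p 0%N)| <= k%:R * (e / n%:R).
  elim: k => [|k IHk] kn; first by rewrite subrr normr0 mul0r.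
  have [E1 E2] := pS k.
  have v1 := vle _ _ (pin _ kn) (pin _ (ltnW kn)).
  have v2 := vle _ _ (pin _ (ltnW kn)) (pin _ kn).
  rewrite E1 in v1; rewrite E2 in v2.
  have := IHk (ltnW kn); rewrite -natr1 mulrDl mul1r !ler_norml.
  move: (v (p k.+1)) (v (p k)) (v (p 0%N)) (f (L / n%:R)) (e / n%:R) fs v1 v2
    => a1 a2 a3 a4 a5 fs v1 v2.
  move: (k%:R * a5) => a6; lra.
have := step n (leqnn n).
have -> : p n = x by rewrite /p divff ?gt_eqF // scale1r addrC subrK.
have -> : p 0%N = xb by rewrite /p mul0r scale0r addr0.
by rewrite mulrC divfK // gt_eqF.
Qed.

End FlatImpliesConstant.

(** * The quadratic penalty in time *)

Section TimePenalty.
Context {R : realType}.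

(** The right side is the maximum of [tau / 16 * q - tau / (8 * rho) * q ^+ 2], attained at
    [q = rho / 4]. *)
Lemma time_penalty_le (tau rho s w : R) : 0 < tau -> 0 < rho ->
  w <= tau / 16 * `|s| -> w - tau / (8 * rho) * (s * s) <= tau * rho / 128.
Proof.
move=> t0 r0 wle; rewrite -[s * s]expr2 -real_normK ?num_real //.
move: `|s| wle => q wle.
have : 0 <= tau / (8 * rho) * (q - rho / 4) ^+ 2.
  by rewrite mulr_ge0 ?sqr_ge0 // divr_ge0 ?mulr_ge0 // ltW.
have -> : tau / (8 * rho) * (q - rho / 4) ^+ 2 =
    tau / (8 * rho) * q ^+ 2 - tau / 16 * q + tau * rho / 128.
  by field; rewrite gt_eqF.
move: (tau / (8 * rho) * q ^+ 2) wle => B wle; lra.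
Qed.

(** For [|s| >= rho] the quadratic term is at least [tau / 8 * |s|], twice the allowance for [w]. *)
Lemma time_penalty_far (tau rho s w : R) : 0 < tau -> 0 < rho -> rho <= `|s| ->
  w <= tau / 16 * `|s| ->
  w - tau / (8 * rho) * (s * s) <= - (tau * rho / 16).
Proof.
move=> t0 r0 rs; rewrite -[s * s]expr2 -real_normK ?num_real //.
move: `|s| rs => q rs wle.
have : tau / 8 * q <= tau / (8 * rho) * q ^+ 2.
  have -> : tau / 8 * q = tau / (8 * rho) * (rho * q).
    by field; rewrite gt_eqF.
  apply: ler_wpM2l; first by rewrite ltW // divr_gt0 // mulr_gt0.
  by rewrite expr2 ler_wpM2r // (le_trans _ rs) // ltW.
have : tau * rho <= tau * q by rewrite ler_wpM2l // ltW.
move: (tau / (8 * rho) * q ^+ 2) wle => B wle; lra.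
Qed.

Lemma little_o_bound (w : R -> R) (e : R) :
  w r / r @[r --> 0^'+] --> (0 : R) -> w 0 = 0 -> 0 < e ->
  exists2 d, 0 < d & forall s, 0 <= s -> s < d -> w s <= e * s.
Proof.
move=> /cvgrPdist_lt wr w0 e0; have := wr _ e0.
rewrite /at_right near_withinE => /nbhs_ballP[d d0 dP]; exists d => // s.
rewrite le_eqVlt => /predU1P[<-|s0] sd; first by rewrite w0 mulr0.
have := dP s; rewrite -ball_normE /ball_ /= !sub0r !normrN (gtr0_norm s0).
move=> /(_ sd s0) /ltW /(le_trans (ler_norm _)).
by rewrite ler_pdivrMr.
Qed.

End TimePenalty.

(** * Closed cylinders and continuity of the test function *)

Section Cylinders.
Context {R : realType} {N : nat}.
Local Notation V := ('rV[R]_N * R)%type.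

Lemma radial_continuous (f f1 f2 : R -> R) : twice_derivable_pos f f1 f2 ->
  f 0 = 0 ->
  (exists2 d, 0 < d & forall r, 0 < r < d -> `|f r| <= 1 * r) ->
  continuous (fun x : 'rV[R]_N => f (enorm x)).
Proof.
move=> df f0 [d d0 dP] x.
have [->|x0] := eqVneq x 0; last first.
  exact: (Ck_continuous (Ck_radial df) (x0 : [set x | x != 0] x)).
apply: (@cvgrPdist_lt R R 'rV[R]_N (nbhs (0 : 'rV[R]_N)) _ _ _).2 => e e0.
have : \forall y \near (0 : 'rV[R]_N), enorm y < Num.min d e.
  have m0 : enorm (0 : 'rV[R]_N) < Num.min d e by rewrite enorm0 lt_min d0.
  exact: (cvgr_lt _ (@enorm_continuous R N 0) _ m0).
apply: filterS => y; rewrite lt_min => /andP[yd ye]; rewrite enorm0 f0 sub0r normrN.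
have [->|y0] := eqVneq y 0; first by rewrite enorm0 f0 normr0.
apply: le_lt_trans ye; rewrite -[leRHS]mul1r; apply: dP.
by rewrite enorm_gt0 y0.
Qed.

Definition closed_cylinder (xb : 'rV[R]_N) (tb r s : R) : set V :=
  [set z | enorm (z.1 - xb) <= r /\ `|z.2 - tb| <= s].

Lemma compact_closed_cylinder xb tb r s : compact (closed_cylinder xb tb r s).
Proof.
pose B := [set x : 'rV[R]_N | enorm (x - xb) <= r].
have -> : closed_cylinder xb tb r s = B `*` (`[tb - s, tb + s])%classic.
  apply/seteqP; split=> -[x t] [/= xr ts]; split=> //=; move: ts;
    by rewrite in_itv /= ler_distl.
apply: compact_setX; last exact: segment_compact.
apply: bounded_closed_compact.
  exists (`|xb| + r); split; first exact: num_real.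
  move=> M hM x /= xr; apply: le_trans (ltW hM).
  rewrite -[x](subrK xb) addrC (le_trans (ler_normD _ _)) // lerD2l.
  exact: le_trans (norm_le_enorm _) xr.
have -> : B = (fun x : 'rV[R]_N => enorm (x - xb)) @^-1` [set s | s <= r] by [].
apply: closed_comp; last exact: closed_le.
move=> x _; apply: (@continuous_comp 'rV[R]_N 'rV[R]_N R (fun x => x - xb)
    (@enorm R N)).
  by apply: continuousB; [exact: cvg_id|exact: cst_continuous].
exact: enorm_continuous.
Qed.

Lemma near_closed_cylinder xb tb (r s : R) (z : V) :
  enorm (z.1 - xb) < r -> `|z.2 - tb| < s ->
  \forall y \near z, closed_cylinder xb tb r s y.
Proof.
case: z => x t /= xr ts; apply/near_pairP.
have N1 : (0 : R) < N%:R + 1 by rewrite ltr_wpDl.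
exists (Num.min ((r - enorm (x - xb)) / (N%:R + 1)) (s - `|t - tb|)).
  by rewrite lt_min divr_gt0 ?subr_gt0.
move=> x' t'; rewrite !lt_min => /andP[x'x _] /andP[_ t't]; split => /=.
  rewrite ltr_pdivlMr // in x'x.
  have e1 : enorm (x' - x) <= `|x' - x| * (N%:R + 1).
    apply: le_trans (enorm_le_norm _) _.
    by rewrite mulrC ler_wpM2l // lerDl.
  have := enormD (x' - x) (x - xb); rewrite addrA subrK.
  move: (enorm _) (enorm _) (enorm _) x'x e1 => a1 a2 a3.
  by move: (`|_| * _) => a4 *; lra.
have := ler_normD (t' - t) (t - tb); rewrite addrA subrK.
by move: `|_| `|_| `|_| t't => a1 a2 a3 *; lra.
Qed.

Lemma cone_test_continuous (f : R -> R) tau K tb y :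
  continuous (fun x : 'rV[R]_N => f (enorm x)) ->
  continuous (cone_test f tau K tb y : V -> R).
Proof.
move=> cg z.
have Ct : Ck 0 setT (fun z : V => z.2 - tb).
  by apply: Ck_add; [exact: openT|exact: (Ck_snd _ openT)|exact: Ck_cst].
have Cp := Ck_add openT (Ck_mul openT (Ck_cst 0 setT tau) Ct)
  (Ck_mul openT (Ck_cst 0 setT K) (Ck_mul openT Ct Ct)).
have c1 := Ck_continuous Cp (I : setT z).
apply: (continuousD c1).
apply: (@continuousM _ _ (cst 2) (fun z : V => f (enorm (z.1 - y)))).
  exact: cst_continuous.
apply: (@continuous_comp _ _ _ (fun z : V => z.1 - y) (fun x => f (enorm x))).
  by apply: continuousB; [exact: cvg_fst|exact: cst_continuous].
exact: cg.
Qed.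

End Cylinders.

(** * Smallness of the operator on flat radial functions *)

Section SmallOperator.
Context {R : realType} {N : nat}.
Variables (Omega : set 'rV[R]_N) (T alpha a A : R).
Variable F : 'rV[R]_N -> 'rV[R]_N -> 'M[R]_N -> R.
Variable h : 'rV[R]_N * R -> 'rV[R]_N.
Hypothesis F_zero : forall x p, Omega x -> p != 0 -> F x p 0 = 0.
Hypothesis F_ell : F_elliptic Omega alpha a A F.
Hypothesis alpha_gtN1 : -1 < alpha.
Hypothesis a_gt0 : 0 < a.
Hypothesis le_aA : a <= A.
Hypothesis h_bounded : exists M : R, forall z, cylinder Omega T z -> enorm (h z) <= M.

(* Ellipticity makes the decay of F at a single x0 uniform over Omega. *)
Lemma radial_operator_small (f f1 f2 : R -> R) x0 (e : R) :
  let g (x : 'rV[R]_N) := f (enorm x) in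
  twice_derivable_pos f f1 f2 ->
  (forall r, 0 < r -> 0 < f1 r) -> (forall r, 0 < r -> 0 < f2 r) ->
  (exists2 d, 0 < d & forall s, 0 < s < d -> `|f1 s| <= 1 * s) ->
  Omega x0 -> F x0 (grad g x) (hess g x) @[x --> (0 : 'rV[R]_N)^'] --> (0 : R) ->
  0 < e ->
  exists2 d, 0 < d & forall xi z, xi != 0 -> enorm xi < d -> cylinder Omega T z ->
    F z.1 (2 *: grad g xi) (2 *: hess g xi)
    + dotp (h z) (2 *: grad g xi) * enorm (2 *: grad g xi) `^ alpha < e.
Proof.
move=> g df f1p f2p [d1 d10 d1P] Ox0 Fcvg e0.
have A0 : 0 < A by exact: lt_le_trans le_aA.
(* Compares the upper elliptic bound at [z] with the lower one at [x0]: the ratio [A / a], the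
   factor 2 to the power [alpha] from the doubled gradient, and 2 from the doubled Hessian. *)
pose C := A * 2 `^ alpha * 2 / a.
have C0 : 0 < C by rewrite divr_gt0 // !mulr_gt0 // powR_gt0.
have [M hM] := h_bounded; pose M1 := `|M| + 1.
have M10 : 0 < M1 by rewrite ltr_wpDl.
move/cvgr0Pnorm_lt: Fcvg => /(_ _ (divr_gt0 e0 (mulr_gt0 (ltr0Sn R 1) C0))).
rewrite /dnbhs near_withinE => /nbhs_ballP[d2 d20 d2P].
have al : 0 < 1 + alpha by rewrite -ltrBlDl sub0r.
have /cvgrPdist_lt/(_ _ (divr_gt0 e0 (mulr_gt0 (ltr0Sn R 1) M10))) := powR_cvg0 al.
rewrite /at_right near_withinE => /nbhs_ballP[d3 d30 d3P].
exists (Num.min (Num.min d1 d2) (d3 / 2)).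
  by rewrite !lt_min d10 d20 divr_gt0.
move=> xi z xi0; rewrite !lt_min => /andP[/andP[xd1 xd2] xd3] Qz.
have r0 : 0 < enorm xi by rewrite enorm_gt0.
have f1r := f1p _ r0.
have gE : enorm (grad g xi) = f1 (enorm xi).
  exact: (enorm_grad_radial df xi0 (ltW f1r)).
have g0 : grad g xi != 0 by rewrite -enorm_gt0 gE.
have g20 : 2 *: grad g xi != 0 by rewrite scaler_eq0 negb_or g0 pnatr_eq0.
have hs : symmetric_mx (hess g xi) by exact: (sym_hess_radial df).
have hp : mxle 0 (hess g xi).
  by apply: (hess_radial_ge0 df xi0); [exact: ltW|exact/ltW/f2p].
have hs2 : symmetric_mx (2 *: hess g xi) by rewrite /symmetric_mx linearZ /= hs.
have hp2 : mxle 0 (2 *: hess g xi).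
  move=> v; have := hp v; rewrite !subr0 -scalemxAr -scalemxAl => v0.
  by rewrite mxE mulr_ge0.
have Oz : Omega z.1 by case: Qz.
have /andP[_ u1] := elliptic_pos F_zero F_ell Oz g20 hs2 hp2.
have /andP[l2 _] := elliptic_pos F_zero F_ell Ox0 g0 hs hp.
have F2 : F x0 (grad g xi) (hess g xi) < e / (2 * C).
  apply: le_lt_trans (ler_norm _) _; apply: d2P => //.
  rewrite -ball_normE /ball_ /= sub0r normrN.
  exact: le_lt_trans (norm_le_enorm _) xd2.
have qE : enorm (2 *: grad g xi) = 2 * f1 (enorm xi).
  by rewrite enormZ gE ger0_norm.
have FE : F z.1 (2 *: grad g xi) (2 *: hess g xi) < e / 2.
  apply: le_lt_trans u1 _; rewrite qE powRM ?(ltW f1r) // mxtraceZ.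
  rewrite -gE.
  have -> : A * (2 `^ alpha * enorm (grad g xi) `^ alpha) * (2 * \tr (hess g xi))
      = C * (a * enorm (grad g xi) `^ alpha * \tr (hess g xi)).
    rewrite /C; move: (2 `^ alpha) (enorm _ `^ _) (\tr _) => b1 b2 b3.
    by field; rewrite gt_eqF.
  rewrite [ltLHS]mulrC -ltr_pdivlMr //.
  apply: le_lt_trans l2 _; apply: lt_le_trans F2 _.
  by rewrite invfM mulrA.
have hE : dotp (h z) (2 *: grad g xi) * enorm (2 *: grad g xi) `^ alpha < e / 2.
  pose q := enorm (2 *: grad g xi).
  have q0 : 0 < q by rewrite enorm_gt0.
  have qd : q < d3.
    rewrite /q qE; have := d1P (enorm xi); rewrite r0 xd1 => /(_ isT).
    rewrite mul1r => /(le_trans (ler_norm _)).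
    by move: (f1 _) xd3 => b1 *; lra.
  (* The drift is bounded by a multiple of this power, whose exponent is positive. *)
  have qP : q * q `^ alpha = q `^ (1 + alpha).
    by rewrite powRD ?gt_eqF ?implybT // powRr1 // ltW.
  have := d3P q; rewrite -ball_normE /ball_ /= !sub0r !normrN (gtr0_norm q0).
  move=> /(_ qd q0); rewrite ger0_norm ?powR_ge0 // -qP => qs.
  apply: (@le_lt_trans _ _ (M1 * (q * q `^ alpha))).
    rewrite mulrA ler_wpM2r ?powR_ge0 //.
    apply: le_trans (ler_norm _) _; apply: le_trans (cauchy_schwarz _ _) _.
    rewrite ler_wpM2r ?enorm_ge0 // (le_trans (hM _ Qz)) //.
    by rewrite (le_trans (ler_norm _)) // lerDl.
  by rewrite [ltLHS]mulrC -ltr_pdivlMr // -mulrA -invfM.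
by rewrite [ltRHS]splitr ltrD.
Qed.

End SmallOperator.

Section BoundaryContradictions.
Context {R : realType}.
Variables (v u0 fx fr frs fs fxy pen : R).

(** Here [v] is the maximum, [u0] the value at the contact point, [fx], [fr], [frs], [fs], [fxy] are
    the values of [f] at [|x - xb|], [r], [r - sg], [sg], [|x - y|], and [pen] is [w1] minus the
    penalty. A maximum on the lateral boundary would be at most [u0 - fr / 4], yet
    [v > u0 - fr / 8]. *)
Lemma lateral_contradiction : u0 - 2 * fs <= v ->
  v <= u0 + fx + pen - 2 * fxy -> fx <= fr -> frs <= fxy ->
  3 / 4 * fr <= frs -> fs < fr / 16 -> pen <= fr / 4 -> 0 < fr -> False.
Proof. lra. Qed.

(** With the same notation, a maximum far from [tb] would be at most [u0 - fr]. *)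
Lemma terminal_contradiction : u0 - 2 * fs <= v ->
  v <= u0 + fx + pen - 2 * fxy -> fx <= fr -> fs < fr / 16 -> 0 <= fxy ->
  pen <= - (2 * fr) -> 0 < fr -> False.
Proof. lra. Qed.

End BoundaryContradictions.

(** * Subsolutions of type I are of type II *)

Section TypeItoII.
Context {R : realType} {N : nat}.
Variables (Omega : set 'rV[R]_N) (T alpha a A : R).
Variable F : 'rV[R]_N -> 'rV[R]_N -> 'M[R]_N -> R.
Variable h : 'rV[R]_N * R -> 'rV[R]_N.
Hypothesis open_Omega : open Omega.
Hypothesis F_zero : forall x p, Omega x -> p != 0 -> F x p 0 = 0.
Hypothesis F_ell : F_elliptic Omega alpha a A F.
Hypothesis alpha_gtN1 : -1 < alpha.
Hypothesis a_gt0 : 0 < a.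
Hypothesis le_aA : a <= A.
Hypothesis h_bounded : exists M : R, forall z, cylinder Omega T z -> enorm (h z) <= M.
Local Notation V := ('rV[R]_N * R)%type.
Local Notation QT := (cylinder Omega T).

(* Off the apex y the test function is C^2 with nonzero gradient; there clause (i)
   of type I gives a contradiction because the operator is small. *)
Lemma cone_max_at_apex u (f f1 f2 : R -> R) (tau K : R) xb tb r s z y :
  typeI_subsolution Omega T alpha F h u ->
  twice_derivable_pos f f1 f2 -> (forall r, 0 < r -> 0 < f1 r) ->
  closed_cylinder xb tb r s `<=` QT ->
  (forall z', closed_cylinder xb tb r s z' ->
    u z' - cone_test f tau K tb y z' <= u z - cone_test f tau K tb y z) ->
  enorm (z.1 - xb) < r -> `|z.2 - tb| < s ->
  (z.1 - y != 0 ->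
    F z.1 (2 *: grad (fun x => f (enorm x)) (z.1 - y))
      (2 *: hess (fun x => f (enorm x)) (z.1 - y))
    + dotp (h z) (2 *: grad (fun x => f (enorm x)) (z.1 - y))
      * enorm (2 *: grad (fun x => f (enorm x)) (z.1 - y)) `^ alpha
    < tau + K * (2 * (z.2 - tb))) ->
  z.1 = y.
Proof.
move=> [_ uI] df f1p sub zmax zr zs small; apply/eqP; rewrite -subr_eq0.
apply: contraT => zy; have {}small := small zy.
case: z zmax zr zs zy small => x t zmax /= zr zs zy small.
have Qz : QT (x, t) by apply: sub; split; exact: ltW.
have [I1 _] := uI x t Qz.
pose c := u (x, t) - cone_test f tau K tb y (x, t).
pose U : set V := QT `&` [set z | z.1 - y != 0].
have oU : open U by apply: openI; [exact: open_cylinder|exact: open_fst_neq].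
have CU : C2_on U (fun z => cone_test f tau K tb y z + c).
  apply: (C2_onP _ oU).2; apply: (Ck_add oU); last exact: Ck_cst.
  by apply: (Ck_sub _ (Ck_cone_test df tau K tb y)) => z' [].
have := I1 U _ (conj oU (conj Qz zy)) CU; rewrite gradx_addr pde_addr.
have r0 : 0 < enorm (x - y) by rewrite enorm_gt0.
have gE : gradx (cone_test f tau K tb y) (x, t) =
    2 *: grad (fun x => f (enorm x)) (x - y) by exact: (gradx_cone_test df).
have g0 : 2 *: grad (fun x => f (enorm x)) (x - y) != 0.
  rewrite -enorm_gt0 enormZ mulr_gt0 ?normr_gt0 ?pnatr_eq0 //.
  by rewrite (enorm_grad_radial df zy) ?f1p // ltW // f1p.
rewrite /pde gE (hessx_cone_test df) // dtime_cone_test => /(_ _ g0).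
have tch : touches_above u (fun z => cone_test f tau K tb y z + c) (x, t).
  split; first by rewrite /c addrC subrK.
  have := @near_closed_cylinder R N xb tb r s (x, t) zr zs; apply: filterS => z' /zmax.
  by rewrite -/c lerBlDl addrC.
move=> /(_ tch); move: small => /=.
move: (F _ _ _) (dotp _ _ * _) (K * _) => b1 b2 b3; lra.
Qed.

(** Of the type II test function only the bound from above is kept. The radius [r] is fixed first;
    [rho], [K] and [sg] are then scaled to [f r], the margin gained on the lateral boundary. *)
Lemma no_rising_touch u (f w1 : R -> R) (tau d0 : R) xb tb :
  typeI_subsolution Omega T alpha F h u -> QT (xb, tb) -> 0 < tau ->
  classF Omega F f -> w1 0 = 0 -> w1 r / r @[r --> 0^'+] --> (0 : R) ->
  0 < d0 ->
  (forall x t, enorm (x - xb) < d0 -> `|t - tb| < d0 -> QT (x, t) /\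
     u (x, t) <= u (xb, tb) + tau * (t - tb) + f (enorm (x - xb)) + w1 `|t - tb|) ->
  False.
Proof.
move=> uI Qb tau0 [f1 [f2 [C2f [f00 f10 f20] f2p Fcvg]]] w10 w1o d00 ub.
have [df f1p fp fmono] := halfline_profile C2f f00 f10 f20 f2p.
have [der1 der2 _] := C2f.
have flat e := @halfline_flat R f f1 e der1 f00 f10.
have flat1 := halfline_flat der2 f10 f20 ltr01.
have Ob : Omega xb by case: Qb.
have [cvF _] := Fcvg xb Ob.
have tau2 : 0 < tau / 2 by rewrite divr_gt0.
have [rho0 rho00 smallF] := radial_operator_small F_zero F_ell alpha_gtN1 a_gt0
  le_aA h_bounded df f1p f2p flat1 Ob cvF tau2.
have [s1 s10 w1le] := little_o_bound w1o w10 (divr_gt0 tau0 (ltr0Sn R 15)).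
have [df1 df10 flatP] := flat 1 ltr01.
(* The bound [rho0 / 2] puts any two points within [r] of [xb] at distance below [rho0]. The
   constants [96] come from [3 * rho = 96 * f r / tau] and [f r <= r]: they keep the half-height
   below [d0] and [s1]. *)
pose m := Num.min (Num.min (Num.min d0 (rho0 / 2)) df1)
                  (Num.min (tau * d0 / 96) (tau * s1 / 96)).
have m0 : 0 < m by rewrite !lt_min d00 df10 !divr_gt0 ?mulr_gt0.
pose r := m / 2; have r0 : 0 < r by rewrite divr_gt0.
have [rd0 rrho rdf rt rs] : [/\ r < d0, r < rho0 / 2, r < df1,
    r < tau * d0 / 96 & r < tau * s1 / 96].
  have : r < m by rewrite /r ltr_pdivrMr // ltr_pMr // ltr1n.
  by rewrite !lt_min => /andP[/andP[/andP[-> ->] ->] /andP[-> ->]].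
have fr0 := fp _ r0.
have frr : f r <= r.
  by rewrite -[leRHS]mul1r (le_trans (ler_norm _)) // flatP // r0.
(* With these rho and K the penalty K (t - tb)^2 beats w1 when |t - tb| >= rho,
   while the time slope of the test function stays above 3/4 tau for
   |t - tb| <= rho. *)
pose rho := 32 * f r / tau.
have rho_gt0 : 0 < rho by rewrite divr_gt0 // mulr_gt0.
have frE : f r = tau * rho / 32 by rewrite /rho; field; rewrite gt_eqF.
have rho3 : 3 * rho < d0 /\ 3 * rho < s1.
  have E : 3 * rho = 96 * f r / tau by rewrite /rho; field; rewrite gt_eqF.
  rewrite E !ltr_pdivrMr //; move: (f r) frr rt rs => b1 *; split; lra.
case: rho3 => rho3d rho3s.
pose K := tau / (8 * rho).
have KE : K * (2 * rho) = tau / 4 by rewrite /K; field; rewrite gt_eqF.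
have K0 : 0 < K by rewrite divr_gt0 // mulr_gt0.
have [d2 d20 d2P] : exists2 d, 0 < d & forall s, `|s - r| < d -> `|f s - f r| < f r / 4.
  have fr4 : 0 < f r / 4 by rewrite divr_gt0.
  have oI : open (`]0, +oo[ : set R)%classic by exact: interval_open.
  have rI : (`]0, +oo[ : set R)%classic r by rewrite /= in_itv /= r0.
  have [d d_0 dP] := Ck_near (Ck_profile df) oI rI fr4.
  by exists d => // s /dP[].
(* Apices this close to [xb] lower the cone on the lateral boundary by at most a quarter of [f r],
   and cost at most [f r / 8] at the contact point. *)
pose sg := Num.min (Num.min r d2) (Num.min df1 (f r / 16)) / 2.
have sg0 : 0 < sg by rewrite divr_gt0 // !lt_min r0 d20 df10 divr_gt0.
have [sgr sgd2 sgdf sgf] : [/\ sg < r, sg < d2, sg < df1 & sg < f r / 16].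
  have : sg < Num.min (Num.min r d2) (Num.min df1 (f r / 16)).
    rewrite /sg ltr_pdivrMr // ltr_pMr ?ltr1n //.
    by rewrite !lt_min r0 d20 df10 divr_gt0.
  by rewrite !lt_min => /andP[/andP[-> ->] /andP[-> ->]].
have fsg : f sg < f r / 16.
  apply: le_lt_trans sgf; rewrite -[leRHS]mul1r (le_trans (ler_norm _)) //.
  by rewrite flatP // sg0.
have frsg : 3 / 4 * f r <= f (r - sg).
  have := d2P (r - sg); rewrite addrC addKr normrN (gtr0_norm sg0).
  move=> /(_ sgd2); rewrite ltr_norml; move: (f r) (f _) => b1 b2; lra.
(* Maxima will satisfy [|t - tb| < rho]. The half-height [3 * rho] leaves room for a time window of
   radius [2 * rho] around any of these times, which in turn contains all the others. *)
pose Kc := closed_cylinder xb tb r (3 * rho).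
have KcQ : Kc `<=` QT.
  move=> [x t] [/= xr ts]; have [] // := ub x t.
    exact: le_lt_trans xr rd0.
  exact: le_lt_trans ts rho3d.
have oQ := open_cylinder (T := T) open_Omega.
have cont y : {within Kc, continuous (fun z => u z - cone_test f tau K tb y z)}.
  apply: continuous_in_subspaceT => z; rewrite inE => /KcQ Qz.
  apply: continuousB.
    case: uI => cu _; move: cu; rewrite continuous_open_subspace //; apply.
    by rewrite inE.
  exact/cone_test_continuous/(radial_continuous df f00 (flat 1 ltr01)).
have Kcb : Kc (xb, tb).
  by split; rewrite /= subrr ?enorm0 ?normr0 ltW // mulr_gt0.
have val0 y : u (xb, tb) - cone_test f tau K tb y (xb, tb) =
    u (xb, tb) - 2 * f (enorm (xb - y)).
  by rewrite /cone_test /= subrr !mulr0 !add0r.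
have maxP y : enorm (y - xb) <= sg -> exists z, [/\ Kc z,
    enorm (z.1 - xb) < r, `|z.2 - tb| < rho &
    forall z', Kc z' -> u z' - cone_test f tau K tb y z' <=
                        u z - cone_test f tau K tb y z].
  move=> ysg.
  have [||[x t] zK zmax] := @compact_EVT_max V R
    (fun z => u z - cone_test f tau K tb y z) Kc _ _ (cont y).
  - by exists (xb, tb).
  - exact: compact_closed_cylinder.
  rewrite inE in zK; have [/= xr ts] := zK.
  have {}zmax z' : Kc z' -> u z' - cone_test f tau K tb y z' <=
      u (x, t) - cone_test f tau K tb y (x, t).
    by move=> Kz'; apply: zmax; rewrite inE.
  have vlow : u (xb, tb) - 2 * f sg <= u (x, t) - cone_test f tau K tb y (x, t).
    apply: le_trans (zmax _ Kcb); rewrite val0 lerD2l lerN2 ler_pM2l //.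
    apply: fmono; first exact: enorm_ge0.
    by rewrite -enormN opprB.
  have [_ uub] := ub x t (le_lt_trans xr rd0) (le_lt_trans ts rho3d).
  have vup : u (x, t) - cone_test f tau K tb y (x, t) <= u (xb, tb)
      + f (enorm (x - xb)) + (w1 `|t - tb| - K * ((t - tb) * (t - tb)))
      - 2 * f (enorm (x - y)).
    rewrite /cone_test /=; move: uub.
    move: (u _) (u _) (f _) (f _) (w1 _) (K * _) (tau * _) => b1 b2 b3 b4 b5 b6 b7.
    lra.
  have wle : w1 `|t - tb| <= tau / 16 * `|t - tb|.
    by apply: w1le; [exact: normr_ge0|exact: le_lt_trans rho3s].
  have fxr : f (enorm (x - xb)) <= f r by apply: fmono; [exact: enorm_ge0|].
  have fge0 q : 0 <= q -> 0 <= f q by move=> q0; rewrite -f00; exact: fmono.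
  have fxy := fge0 _ (enorm_ge0 (x - y)).
  exists (x, t); split=> //=.
    rewrite ltNge; apply/negP => rx.
    have fxy2 : f (r - sg) <= f (enorm (x - y)).
      apply: fmono; first by rewrite subr_ge0 ltW.
      have := enormD (x - y) (y - xb); rewrite addrA subrK.
      move: (enorm _) (enorm _) (enorm _) ysg rx => b1 b2 b3 *; lra.
    have := time_penalty_le tau0 rho_gt0 wle.
    have E : tau * rho / 128 = f r / 4 by rewrite frE; field.
    rewrite E -/K => pen.
    exact: lateral_contradiction vlow vup fxr fxy2 frsg fsg pen fr0.
  rewrite ltNge; apply/negP => rt'.
  have := time_penalty_far tau0 rho_gt0 rt' wle.
  have E : tau * rho / 16 = 2 * f r by rewrite frE; field.
  rewrite E -/K => pen.
  exact: terminal_contradiction vlow vup fxr fsg fxy pen fr0.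
have apexP y : enorm (y - xb) <= sg -> exists t, `|t - tb| < rho /\
    forall z', Kc z' -> u z' - cone_test f tau K tb y z' <=
                        u (y, t) - cone_test f tau K tb y (y, t).
  move=> ysg; have [[x t] [zK /= zr zt zmax]] := maxP y ysg.
  suff xy : x = y by exists t; rewrite -[in (_, t)]xy.
  have zs : `|t - tb| < 3 * rho by apply: lt_trans zt _; lra.
  apply: (@cone_max_at_apex u f f1 f2 tau K xb tb r (3 * rho) (x, t) y) => //=.
  move=> xy.
  have := smallF (x - y) (x, t) xy.
  have xyr : enorm (x - y) < rho0.
    have := enormD (x - xb) (xb - y); rewrite addrA subrK => /le_lt_trans; apply.
    rewrite -[xb - y]opprB enormN.
    move: (enorm _) (enorm _) zr ysg => b1 b2 *; lra.
  move=> /(_ xyr (KcQ _ zK)) => /lt_le_trans; apply.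
  have : - (K * (2 * rho)) <= K * (2 * (t - tb)).
    rewrite -mulrN ler_pM2l // -mulrN ler_pM2l //.
    by move: zt; rewrite ltr_norml => /andP[/ltW].
  rewrite KE; move: (K * _) => b1; lra.
have [tm tmP] : exists tm : 'rV[R]_N -> R, forall y, enorm (y - xb) <= sg ->
    `|tm y - tb| < rho /\ forall z', Kc z' ->
      u z' - cone_test f tau K tb y z' <= u (y, tm y) - cone_test f tau K tb y (y, tm y).
  have /choice[tm tmP] : forall y, exists t, enorm (y - xb) <= sg ->
    `|t - tb| < rho /\ forall z', Kc z' ->
      u z' - cone_test f tau K tb y z' <= u (y, t) - cone_test f tau K tb y (y, t).
    move=> y; have [ysg|ysg] := pselect (enorm (y - xb) <= sg).
      by have [t tP] := apexP y ysg; exists t.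
    by exists 0 => /ysg.
  by exists tm.
pose q t := tau * (t - tb) + K * ((t - tb) * (t - tb)).
have ctE y t y' : cone_test f tau K tb y (y', t) = q t + 2 * f (enorm (y' - y)).
  by [].
pose v y := u (y, tm y) - q (tm y).
have xb_in : enorm (xb - xb) <= sg by rewrite subrr enorm0 ltW.
have inK y t : enorm (y - xb) <= sg -> `|t - tb| <= 3 * rho -> Kc (y, t).
  by move=> ysg tr; split=> //=; rewrite (le_trans ysg) // ltW.
have tmK y : enorm (y - xb) <= sg -> Kc (y, tm y).
  move=> ysg; apply: inK => //; have [/ltW + _] := tmP y ysg.
  move=> /le_trans; apply; lra.
(* The cone vanishes at its apex, so [v y] is the maximum itself. Taking [t = tm y'] gives the
   increment bound for [v]; taking [y' = y] shows that [tm y] is a maximum in time. *)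
have vge y y' t : enorm (y - xb) <= sg -> Kc (y', t) ->
    u (y', t) - q t <= v y + 2 * f (enorm (y' - y)).
  move=> ysg K'; have [_ /(_ _ K')] := tmP y ysg.
  rewrite !ctE subrr enorm0 f00 /v.
  move: (u _) (u _) (q _) (q _) (f _) => b1 b2 b3 b4 b5; lra.
have vconst x : enorm (x - xb) <= sg -> v x = v xb.
  apply: (flat_increments_const flat) => x' y' xs' ys'.
  by apply: vge => //; exact: tmK.
pose t0 := tm xb; have [t0r _] := tmP xb xb_in.
rewrite -/t0 in t0r.
(* Clause (ii) is used at [(xb, t0)], the time of the maximum over [xb], instead of the original
   contact point; hence the normalisation at [t0]. *)
pose phi t := q t + - q t0.
have rho2 : 0 < 2 * rho by rewrite mulr_gt0.
have t3 t : `|t - t0| < 2 * rho -> `|t - tb| <= 3 * rho.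
  move=> tt0; have := ler_normD (t - t0) (t0 - tb); rewrite addrA subrK.
  by move: `|_| `|_| `|_| tt0 t0r => b1 b2 b3 *; lra.
have Qt t : `|t - t0| < 2 * rho -> QT (xb, t).
  by move=> /t3 tt; apply: KcQ; exact: inK.
have Q0 : QT (xb, t0) by apply: Qt; rewrite subrr normr0.
have [_ uI2] := uI.
have [_ I2] := uI2 xb t0 Q0.
have itvE t : (`]t0 - 2 * rho, t0 + 2 * rho[)%classic t -> `|t - t0| < 2 * rho.
  by rewrite /= in_itv /= ltr_distl.
have q1 (t : R) : is_derive t 1 q (tau + K * ((t - tb) + (t - tb))).
  have d1 : is_derive t 1 (fun s : R => s - tb) 1.
    rewrite -[X in is_derive _ _ _ X]addr0; apply: is_derive_add.
  have := is_derive_add (is_derive_mull tau d1) (is_derive_mull K (is_derive_mul d1 d1)).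
  by rewrite !mulr1.
have : phi^`()%classic t0 <= 0.
  apply: (I2 (2 * rho) phi) => //.
  - by move=> t /itvE/Qt [_]; rewrite /= in_itv.
  - have oI : open (`]t0 - 2 * rho, t0 + 2 * rho[ : set R)%classic.
      exact: interval_open.
    have Ct : Ck 2 (`]t0 - 2 * rho, t0 + 2 * rho[ : set R)%classic (fun t => t - tb).
      exact: (Ck_add oI (Ck_id _ oI) (Ck_cst _ _ _)).
    apply: (C2_onP _ oI).2.
    exact: (Ck_add oI (Ck_add oI (Ck_mul oI (Ck_cst _ _ tau) Ct)
      (Ck_mul oI (Ck_cst _ _ K) (Ck_mul oI Ct Ct))) (Ck_cst _ _ _)).
  - by rewrite /phi subrr.
  - move=> t tt; have := vge xb xb t xb_in (inK _ _ xb_in (t3 _ tt)).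
    rewrite subrr enorm0 f00 /v /phi -/t0.
    move: (u _) (u _) (q _) (q _) => b1 b2 b3 b4; lra.
  (* The supremum over the window at [x] is [v x + q t0], attained at [tm x]; by constancy of [v] it
     equals [v xb + q t0 = u (xb, t0)]. *)
  exists (u (xb, t0))%:E.
  have : \forall x \near xb, enorm (x - xb) < sg.
    have cx : {for xb, continuous (fun x : 'rV[R]_N => enorm (x - xb))}.
      apply: (@continuous_comp 'rV[R]_N 'rV[R]_N R (fun x => x - xb) (@enorm R N)).
        by apply: continuousB; [exact: cvg_id|exact: cst_continuous].
      exact: enorm_continuous.
    have lt0 : enorm (xb - xb) < sg by rewrite subrr enorm0.
    exact: (cvgr_lt _ cx _ lt0).
  apply: filterS => x /ltW xs.
  have vE := vconst x xs.
  apply/eqP; rewrite eq_le; apply/andP; split.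
    apply: ge_ereal_sup => _ [t tt <-]; rewrite lee_fin.
    have := vge x x t xs (inK _ _ xs (t3 _ tt)).
    rewrite subrr enorm0 f00 vE /v /phi -/t0.
    move: (u _) (u _) (q _) (q _) => b1 b2 b3 b4; lra.
  apply: ereal_sup_ubound; exists (tm x) => /=.
    have [tx _] := tmP x xs.
    have := ler_normB (tm x - tb) (t0 - tb); rewrite opprB addrA subrK.
    by move: `|_| `|_| `|_| tx t0r => b1 b2 b3 *; lra.
  congr EFin; move: vE; rewrite /v /phi -/t0.
  move: (u _) (u _) (q _) (q _) => b1 b2 b3 b4; lra.
have [_ E] := q1 t0.
rewrite derive1E [X in X <= 0](@derive_addr R R q (- q t0) 1 t0) E.
have : - (K * (2 * rho)) <= K * (t0 - tb + (t0 - tb)).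
  rewrite -mulrN ler_pM2l //; move: t0r; rewrite ltr_norml; lra.
rewrite KE; move: (K * _) => b1; lra.
Qed.

Lemma typeI_typeII_sub u :
  typeI_subsolution Omega T alpha F h u -> typeII_subsolution Omega T alpha F h u.
Proof.
move=> uI; have [cu I] := uI; split=> // phi [C2 adm] [xb tb] Qz loc.
have oQ := open_cylinder (T := T) open_Omega.
split.
  move=> g0; have [I1 _] := I xb tb Qz.
  pose c := u (xb, tb) - phi (xb, tb).
  have Cc : C2_on QT (fun y => phi y + c).
    apply: (C2_onP _ oQ).2; apply: (Ck_add oQ); last exact: Ck_cst.
    exact: (C2_onP _ oQ).1.
  have tch : touches_above u (fun y => phi y + c) (xb, tb).
    split; first by rewrite /c addrC subrK.
    by apply: filterS loc => y; rewrite -/c lerBlDl addrC.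
  have := I1 QT _ (conj oQ Qz) Cc tch.
  by rewrite gradx_addr pde_addr; exact.
move=> g0; rewrite leNgt; apply/negP => tau0.
have [d [f [w1 [d0 cf [_ _ w10 w1o] bnd]]]] := adm xb tb Qz g0.
have QN : \forall y \near ((xb, tb) : V), QT y by exact: open_nbhs_nbhs.
have [d1 d10 d1P] := (near_pairP (fun y => u y - phi y <= u (xb, tb) - phi (xb, tb)
  /\ QT y) xb tb).1 (filterI loc QN).
(* Half of [d] for space and half for time keep the sum of the two distances below [d]. *)
apply: (@no_rising_touch u f w1 (dtime phi (xb, tb)) (Num.min d1 (d / 2)) xb tb) => //.
  by rewrite lt_min d10 divr_gt0.
move=> x t; rewrite !lt_min => /andP[xd1 xd2] /andP[td1 td2].
have [] := d1P x t (le_lt_trans (norm_le_enorm _) xd1) td1.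
move=> /= le1 Qxt; split=> //.
have := bnd x t Qxt; rewrite [d]splitr => /(_ (ltrD xd2 td2)).
move=> /(le_trans (ler_norm _)); move: le1.
move: (u _) (u _) (phi _) (phi _) (dtime _ _ * _) (f _) (w1 _).
by move=> b1 b2 b3 b4 b5 b6 b7; lra.
Qed.

End TypeItoII.

(** * Supersolutions by reflection *)

Section Reflection.
Context {R : realType} {N : nat}.
Local Notation V := ('rV[R]_N * R)%type.
Implicit Types (F : 'rV[R]_N -> 'rV[R]_N -> 'M[R]_N -> R).

(* -u is a subsolution for flip F exactly when u is a supersolution for F. *)
Definition flip F : 'rV[R]_N -> 'rV[R]_N -> 'M[R]_N -> R :=
  fun x p X => - F x (- p) (- X).

Lemma flipK F : flip (flip F) = F.
Proof.
apply/funext => x; apply/funext => p; apply/funext => X.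
by rewrite /flip !opprK.
Qed.

Lemma negfunK (T : Type) (u : T -> R) : (fun z => - - u z) = u.
Proof. by apply/funext => z; rewrite opprK. Qed.

(** Adding [P] leads from [- (M + P)] to [- M], so the increment of [flip F] is an increment of [F]
    at the gradient [- p], which has the same norm. *)
Lemma flip_elliptic Omega alpha (a A : R) F :
  F_elliptic Omega alpha a A F -> F_elliptic Omega alpha a A (flip F).
Proof.
move=> ell x p M P Ox p0 sM sP P0.
have sMP : symmetric_mx (- (M + P)).
  apply: symmetric_mxN; rewrite /symmetric_mx linearD /=.
  by rewrite /symmetric_mx in sM sP; rewrite sM sP.
have := @ell x (- p) (- (M + P)) P Ox _ sMP sP P0.
rewrite oppr_eq0 enormN => /(_ p0).
have -> : - (M + P) + P = - M by rewrite opprD subrK.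
by rewrite /flip opprK [- F _ _ _ + _]addrC.
Qed.

Section Derivatives.
Variables (U : set V) (phi : V -> R) (z : V).
Hypotheses (oU : open U) (Uz : U z) (Cphi : Ck 2 U phi).

Lemma gradxN : gradx (fun y => - phi y) z = - gradx phi z.
Proof.
apply/rowP => i; rewrite !gradxE !mxE.
exact: (deriveN (Ck_derivable (Ck_pred Cphi) Uz)).
Qed.

Lemma dtimeN : dtime (fun y => - phi y) z = - dtime phi z.
Proof.
rewrite !dtimeE; exact: (deriveN (Ck_derivable (Ck_pred Cphi) Uz)).
Qed.

Lemma hessxN : hessx (fun y => - phi y) z = - hessx phi z.
Proof.
apply/matrixP => i j; rewrite !hessxE !mxE.
have E y : U y -> 'D_((delta_mx 0 j, 0) : V) (fun y => - phi y) y =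
    - 'D_((delta_mx 0 j, 0) : V) phi y.
  by move=> Uy; exact: (deriveN (Ck_derivable (Ck_pred Cphi) Uy)).
apply: etrans (near_eq_derive _ (open_near_eq oU E Uz)) _.
exact: (deriveN (Ck_derivable (Ck_derive _ Cphi) Uz)).
Qed.

Lemma dotpNN (alpha : R) (p q : 'rV[R]_N) :
  dotp p (- q) * enorm (- q) `^ alpha = - (dotp p q * enorm q `^ alpha).
Proof. by rewrite dotpNr enormN mulNr. Qed.

Lemma pdeN (alpha : R) F h :
  pde alpha F h (fun y => - phi y) z = - pde alpha (flip F) h phi z.
Proof.
rewrite /pde gradxN hessxN dtimeN dotpNN /flip.
by rewrite !opprD !opprK.
Qed.

End Derivatives.

Lemma C2_onN (W : normedModType R) (U : set W) (f : W -> R) :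
  open U -> C2_on U f -> C2_on U (fun x => - f x).
Proof.
by move=> oU /(C2_onP _ oU) Cf; apply: (C2_onP _ oU).2; exact: Ck_opp.
Qed.

Lemma within_continuousN (U : set V) (u : V -> R) :
  {within U, continuous u} -> {within U, continuous (fun z => - u z)}.
Proof. by move=> cu z; apply: continuousN; exact: cu. Qed.

Lemma ereal_infN_image (T : Type) (D : set T) (k : T -> R) :
  ereal_inf [set (k t)%:E | t in D] = (- ereal_sup [set (- k t)%:E | t in D])%E.
Proof.
rewrite ereal_infEN image_comp; congr (- ereal_sup _)%E.
Qed.

Variables (Omega : set 'rV[R]_N) (T alpha : R).
Variable h : V -> 'rV[R]_N.
Hypothesis open_Omega : open Omega.
Local Notation QT := (cylinder Omega T).

Lemma derive1N_itv (phi : R -> R) tb d : 0 < d ->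
  C2_on (`]tb - d, tb + d[ : set R)%classic phi ->
  (fun t => - phi t)^`()%classic tb = - phi^`()%classic tb.
Proof.
move=> d0 C2; have oI : open (`]tb - d, tb + d[ : set R)%classic.
  exact: interval_open.
have tI : (`]tb - d, tb + d[ : set R)%classic tb by rewrite /= in_itv /=; lra.
have Cp := (C2_onP _ oI).1 C2.
by rewrite !derive1E; exact: (deriveN (Ck_derivable (Ck_pred Cp) tI)).
Qed.

Lemma typeI_super_flip F u : typeI_supersolution Omega T alpha F h u ->
  typeI_subsolution Omega T alpha (flip F) h (fun z => - u z).
Proof.
move=> [cu I]; split; first exact: within_continuousN.
move=> xb tb Qz; have [I1 I2] := I xb tb Qz; split.
  move=> U phi [oU Uz] C2 [pz up] g0.
  have Cp := (C2_onP _ oU).1 C2.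
  have tb' : touches_below u (fun y => - phi y) (xb, tb).
    split; first by rewrite pz opprK.
    by apply: filterS up => y; rewrite lerNl.
  have := I1 U _ (conj oU Uz) (C2_onN oU C2) tb'.
  rewrite (gradxN Uz Cp) oppr_eq0 (pdeN oU Uz Cp) oppr_ge0; exact.
move=> d phi d0 dT C2 p0 umax [c cP].
have oI : open (`]tb - d, tb + d[ : set R)%classic by exact: interval_open.
have := I2 d (fun t => - phi t) d0 dT (C2_onN oI C2).
rewrite (derive1N_itv d0 C2) oppr_ge0; apply.
- by rewrite p0 oppr0.
- by move=> t /umax; rewrite opprK lerBlDr => ?; lra.
exists (- c)%E; apply: filterS cP => x <-.
rewrite ereal_infN_image; congr (- ereal_sup _)%E.
by apply: eq_imagel => t _; rewrite opprK opprD.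
Qed.

Lemma typeI_sub_flip F u : typeI_subsolution Omega T alpha F h u ->
  typeI_supersolution Omega T alpha (flip F) h (fun z => - u z).
Proof.
move=> [cu I]; split; first exact: within_continuousN.
move=> xb tb Qz; have [I1 I2] := I xb tb Qz; split.
  move=> U phi [oU Uz] C2 [pz up] g0.
  have Cp := (C2_onP _ oU).1 C2.
  have ta : touches_above u (fun y => - phi y) (xb, tb).
    split; first by rewrite pz opprK.
    by apply: filterS up => y; rewrite lerNr.
  have := I1 U _ (conj oU Uz) (C2_onN oU C2) ta.
  rewrite (gradxN Uz Cp) oppr_eq0 (pdeN oU Uz Cp) oppr_le0; exact.
move=> d phi d0 dT C2 p0 umin [c cP].
have oI : open (`]tb - d, tb + d[ : set R)%classic by exact: interval_open.
have := I2 d (fun t => - phi t) d0 dT (C2_onN oI C2).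
rewrite (derive1N_itv d0 C2) oppr_le0; apply.
- by rewrite p0 oppr0.
- by move=> t /umin => ?; lra.
exists (- c)%E; apply: filterS cP => x <-.
rewrite ereal_infN_image oppeK; congr (ereal_sup _)%E.
by apply: eq_imagel => t _; rewrite opprD !opprK.
Qed.

(** [flip] exchanges the two limits demanded by the class. *)
Lemma classF_flip F f : classF Omega F f -> classF Omega (flip F) f.
Proof.
move=> [f1 [f2 [C2 f0 fp Fcvg]]]; exists f1, f2; split=> // g x0 Ox0.
have [/cvgr0Pnorm_lt c1 /cvgr0Pnorm_lt c2] := Fcvg x0 Ox0.
split; apply/cvgr0Pnorm_lt => e e0.
  by apply: filterS (c2 e e0) => x; rewrite /flip normrN.
by apply: filterS (c1 e e0) => x; rewrite /flip normrN !opprK.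
Qed.

Lemma admissible_flip F phi :
  admissible Omega T F phi -> admissible Omega T (flip F) (fun z => - phi z).
Proof.
have oQ := open_cylinder (T := T) open_Omega.
move=> [C2 adm]; split; first exact: C2_onN.
have Cp := (C2_onP _ oQ).1 C2.
move=> xb tb Qz; rewrite (gradxN Qz Cp) => /eqP; rewrite oppr_eq0 => /eqP g0.
have [d [f [w1 [d0 cf w1P bnd]]]] := adm xb tb Qz g0.
exists d, f, w1; split=> //; first exact: classF_flip.
move=> x t Qxt xt; rewrite (dtimeN Qz Cp) mulNr -!opprD normrN; exact: bnd.
Qed.

Lemma typeII_super_flip F u : typeII_supersolution Omega T alpha F h u ->
  typeII_subsolution Omega T alpha (flip F) h (fun z => - u z).
Proof.
have oQ := open_cylinder (T := T) open_Omega.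
move=> [cu II]; split; first exact: within_continuousN.
move=> phi adm z Qz loc.
have Cp := (C2_onP _ oQ).1 adm.1.
have := admissible_flip adm; rewrite flipK => adm'.
have [|h1 h2] := II _ adm' z Qz.
  by apply: filterS loc => y; rewrite !opprK -!opprD lerN2.
rewrite (gradxN Qz Cp) in h1 h2; split=> g0.
  by move: h1; rewrite oppr_eq0 (pdeN oQ Qz Cp) oppr_ge0; exact.
by move: h2; rewrite g0 oppr0 (dtimeN Qz Cp) oppr_ge0; exact.
Qed.

Lemma typeII_sub_flip F u : typeII_subsolution Omega T alpha F h u ->
  typeII_supersolution Omega T alpha (flip F) h (fun z => - u z).
Proof.
have oQ := open_cylinder (T := T) open_Omega.
move=> [cu II]; split; first exact: within_continuousN.
move=> phi adm z Qz loc.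
have Cp := (C2_onP _ oQ).1 adm.1.
have := admissible_flip adm; rewrite flipK => adm'.
have [|h1 h2] := II _ adm' z Qz.
  by apply: filterS loc => y; rewrite !opprK -!opprD lerN2.
rewrite (gradxN Qz Cp) in h1 h2; split=> g0.
  by move: h1; rewrite oppr_eq0 (pdeN oQ Qz Cp) oppr_le0; exact.
by move: h2; rewrite g0 oppr0 (dtimeN Qz Cp) oppr_le0; exact.
Qed.

End Reflection.


Theorem proposition12 (R : realType) (N : nat) (Omega : set 'rV[R]_N)
    (T alpha a A : R)
    (F : 'rV[R]_N -> 'rV[R]_N -> 'M[R]_N -> R)
    (h : 'rV[R]_N * R -> 'rV[R]_N)
    (N_gt0 : (0 < N)%N)
    (T_gt0 : 0 < T) (alpha_gtN1 : -1 < alpha) (alpha_neq0 : alpha != 0)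
    (a_gt0 : 0 < a) (le_aA : a <= A)
    (dom_Omega : bounded_domain Omega)
    (cone_Omega : exterior_cone_condition Omega)
    (F_cont : F_continuous Omega F)
    (F_hom : F_homogeneous Omega alpha F)
    (F_ell : F_elliptic Omega alpha a A F)
    (F_str : F_structure Omega F)
    (h_ass : h_assumptions Omega T alpha h)
    (u : 'rV[R]_N * R -> R)
    (u_cont : {within cylinder Omega T, continuous u}) :
  typeI_solution Omega T alpha F h u <-> typeII_solution Omega T alpha F h u.
Proof.
have [_ oO _ _] := dom_Omega.
(* Homogeneity with [mu = 0]. *)
have F0 x p : Omega x -> p != 0 -> F x p 0 = 0.
  move=> Ox p0; have := F_hom 1 0 x p 0 (oner_neq0 R) (lexx 0) Ox p0 symmetric_mx0.
  by rewrite scale1r scale0r mulr0 mul0r.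
have fF0 x p : Omega x -> p != 0 -> flip F x p 0 = 0.
  by move=> Ox p0; rewrite /flip oppr0 F0 ?oppr0 // oppr_eq0.
have fell := flip_elliptic F_ell.
have [_ hb _] := h_ass.
have sub12 F' := @typeI_typeII_sub R N Omega T alpha a A F' h oO.
have sub21 F' := @typeII_typeI_sub R N Omega T alpha a A F' h oO.
split=> -[sub super]; split.
- exact: sub12.
(* Writing [F] as a double flip and [u] as a double negative turns the goal into a statement about
   the subsolution [- u] for [flip F]. *)
- rewrite -(flipK F) -(negfunK u); apply: typeII_sub_flip => //.
  by apply: sub12 => //; exact: typeI_super_flip.
- exact: sub21.
- rewrite -(flipK F) -(negfunK u); apply: typeI_sub_flip => //.
  by apply: sub21 => //; exact: typeII_super_flip.
Qed.
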